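(* Let $s\ge1$, let $\nu>1$, let $\mu,\mu_0\in\mathbb{R}^s$, let $\Sigma,\Sigma_0\in\mathbb{R}^{s\times s}$ be symmetric positive definite, let $L\in\mathbb{R}^{s\times s}$ satisfy $LL^T=\Sigma$, and let $G_{\mathrm{tIS}}(z)=G_0(\mu+Lz)\,W_t(\mu+Lz)$, where $G_0(z)=f(z)\exp(-n\Psi(z))$ and, for $x=\mu+Lz$, $$W_t(x)=\frac{|\Sigma|^{1/2}}{(2\pi)^{s/2}|\Sigma_0|^{1/2}}\exp\Big\{-\frac12\|\mu+Lz-\mu_0\|_{\Sigma_0}^2\Big\}\prod_{i=1}^s\frac{\sqrt{\nu\pi}\,\Gamma(\frac\nu2)}{\Gamma(\frac{\nu+1}2)}\Big(1+\frac{z_i^2}\nu\Big)^{\frac{\nu+1}2}.$$ Suppose there exist $B>0$ and $M\in\mathbb{R}$ such that for every $a\in\mathbb{N}_0^s$ with $|a|\le s$ and every $z\in\mathbb{R}^s$, $|D^aG_0(z)|\le B\exp\{M\|z\|^2\}$. If $$\frac1{\lambda_{\max}(\Sigma_0)}-2M>0,$$ then a randomly shifted lattice rule $\hat I_s(G_{\mathrm{tIS}}\circ\Phi^{-1})$ with $N$ points can be constructed by the CBC algorithm with a root mean squared error of $O(N^{-1+\frac1{2\nu}+\epsilon})$ for arbitrarily small $\epsilon>0$, where $\Phi$ is the distribution function of the $t$-distribution $t_\nu$; that is, for every $\epsilon>0$ there are an $\alpha>0$ with $2\alpha+1<\nu$ and a constant $C$ independent of $N$ such that for every $N\ge2$ the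 generating vector produced by the CBC algorithm (run with this $\alpha$) satisfies $$\sqrt{\mathbb{E}^\Delta|I_{s,\phi}(G_{\mathrm{tIS}})-\hat I_s(G_{\mathrm{tIS}}\circ\Phi^{-1})|^2}\le C\,N^{-1+\frac1{2\nu}+\epsilon}.$$
   Context: Setting: $f,\Psi:\mathbb{R}^s\to\mathbb{R}$, $n\in\mathbb{N}$ a fixed noise-level parameter. The prior is $N(\mu_0,\Sigma_0)$; the importance sampling proposal is the law of $\mu+LZ$ with $Z_i$ i.i.d. $t_\nu$, and $W_t$ is the ratio of prior and proposal densities. For positive definite $E$, $\|x\|_E^2=x^TE^{-1}x$; $\|x\|^2=x^Tx$; $\lambda_{\max}(E)$ is the largest eigenvalue; $|E|$ the determinant; $\Gamma(\cdot)$ the gamma function. For $a\in\mathbb{N}_0^s$, $|a|=\sum_ia_i$ and $D^aG=\frac{\partial^{|a|}}{\partial z_1^{a_1}\cdots\partial z_s^{a_s}}G$; derivatives appearing in hypotheses are understood to exist and be continuous. $\phi(t)=\frac{\Gamma(\frac{\nu+1}2)}{\sqrt{\nu\pi}\,\Gamma(\frac\nu2)}\big(1+\frac{t^2}\nu\big)^{-\frac{\nu+1}2}$ is the density of $t_\nu$, $\Phi$ its distribution function, $\Phi^{-1}$ its quantile function (applied componentwise), $\phi(z)=\prod_j\phi(z_j)$. The weight function is $\psi(t)=(1+|t|)^{-\alpha}$ with $\alpha>0$, $2\alpha+1<\nu$. Fixed weights $\gamma_u>0$, $u\subseteq 1{:}s=\{1,\dots,s\}$, are given. $I_{s,\phi}(G)=\int_{\mathbb{R}^s}G(z)\phi(z)\,dz$.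 The randomly shifted (rank-1) lattice rule with generating vector $z^*\in\mathbb{N}^s$ is $$\hat I_s(G\circ\Phi^{-1})=\frac1N\sum_{k=0}^{N-1}G\Big(\Phi^{-1}\big(\{kz^*/N+\Delta\}\big)\Big),$$ where $\{\cdot\}$ is the componentwise fractional part and $\Delta$ is uniform on $(0,1)^s$; $\mathbb{E}^\Delta$ is expectation over $\Delta$. CBC (component-by-component) algorithm: for $d\le s$ put $$e_d^{\rm sh}(z_1^*,\dots,z_d^* )^2=\sum_{\emptyset\ne u\subseteq 1:d}\frac{\gamma_u}{N}\sum_{k=0}^{N-1}\prod_{j\in u}\theta(\{kz_j^*/N\}),$$ $$\theta(c)=\int_{-\infty}^\infty\frac{\max(\Phi(t)-c,0)+\max(\Phi(t)-1+c,0)-\Phi(t)^2}{\psi(t)^2}\,dt .$$ Set $z_1^*=1$; for $d=2,\dots,s$, with $z_1^*,\dots,z_{d-1}^*$ fixed, choose $z_d^*\in\{0,\dots,N-1\}$ with $\gcd(z_d^*,N)=1$ minimizing $e_d^{\rm sh}(z_1^*,\dots,z_d^* )$. *)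

(* Defs.v *)
From HB Require Import structures.
From mathcomp Require Import all_boot all_order all_algebra.
From mathcomp Require Import all_classical all_reals all_analysis.

Set Implicit Arguments.
Unset Strict Implicit.
Unset Printing Implicit Defensive.

Import Order.TTheory GRing.Theory Num.Theory.
Import numFieldNormedType.Exports.

Local Open Scope classical_set_scope.
Local Open Scope ring_scope.

Section lebesgue_tuple.
Context {R : realType}.
Local Notation mR := (measurableTypeR R).

Definition tcons n (p : n.-tuple mR * mR) : n.+1.-tuple mR :=
  [tuple of p.2 :: p.1].

Lemma measurable_tcons n : measurable_fun [set: n.-tuple mR * mR] (@tcons n).
Proof. by apply: measurable_cons. Qed.

HB.instance Definition _ n :=
  isMeasurableFun.Build _ _ _ _ (@tcons n) (@measurable_tcons n).

Section lebesgue_cons.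
Variables (n : nat) (m : {measure set (n.-tuple mR) -> \bar R}).

Definition lebesgue_cons : set (n.+1.-tuple mR) -> \bar R :=
  pushforward (m \x @lebesgue_measure R)%E (@tcons n).

Let lebesgue_cons0 : lebesgue_cons set0 = 0%E.
Proof. exact: measure0. Qed.

Let lebesgue_cons_ge0 A : (0 <= lebesgue_cons A)%E.
Proof. exact: measure_ge0. Qed.

Let lebesgue_cons_sigma_additive : semi_sigma_additive lebesgue_cons.
Proof. exact: measure_semi_sigma_additive. Qed.

HB.instance Definition _ := isMeasure.Build _ _ _ lebesgue_cons
  lebesgue_cons0 lebesgue_cons_ge0 lebesgue_cons_sigma_additive.

End lebesgue_cons.

(* Lebesgue measure on [R^n]: [R^(n+1)] carries the image under [tcons] of the
   product of the Lebesgue measures of [R^n] and [R]. *)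
Fixpoint lebesgue_tuple n : {measure set (n.-tuple mR) -> \bar R} :=
  if n is m.+1 then lebesgue_cons (lebesgue_tuple m)
  else \d_ ([tuple] : 0.-tuple mR).

End lebesgue_tuple.

Section calculus.
Context {R : realType} {s : nat}.
Implicit Type g : 'cV[R]_s -> R.

Definition partial (i : 'I_s) g : 'cV[R]_s -> R := 'D_(delta_mx i ord0) g.

(* All iterated partial derivatives of order at most [k], in any order of
   differentiation, exist and are continuous. *)
Fixpoint Ck (k : nat) g : Prop :=
  continuous g /\
  if k is k'.+1 then
    forall i, (forall x, derivable g x (delta_mx i ord0)) /\ Ck k' (partial i g)
  else True.

(* [D^a g], with the derivative in the last coordinate taken first. *)
Definition mderive (a : 'I_s -> nat) g : 'cV[R]_s -> R :=
  foldr (fun i h => iter (a i) (partial i) h) g (enum 'I_s).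

End calculus.

Section matrices.
Context {R : realType} {s : nat}.
Implicit Types (E : 'M[R]_s) (x : 'cV[R]_s).

Definition sqnorm x : R := (x^T *m x) 0 0.

(* [||x||_E^2] *)
Definition sqnorm_mx E x : R := (x^T *m invmx E *m x) 0 0.

Definition sym_posdef E : Prop :=
  E^T = E /\ forall x, x != 0 -> 0 < (x^T *m E *m x) 0 0.

Definition lambda_max E : R := sup [set a | eigenvalue E a].

End matrices.

Section student.
Context {R : realType}.
Local Notation lebesgue := (@lebesgue_measure R).

Definition Gamma (a : R) : R :=
  \int[lebesgue]_(t in `]0, +oo[) (t `^ (a - 1) * expR (- t)).

Definition t_const (nu : R) : R :=
  Gamma ((nu + 1) / 2) / (Num.sqrt (nu * pi) * Gamma (nu / 2)).

Definition t_density (nu t : R) : R :=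
  t_const nu * (1 + t ^+ 2 / nu) `^ (- ((nu + 1) / 2)).

Definition t_cdf (nu t : R) : R :=
  \int[lebesgue]_(x in `]-oo, t]) t_density nu x.

Definition t_quantile (nu u : R) : R := inf [set t | u <= t_cdf nu t].

Definition psi (alpha t : R) : R := (1 + `|t|) `^ (- alpha).

Definition frac (x : R) : R := x - (Num.floor x)%:~R.

Definition theta (nu alpha c : R) : R :=
  \int[lebesgue]_t
    ((Num.max (t_cdf nu t - c) 0 + Num.max (t_cdf nu t - 1 + c) 0
      - t_cdf nu t ^+ 2) / psi alpha t ^+ 2).

End student.

Section lattice_rule.
Context {R : realType} {s : nat}.
Implicit Types (nu alpha : R) (N : nat) (z : 'I_s -> nat) (G : 'cV[R]_s -> R).

Definition I_phi nu G : R :=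
  \int[lebesgue_tuple s]_(t in setT)
    (G (\col_i tnth t i) * \prod_(i < s) t_density nu (tnth t i)).

Definition lattice_rule nu N z G (Delta : s.-tuple R) : R :=
  N%:R^-1 * \sum_(k < N)
    G (\col_i t_quantile nu (frac (k%:R * (z i)%:R / N%:R + tnth Delta i))).

Definition unit_cube : set (s.-tuple (measurableTypeR R)) :=
  [set t | forall i, 0 < tnth t i < 1].

(* The expectation over the uniform shift is the integral over the open unit
   cube.  It is kept extended-real-valued, so that an infinite mean squared
   error is not read as zero. *)
Definition rmse nu N z G : \bar R :=
  sqrte (\int[lebesgue_tuple s]_(D in unit_cube)
    (`|I_phi nu G - lattice_rule nu N z G D| ^+ 2)%:E)%E.

(* Coordinates are numbered from [0]: the set [1:d] is [{i : 'I_s | i < d}],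
   and only the first [d] entries of [z] matter. *)
Definition e_sh (gamma : {set 'I_s} -> R) nu alpha N (d : nat) z : R :=
  Num.sqrt (\sum_(u : {set 'I_s} |
                  (u != finset.set0) && (u \subset [set i : 'I_s | (i < d)%N]%SET))
    gamma u / N%:R *
      \sum_(k < N) \prod_(j in u)
        theta nu alpha (frac (k%:R * (z j)%:R / N%:R))).

Definition replace z (j : 'I_s) (w : nat) : 'I_s -> nat :=
  fun i => if i == j then w else z i.

(* [z] is a possible output of the CBC algorithm: no particular way of breaking
   ties between minimizers is assumed. *)
Definition cbc_vector (gamma : {set 'I_s} -> R) nu alpha N z : Prop :=
  forall j : 'I_s,
    if j == 0%N :> nat then z j = 1%N
    else [/\ (z j < N)%N, coprime (z j) N &
      forall w, (w < N)%N -> coprime w N ->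
        e_sh gamma nu alpha N j.+1 z
          <= e_sh gamma nu alpha N j.+1 (replace z j w)].

End lattice_rule.

Section importance_sampling.
Context {R : realType} {s : nat}.
Implicit Types (f Psi : 'cV[R]_s -> R) (L Sigma : 'M[R]_s).
Implicit Types (mu z : 'cV[R]_s) (n : nat) (nu : R).

Definition G0 f Psi n z : R := f z * expR (- (n%:R * Psi z)).

(* The weight [W_t] at the point [mu + L z], as a function of [z]. *)
Definition W_t nu mu mu0 Sigma Sigma0 L z : R :=
  Num.sqrt (\det Sigma)
    / ((2 * pi) `^ (s%:R / 2) * Num.sqrt (\det Sigma0))
  * expR (- (2^-1 * sqnorm_mx Sigma0 (mu + L *m z - mu0)))
  * \prod_(i < s) (Num.sqrt (nu * pi) * Gamma (nu / 2) / Gamma ((nu + 1) / 2)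
                   * (1 + z i ord0 ^+ 2 / nu) `^ ((nu + 1) / 2)).

Definition G_tIS f Psi n nu mu mu0 Sigma Sigma0 L z : R :=
  G0 f Psi n (mu + L *m z) * W_t nu mu mu0 Sigma Sigma0 L z.

End importance_sampling.

(* Main.v *)
(* Iterating [g z = \int g phi + \int g'(t) (Phi t - 1_(z <= t)) dt] over the
   coordinates writes [G] as its integral plus one term for each nonempty set [u]
   of coordinates, in which [D^u G] is integrated against a product of kernels.
   By Cauchy-Schwarz with weight [psi^-2] in the coordinates of [u], and because
   averaging over the shift turns the squared kernels into [theta], the mean
   squared error is at most a constant times the sum over [u] of
   [S_u = 1/N \sum_k \prod_(j in u) theta {k z_j / N}].  The constant is finite
   since [D^u G] decays: in [W_t] the prior contributes
   [exp (- |x|^2 / (2 lambda_max))] up to lower order terms, which beats the growth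
   [exp (M |x|^2)] of the derivatives of [G_0].

   The integrand of [theta] is a piecewise linear function of [c] whose Fourier
   coefficients on Z/N are nonnegative and bounded both by [min (Phi t, 1 - Phi t) / h]
   and by [1 / h^2].  Interpolating and integrating against [psi^-2], with
   [Phi t = O (|t|^-p)] at [-oo] for every [p < nu], makes the coefficients of
   [theta] [O (h^(k - 2))] for every [k > (2 alpha + 1) / nu].  The sum [S_u] is a
   sum of products of such coefficients over the dual lattice.  Its power with
   exponent [x] slightly above [1 / (2 - k)] is subadditive, so the average over
   the admissible last coordinate is [O (N^(-1 + 2 d))], and the CBC minimizer does
   as well up to a constant: [S_u = O (N^(k - 2 + eps))].  Letting [alpha -> 0]
   and [k -> 1 / nu] gives the rate. *)
Require Import Defs.
From HB Require Import structures.
From mathcomp Require Import all_boot all_order all_algebra.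
From mathcomp Require Import all_classical all_reals all_analysis.
From mathcomp Require Import measurable_realfun.
From mathcomp Require Import ring lra zify.

Set Implicit Arguments.
Unset Strict Implicit.
Unset Printing Implicit Defensive.

Import Order.TTheory GRing.Theory Num.Theory.
Import numFieldNormedType.Exports.

Local Open Scope classical_set_scope.
Local Open Scope ring_scope.

(** * Number theory *)

Section number_theory.
Local Open Scope nat_scope.

(** The Fourier analysis lives on Z/N: aliasing is built into the transform, inversion is a finite
    identity, and no series has to converge. Nonnegative coefficients serve twice: powers of the
    dual sums can be taken, and each term of the CBC criterion is bounded by the whole. Since [N]
    need not be prime, [w |-> h * w] is not injective mod [N] and only [totient N] candidates
    compete; both losses are bounded by [expS_prod N], the number of divisors, which is [O(N^d)] for
    every [d > 0]. They cost the [2 d] in the exponent. The hypotheses bound [D^a G_0] in one order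
    of differentiation, while the representation differentiates coordinate by coordinate after an
    affine substitution that mixes all directions; hence the symmetry of iterated partial
    derivatives is proved. Explicit derivatives of [W_t] are avoided by recording growth only: a
    factor all of whose derivatives are [O(exp (t |z|^2))] for every [t > 0] costs an arbitrarily
    small share of the Gaussian decay. What is left is [O(\prod_i (1 + |z_i|)^(-2))], enough for
    absolute convergence of every integral. *)

Definition expS_prod N := \prod_(p <- primes N) (logn p N).+1.

(** A divisor [e] of [m * n] is determined by the pair [gcdn e m], [e %/ gcdn e m]; the second
    divides [n] because it is coprime to [m %/ gcdn e m]. *)
Lemma size_divisors_mul m n : 0 < m -> 0 < n ->
  size (divisors (m * n)) <= size (divisors m) * size (divisors n).
Proof.
move=> m0 n0.
rewrite -(size_allpairs muln).
apply: uniq_leq_size; first exact: divisors_uniq.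
move=> e; rewrite -dvdn_divisors ?muln_gt0 ?m0// => emn.
have e0 : 0 < e by apply: dvdn_gt0 emn; rewrite muln_gt0 m0.
have g0 : 0 < gcdn e m by rewrite gcdn_gt0 e0.
apply/allpairsP; exists (gcdn e m, e %/ gcdn e m) => /=; split.
- by rewrite -dvdn_divisors// dvdn_gcdr.
- rewrite -dvdn_divisors//.
  have co : coprime (e %/ gcdn e m) (m %/ gcdn e m).
    by rewrite /coprime -(eqn_pmul2l g0) muln_gcdr muln1 ![_ * (_ %/ _)]mulnC !divnK ?dvdn_gcdl ?dvdn_gcdr.
  rewrite -(Gauss_dvdr _ co) -(dvdn_pmul2l g0).
  by rewrite mulnA ![gcdn e m * (_ %/ _)]mulnC !divnK ?dvdn_gcdl ?dvdn_gcdr.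
- by rewrite mulnC divnK ?dvdn_gcdl.
Qed.

Lemma size_divisors_pfactor p a : prime p -> size (divisors (p ^ a)) <= a.+1.
Proof.
move=> pp; rewrite -[X in _ <= X](size_iota 0) -[X in _ <= X](size_map (expn p)).
apply: uniq_leq_size; first exact: divisors_uniq.
move=> e; rewrite -dvdn_divisors ?expn_gt0 ?prime_gt0// => /(dvdn_pfactor _ _ pp)[k ka ->].
by apply: map_f; rewrite mem_iota.
Qed.

Lemma prod_primes N : 0 < N -> N = \prod_(p <- primes N) p ^ logn p N.
Proof.
move=> N0; rewrite [LHS](prod_prime_decomp N0) prime_decompE big_map.
by apply: eq_bigr.
Qed.

Lemma size_divisors_le N : 0 < N -> size (divisors N) <= expS_prod N.
Proof.
move=> N0; rewrite [X in divisors X](prod_primes N0) /expS_prod.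
have : all prime (primes N) by exact: all_prime_primes.
elim: (primes N) => [|p r IH] /=; first by rewrite !big_nil.
case/andP => pp /[dup] rp /IH {}IH; rewrite !big_cons.
apply: leq_trans (size_divisors_mul _ _) _.
- by rewrite expn_gt0 prime_gt0.
- elim: r rp {IH} => [|q r IH] /=; first by rewrite big_nil.
  by case/andP => qq /IH IH'; rewrite big_cons muln_gt0 IH' expn_gt0 prime_gt0.
- by apply: leq_mul => //; exact: size_divisors_pfactor.
Qed.

(** At a prime [p] of exponent [a >= 1] the inequality reads [p <= (a + 1) (p - 1)] after division
    by [p^(a-1)], and [p <= 2 (p - 1)]. *)
Lemma leq_totient_expS_prod N : 0 < N -> N <= expS_prod N * totient N.
Proof.
move=> N0; rewrite totientE// [X in X <= _](prod_primes N0) /expS_prod -big_split/=.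
have : forall p, p \in primes N -> prime p /\ 0 < logn p N.
  by move=> p; rewrite logn_gt0 => pN; split => //; move: pN; rewrite mem_primes => /andP[].
elim: (primes N) => [|p r IH] pr; first by rewrite !big_nil.
rewrite !big_cons; apply: leq_mul; last by apply: IH => // q qr; apply: pr; rewrite inE qr orbT.
have /pr[pp l0] : p \in p :: r by rewrite inE eqxx.
move: (prime_gt1 pp); case: (logn p N) l0 => // a _ /=; rewrite expnS mulnA leq_mul2r => p1.
by apply/orP; right; nia.
Qed.

(** Two solutions of [h * w = q] mod [N] differ by a multiple of [N' = N / gcdn h N]. Hence the
    quotient [w %/ N'] separates solutions, and it takes only [gcdn h N] values. *)
Lemma card_mulmod_eq h N q : 0 < h -> 0 < N ->
  #|[set w : 'I_N | h * w %% N == q]%SET| <= gcdn h N.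
Proof.
move=> h0 N0; have g0 : 0 < gcdn h N by rewrite gcdn_gt0 h0.
set g := gcdn h N in g0 *.
set N' := N %/ g; have N'0 : 0 < N' by rewrite divn_gt0// dvdn_leq ?dvdn_gcdr.
have NE : N = (N' * g)%N by rewrite divnK ?dvdn_gcdr.
have wg (w : 'I_N) : w %/ N' < g by rewrite ltn_divLR// mulnC -NE ltn_ord.
rewrite -[X in _ <= X]card_ord.
rewrite -(card_in_imset (f := fun w : 'I_N => Ordinal (wg w))) ?max_card//.
move=> w w'; rewrite !inE => /eqP e1 /eqP e2 [] e3; apply/val_inj => /=.
rewrite (divn_eq w N') (divn_eq w' N') e3; congr (_ + _)%N.
apply/eqP; wlog ww' : w w' e1 e2 e3 / w' <= w.
  by move=> H; case/orP: (leq_total w' w) => l; [exact: H|rewrite eq_sym; exact: H].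
rewrite eqn_mod_dvd//.
have : N %| h * w - h * w' by rewrite -eqn_mod_dvd ?e1 ?e2// leq_mul2l ww' orbT.
rewrite -mulnBr {1}NE -(divnK (dvdn_gcdl h N)) -/g mulnAC dvdn_pmul2r//.
rewrite Gauss_dvdr// /coprime -(eqn_pmul2l g0) muln_gcdr muln1.
by rewrite ![(g * _)%N]mulnC !divnK ?dvdn_gcdl ?dvdn_gcdr// gcdnC.
Qed.

End number_theory.

(** * Growth of the divisor function and the sums it controls *)

Section divisor_growth.
Context {R : realType}.

Lemma powR_prod (I : eqType) (r : seq I) (F : I -> R) x : {in r, forall i, 0 <= F i} ->
  (\prod_(i <- r) F i) `^ x = \prod_(i <- r) F i `^ x.
Proof.
elim: r => [|i r IH] F0; first by rewrite !big_nil powR1.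
rewrite !big_cons powRM ?IH//.
- by move=> j jr; apply: F0; rewrite inE jr orbT.
- by apply: F0; rewrite inE eqxx.
- by rewrite big_seq; apply: prodr_ge0 => j jr; apply: F0; rewrite inE jr orbT.
Qed.

(** [a + 1 <= 2^a] and [p^d >= 2]: such a base costs no constant. *)
Lemma natS_le_powR (d : R) (p a : nat) : 0 < d -> 2 `^ (d^-1) <= p%:R -> a.+1%:R <= p%:R `^ (a%:R * d).
Proof.
move=> d0 pd.
have p2 : 2 <= p%:R `^ d :> R.
  have -> : 2 = (2 `^ d^-1) `^ d :> R by rewrite -powRrM mulVf ?powRr1// gt_eqF.
  by apply: ge0_ler_powR; rewrite ?nnegrE ?powR_ge0 ?ler0n// ltW.
rewrite mulrC powRrM powR_mulrn ?powR_ge0//.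
apply: (@le_trans _ _ (2 ^+ a)); last by apply: lerXn2r; rewrite ?nnegrE ?powR_ge0.
by rewrite -natrX ler_nat ltn_expl.
Qed.

(** Only primes below [2^(1/d)] can have [a + 1 > p^(a d)]. They are at most [P0] in number, and
    each costs at most a factor [K]. *)
Lemma expS_prod_le (d : R) : 0 < d ->
  exists2 C : R, 0 < C & forall N, (0 < N)%N -> (expS_prod N)%:R <= C * N%:R `^ d.
Proof.
(* With [y = d ln 2], [K (1 + a y) = 1 + 1/y + a y + a >= 1 + a], and
   [1 + a y <= 2^(a d) <= p^(a d)]. *)
move=> d0; pose K := (1 + (d * ln 2)^-1) : R.
have ln20 : 0 < ln 2 :> R by apply: ln_gt0; rewrite ltr1n.
have K1 : 1 <= K by rewrite lerDl invr_ge0 mulr_ge0 ?ltW.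
have HK p a : (2 <= p)%N -> a.+1%:R <= K * p%:R `^ (a%:R * d).
  move=> p2; apply: (@le_trans _ _ (K * 2 `^ (a%:R * d))); last first.
    rewrite ler_pM2l ?(lt_le_trans _ K1)//.
    by apply: ge0_ler_powR; rewrite ?nnegrE ?ler_nat ?mulr_ge0 ?ler0n// ltW.
  have -> : 2 `^ (a%:R * d) = expR (a%:R * (d * ln 2)) :> R.
    by rewrite /powR pnatr_eq0/= mulrA.
  have y0 : 0 < d * ln 2 by rewrite mulr_gt0.
  move: (d * ln 2) y0 @K K1 => y y0 K K1.
  apply: (@le_trans _ _ (K * (1 + a%:R * y))); last by rewrite ler_pM2l ?(lt_le_trans _ K1)// expR_ge1Dx.
  rewrite /K mulrDl mul1r mulrDr mulr1 mulrCA mulVf ?gt_eqF// mulr1 -addn1 natrD addrC.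
  by rewrite -addrA lerD2l addrA lerDr addr_ge0 ?mulr_ge0 ?invr_ge0 ?ler0n// ltW.
pose P0 := (Num.truncn (2 `^ (d^-1) : R)).+1.
have HP p : (P0 <= p)%N -> 2 `^ (d^-1) <= p%:R :> R.
  by rewrite -(ler_nat R); apply: le_trans; rewrite ltW// truncnS_gt.
exists (K ^+ P0); first by rewrite exprn_gt0 ?(lt_le_trans _ K1).
move=> N N0.
rewrite [X in X%:R `^ d](prod_primes N0) natr_prod powR_prod; last by move=> i _; rewrite ler0n.
rewrite /expS_prod natr_prod.
have HKP : \prod_(p <- primes N) (if (p < P0)%N then K else 1) <= K ^+ P0.
  rewrite -big_mkcond/= big_const_seq iter_mulr_1 ler_weXn2l// -size_filter.
  rewrite -[leqRHS](size_iota 0); apply: uniq_leq_size; first by rewrite filter_uniq ?primes_uniq.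
  by move=> p; rewrite mem_filter mem_iota => /andP[].
apply: le_trans (ler_wpM2r _ HKP); last by apply: prodr_ge0 => *; rewrite powR_ge0.
rewrite -big_split/= big_seq [leRHS]big_seq; apply: ler_prod => p; rewrite mem_primes => /andP[/prime_gt1 p1 _].
rewrite ler0n/= natrX -powR_mulrn ?ler0n// -powRrM.
case: ltnP => [_|/HP Pp]; first exact: HK.
by rewrite mul1r; exact: natS_le_powR.
Qed.

(** Discrete integral comparison: [d (m+1)^(-(1+d)) <= m^(-d) - (m+1)^(-d)], which telescopes; the
    initial [1] is the term [m = 1]. *)
Lemma sum_powRN_le (d : R) : 0 < d -> forall N, \sum_(1 <= m < N) m%:R `^ (- (1 + d)) <= 1 + d^-1.
Proof.
move=> d0 N; have C0 : 0 <= 1 + d^-1 by rewrite addr_ge0// invr_ge0 ltW.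
case: N => [|[|N]]; [by rewrite big_geq|by rewrite big_geq|].
have step m : (1 <= m)%N -> m.+1%:R `^ (- (1 + d)) <= d^-1 * (m%:R `^ (- d) - m.+1%:R `^ (- d)) :> R.
  move=> m1.
  have m0 : 0 < m%:R :> R by rewrite ltr0n.
  have M0 : 0 < m.+1%:R :> R by [].
  have eM : m%:R / m.+1%:R = 1 - (m.+1%:R)^-1 :> R.
    by apply: (mulIf (lt0r_neq0 M0)); rewrite mulrBl divfK ?gt_eqF// mulVf ?gt_eqF// mul1r -natr1 addrK.
  have key : 1 + d / m.+1%:R <= (m%:R / m.+1%:R) `^ (- d).
    rewrite /powR gt_eqF ?divr_gt0//; apply: le_trans (expR_ge1Dx _).
    rewrite lerD2l mulNr -mulrN ler_pM2l// eM.
    by rewrite lerNr; apply: le_ln1Dx; rewrite ltrN2 invf_lt1// ltr1n.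
  have -> : m%:R `^ (- d) = m.+1%:R `^ (- d) * (m%:R / m.+1%:R) `^ (-d) :> R.
    by rewrite -powRM ?divr_ge0 ?(ltW m0) ?(ltW M0)// mulrCA divff ?mulr1 ?gt_eqF.
  rewrite opprD powRD ?pnatr_eq0 ?implybT// powR_inv1 ?(ltW M0)//.
  rewrite -[X in _ - X]mulr1 -mulrBr mulrCA mulrC.
  apply: ler_wpM2l; first exact: powR_ge0.
  by rewrite mulrC ler_pdivlMr// lerBrDl mulrC.
rewrite big_nat_recl//= powR1 lerD2l.
apply: (@le_trans _ _ (\sum_(1 <= i < N.+1) d^-1 * (i%:R `^ (- d) - i.+1%:R `^ (- d)))).
  by apply: ler_sum_nat => i /andP[i1 _]; exact: step.
rewrite -mulr_sumr (telescope_sumr_eq (fun i => - (i%:R `^ (- d))))//; last by move=> i _; rewrite opprK addrC.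
by rewrite opprK powR1 ger_pMr ?invr_gt0// addrC gerBl powR_ge0.
Qed.

Lemma ler_sum_sub_seq (I : eqType) (s1 s2 : seq I) (F : I -> R) : uniq s1 -> uniq s2 ->
  {subset s1 <= s2} -> (forall i, 0 <= F i) -> \sum_(i <- s1) F i <= \sum_(i <- s2) F i.
Proof.
move=> u1 u2 s12 F0; rewrite (perm_big [seq i <- s2 | i \in s1])/=; last first.
  apply: uniq_perm; rewrite ?filter_uniq// => i; rewrite mem_filter.
  by apply/idP/andP => [is1|[]//]; split => //; exact: s12.
by rewrite big_filter big_mkcond; apply: ler_sum => i _; case: ifP.
Qed.

(** Replacing [gcdn h N] by the sum of all [g] dividing both [h] and [N] decouples the two: the
    multiples [h = g m] of a fixed [g] contribute [g^(-d) \sum m^(-(1+d))], at most [1 + 1/d] for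
    each divisor [g]. *)
Lemma sum_gcd_powRN_le (d : R) : 0 < d -> forall N, (0 < N)%N ->
  \sum_(1 <= h < N) (gcdn h N)%:R * h%:R `^ (- (1 + d)) <= (1 + d^-1) * (size (divisors N))%:R.
Proof.
move=> d0 N N0.
pose F (g h : nat) : R := g%:R * h%:R `^ (- (1 + d)).
apply: (@le_trans _ _ (\sum_(g <- divisors N) \sum_(1 <= h < N | (g %| h)%N) F g h)).
  rewrite (exchange_big_dep xpredT)//=; apply: ler_sum => h _.
  rewrite big_mkcond/= (bigD1_seq (gcdn h N))/= ?divisors_uniq//; last first.
    by rewrite -dvdn_divisors// dvdn_gcdr.
  rewrite dvdn_gcdl lerDl; apply: sumr_ge0 => g _.
  by case: ifP => // _; rewrite /F mulr_ge0 ?powR_ge0.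
apply: (@le_trans _ _ (\sum_(g <- divisors N) (1 + d^-1))); last first.
  by rewrite big_const_seq count_predT iter_addr_0 mulr_natr.
rewrite big_seq [leRHS]big_seq; apply: ler_sum => g; rewrite -dvdn_divisors// => gN.
have g0 : (0 < g)%N by apply: dvdn_gt0 gN.
apply: le_trans (sum_powRN_le d0 N).
apply: (@le_trans _ _ (\sum_(1 <= m < N) F g (g * m)%N)); last first.
  apply: ler_sum_nat => m /andP[m1 _].
  rewrite /F natrM powRM ?ler0n// mulrA -[leRHS]mul1r; apply: ler_wpM2r; first exact: powR_ge0.
  rewrite opprD powRD ?pnatr_eq0 -?lt0n ?g0 ?implybT// powR_inv1 ?ler0n// mulrA divff ?pnatr_eq0 -?lt0n// mul1r.
  rewrite powRN invf_le1 ?powR_gt0 ?ltr0n//.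
  by rewrite -[leLHS](@powRr0 R g%:R) ler_powR ?ler1n// ltW.
rewrite -big_filter -[leRHS](big_map (muln g) xpredT (F g)); apply: ler_sum_sub_seq.
- by rewrite filter_uniq// iota_uniq.
- by rewrite map_inj_uniq ?iota_uniq// => x y /eqP; rewrite eqn_pmul2l// => /eqP.
- move=> h; rewrite mem_filter mem_index_iota => /and3P[/dvdnP[k ->] h1 hN].
  rewrite mulnC; apply: map_f; rewrite mem_index_iota; apply/andP; split; first by case: k h1 {hN}.
  by apply: leq_ltn_trans hN; rewrite leq_pmulr.
- by move=> h; rewrite /F mulr_ge0 ?powR_ge0.
Qed.

End divisor_growth.

(** * Lattice sums and the discrete Fourier transform *)

Section dft.
Context {R : realType}.
Implicit Types (N q m h k z : nat) (f c : nat -> R).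

Definition cosq N q : R := cos (pi *+ 2 * q%:R / N%:R).
Definition sinq N q : R := sin (pi *+ 2 * q%:R / N%:R).

Lemma cosqD N a b : cosq N (a + b) = cosq N a * cosq N b - sinq N a * sinq N b.
Proof. by rewrite /cosq natrD mulrDr mulrDl cosD. Qed.

Lemma cosqM N k : (0 < N)%N -> cosq N (k * N) = 1.
Proof.
move=> N0; rewrite /cosq natrM mulrA mulfK ?pnatr_eq0 -?lt0n//.
by rewrite mulr_natr -[_ *+ k]add0r (periodicn (@cosD2pi R)) cos0.
Qed.

Lemma sinqM N k : (0 < N)%N -> sinq N (k * N) = 0.
Proof.
move=> N0; rewrite /sinq natrM mulrA mulfK ?pnatr_eq0 -?lt0n//.
by rewrite mulr_natr -[_ *+ k]add0r (periodicn (@sinD2pi R)) sin0.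
Qed.

Lemma cosq_mod N q : (0 < N)%N -> cosq N (q %% N) = cosq N q.
Proof.
by move=> N0; rewrite {2}(divn_eq q N) cosqD cosqM// sinqM// mul1r mul0r subr0.
Qed.

Lemma cosq_compl N a k : (0 < N)%N -> (a <= N)%N -> cosq N ((N - a) * k) = cosq N (a * k).
Proof.
move=> N0 aN; rewrite /cosq !natrM natrB// mulrBl mulrBr mulrBl cosB.
rewrite -(natrM _ N k) (mulnC N k) -/(cosq N (k * N)) -/(sinq N (k * N)).
by rewrite cosqM// sinqM// mul1r mul0r addr0.
Qed.

Lemma sinq_compl N a k : (0 < N)%N -> (a <= N)%N -> sinq N ((N - a) * k) = - sinq N (a * k).
Proof.
move=> N0 aN; rewrite /sinq !natrM natrB// mulrBl mulrBr mulrBl sinB.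
rewrite -(natrM _ N k) (mulnC N k) -/(cosq N (k * N)) -/(sinq N (k * N)).
by rewrite cosqM// sinqM// mul1r mul0r sub0r.
Qed.

(** After reduction of [q] mod [N], multiplication by [2 sin x] with [x = pi q / N], nonzero when
    [N] does not divide [q], makes the sum telescope; its two ends agree by periodicity. *)
Lemma sum_cosq N q : (0 < N)%N ->
  \sum_(k < N) cosq N (k * q) = if (N %| q)%N then N%:R else 0.
Proof.
move=> N0; case: ifPn => [/dvdnP[t ->]|Nq].
  rewrite (eq_bigr (fun=> 1)) ?sumr_const ?card_ord// => k _.
  by rewrite mulnA cosqM.
rewrite (eq_bigr (fun k : 'I_N => cosq N (k * (q %% N)))); last first.
  by move=> k _; rewrite -cosq_mod// -modnMmr cosq_mod.
move: Nq; rewrite /dvdn; have : (q %% N < N)%N by rewrite ltn_mod.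
move: (q %% N)%N => {}q qN; rewrite -lt0n => q0.
have N0' : 0 < N%:R :> R by rewrite ltr0n.
pose x : R := pi * (q%:R / N%:R).
have x1 : 0 < q%:R / N%:R :> R by rewrite divr_gt0// ltr0n.
have x2 : q%:R / N%:R < 1 :> R by rewrite ltr_pdivrMr// mul1r ltr_nat.
have sx : sin x != 0.
  by rewrite gt_eqF// sin_gt0_pi// mulr_gt0 ?pi_gt0//= /x gtr_pMr ?pi_gt0.
apply: (mulfI sx); rewrite mulr0 mulr_sumr.
apply: (mulfI (_ : 2 != 0 :> R)) => //; rewrite mulr0 mulr_sumr.
rewrite (eq_bigr (fun k : 'I_N => sin (x *+ 2 * k.+1%:R - x) - sin (x *+ 2 * k%:R - x))); last first.
  move=> k _.
  have -> : cosq N (k * q) = cos (x *+ 2 * k%:R).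
    rewrite /cosq; congr cos; rewrite natrM /x -[in LHS]mulr_natr -[in RHS]mulr_natr.
    by field; rewrite pnatr_eq0 -lt0n.
  have -> : x *+ 2 * k.+1%:R - x = x *+ 2 * k%:R + x by rewrite -natr1 mulrDr mulr1 mulr2n; ring.
  by rewrite sinD sinB; ring.
rewrite -(big_mkord xpredT (fun k => sin (x *+ 2 * k.+1%:R - x) - sin (x *+ 2 * k%:R - x))).
rewrite telescope_sumr//= mulr0 sub0r sinN opprK.
have -> : x *+ 2 * N%:R = 0 + pi *+ 2 *+ q.
  rewrite add0r /x -[in LHS]mulr_natr -[in RHS]mulr_natr; field; by rewrite pnatr_eq0 -lt0n.
by rewrite addrAC (periodicn (@sinD2pi R)) add0r sinN addNr.
Qed.

Lemma sum_modD N a (F : nat -> R) : (0 < N)%N ->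
  \sum_(q < N) F ((q + a) %% N)%N = \sum_(q < N) F q.
Proof.
move=> N0.
have lt (q : 'I_N) : ((q + a) %% N < N)%N by rewrite ltn_mod.
rewrite [RHS](reindex_inj (h := fun q : 'I_N => Ordinal (lt q)))//=.
move=> q q' /(congr1 val)/= /eqP; rewrite eqn_modDr !modn_small// => /eqP e; exact: val_inj.
Qed.

Lemma sum_dvdD N a (F : nat -> R) : (0 < N)%N ->
  \sum_(q < N | (N %| q + a)%N) F q = F ((N - a %% N) %% N)%N.
Proof.
move=> N0.
have lt : ((N - a %% N) %% N < N)%N by rewrite ltn_mod.
rewrite (big_pred1 (Ordinal lt))// => q /=.
rewrite -val_eqE/= /dvdn -modnDmr -/(dvdn _ _).
have := ltn_ord q; have := ltn_pmod a N0; move: (a %% N)%N => r rN qN.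
have [->|r0] := posnP r; first by rewrite addn0 subn0 modnn /dvdn modn_small.
rewrite [RHS]eq_sym [((N - r) %% N)%N]modn_small ?ltn_subrL ?r0 ?N0//.
apply/eqP/eqP => [|<-]; last by rewrite subnK ?modnn// ltnW.
have [qr|qr] := ltnP (q + r) N; first by rewrite modn_small//; lia.
by rewrite -(subnK qr) modnDr modn_small; lia.
Qed.

(** [h |-> N - h] changes the sign of each summand. This is why a real cosine transform suffices:
    the sine parts of the addition formula drop out. *)
Lemma sum_even_sinq N (d : nat -> R) z : (0 < N)%N -> (forall h, (h <= N)%N -> d (N - h)%N = d h) ->
  \sum_(h < N) d h * sinq N (h * z) = 0.
Proof.
move=> N0 dE.
have H : \sum_(h < N) d h * sinq N (h * z) = - \sum_(h < N) d h * sinq N (h * z).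
  case: N N0 dE => // n _ dE.
  have s0 : sinq n.+1 ((ord0 : 'I_n.+1) * z) = 0 by rewrite /sinq mul0n mulr0 mul0r sin0.
  rewrite !big_ord_recl s0 !mulr0 !add0r.
  rewrite [LHS](reindex_inj rev_ord_inj)/= -sumrN; apply: eq_bigr => i _.
  have iE : bump 0 (n - i.+1) = (n.+1 - bump 0 i)%N :> nat.
    by rewrite /bump/= !add1n; have := ltn_ord i; lia.
  have le : (bump 0 i <= n.+1)%N by rewrite /bump/= add1n ltnW// ltnS ltn_ord.
  by rewrite iE dE// sinq_compl// mulrN.
by move: H; set S := (\sum_(h < N) _); lra.
Qed.

(* The sum of the products of the [c h_i] over the frequencies [h] with
   [q + \sum_i h_i l_i = 0] mod [N]. *)
Fixpoint dual_sum N (c : nat -> R) (l : seq nat) q : R :=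
  if l is z :: l' then \sum_(h < N) c h * dual_sum N c l' (q + h * z) else (N %| q)%:R.

Lemma dual_sum_ge0 N c l q : (forall h, 0 <= c h) -> 0 <= dual_sum N c l q.
Proof.
move=> c0; elim: l q => [|z l IH] q /=; first by rewrite ler0n.
by apply: sumr_ge0 => h _; rewrite mulr_ge0.
Qed.

Lemma dual_sum_mod N c l q : dual_sum N c l (q %% N) = dual_sum N c l q.
Proof.
elim: l q => [|z l IH] q /=; first by rewrite /dvdn modn_mod.
by apply: eq_bigr => h _; rewrite -IH modnDml IH.
Qed.

(** Orthogonality: the sum over [k] of [cosq N (k * q)] detects [N %| q]. Each factor [f (k * z)] is
    expanded into frequencies [h], and the frequency [h] moves [q] to [q + h * z]. *)
Lemma dual_sumE N c f l q : (0 < N)%N -> (forall h, (h <= N)%N -> c (N - h)%N = c h) ->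
  (forall m, f m = \sum_(h < N) c h * cosq N (h * m)) ->
  N%:R * dual_sum N c l q = \sum_(k < N) cosq N (k * q) * \prod_(z <- l) f (k * z)%N.
Proof.
move=> N0 cE fE; elim: l q => [|z l IH] q /=.
  under eq_bigr do rewrite big_nil mulr1.
  by rewrite sum_cosq//; case: ifP; rewrite ?mulr1 ?mulr0.
rewrite mulr_sumr.
transitivity (\sum_(h < N) \sum_(k < N) c h * (cosq N (k * (q + h * z)) * \prod_(z <- l) f (k * z)%N)).
  by apply: eq_bigr => h _; rewrite mulrCA IH mulr_sumr.
rewrite exchange_big/=; apply: eq_bigr => k _.
rewrite big_cons mulrCA [in RHS]mulrC.
transitivity ((\sum_(h < N) c h * cosq N (k * (q + h * z))) * \prod_(z <- l) f (k * z)%N).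
  by rewrite mulr_suml; apply: eq_bigr => h _; rewrite mulrA.
rewrite -[in RHS]mulrA [in RHS]mulrC -[in RHS]mulrA [in RHS]mulrC; congr (_ * _).
rewrite fE mulr_suml -[RHS]subr0 -[X in _ = _ - X](mulr0 (sinq N (k * q))).
rewrite -[X in _ * X](sum_even_sinq (k * z) N0 cE) mulr_sumr -sumrB; apply: eq_bigr => h _.
by rewrite mulnDr cosqD (mulnCA k h z); ring.
Qed.

Section coefficients.
Variables (N : nat) (N0 : (0 < N)%N) (f : nat -> R).
Hypothesis f_mod : forall m, f (m %% N)%N = f m.
Hypothesis f_even : forall m, (m <= N)%N -> f (N - m)%N = f m.

(** On even functions this is the complex discrete Fourier transform, whose values are then real. *)
Definition dft h : R := N%:R^-1 * \sum_(m < N) f m * cosq N (h * m).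

Lemma dft_compl h : (h <= N)%N -> dft (N - h) = dft h.
Proof.
by move=> hN; congr (_ * _); apply: eq_bigr => m _; rewrite cosq_compl.
Qed.

(** The product formula for cosines and orthogonality select [l = m] and [l = N - m] mod [N];
    evenness makes both contribute [f m], whence the factor [2] in the computation. *)
Lemma dft_inv m : f m = \sum_(h < N) dft h * cosq N (h * m).
Proof.
wlog mN : m / (m < N)%N.
  move=> H; rewrite -f_mod H ?ltn_mod//; apply: eq_bigr => h _.
  by rewrite -cosq_mod// modnMmr cosq_mod.
have NR : N%:R != 0 :> R by rewrite pnatr_eq0 -lt0n.
apply: (mulfI NR); apply: (mulfI (_ : 2 != 0 :> R)) => //.
rewrite !mulr_sumr.
transitivity (\sum_(l < N) f l * \sum_(h < N) (cosq N (h * (l + m)) + cosq N (h * (l + (N - m))))).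
  under eq_bigr => l _ do rewrite big_split/= !sum_cosq// mulrDr.
  rewrite big_split/=.
  have aux a : \sum_(i < N) f i * (if (N %| i + a)%N then N%:R else 0) = N%:R * f a.
    rewrite (eq_bigr (fun i : 'I_N => if (N %| i + a)%N then N%:R * f i else 0)); last first.
      by move=> i _; case: ifP; rewrite ?mulr0// mulrC.
    by rewrite -big_mkcond/= (sum_dvdD a (fun i => N%:R * f i))// f_mod f_even ?f_mod// ltnW// ltn_mod.
  by rewrite !aux f_even ?(ltnW mN)//; ring.
transitivity (\sum_(h < N) \sum_(l < N) f l * (cosq N (h * (l + m)) + cosq N (h * (l + (N - m))))).
  by rewrite exchange_big/=; apply: eq_bigr => l _; rewrite mulr_sumr.
apply: eq_bigr => h _; rewrite /dft -[N%:R^-1 * _ * _]mulrA mulVKf// mulr_suml mulr_sumr.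
apply: eq_bigr => l _; rewrite !mulnDr !cosqD ![(h * (N - m))%N]mulnC cosq_compl ?(ltnW mN)//.
by rewrite sinq_compl ?(ltnW mN)// ![(m * h)%N]mulnC; ring.
Qed.

End coefficients.

(** [t <= t^x] on [[0, 1]], applied to [a / (a + b)] and [b / (a + b)], which add up to [1]. *)
Lemma powR_subadd (x a b : R) : 0 < x <= 1 -> 0 <= a -> 0 <= b -> (a + b) `^ x <= a `^ x + b `^ x.
Proof.
move=> /andP[x0 x1] a0 b0.
have [/eqP|ab0] := eqVneq (a + b) 0.
  by rewrite paddr_eq0// => /andP[/eqP -> /eqP ->]; rewrite addr0 powR0 ?gt_eqF// addr0.
have ab : 0 < a + b by rewrite lt_def ab0 addr_ge0.
have H (c : R) : 0 <= c -> c <= a + b -> (a + b) `^ x * (c / (a + b)) <= c `^ x.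
  move=> c0 cab; have cE : c `^ x = (a + b) `^ x * (c / (a + b)) `^ x.
    by rewrite -powRM ?(ltW ab) ?divr_ge0 ?(ltW ab)// mulrCA divff// mulr1.
  rewrite cE; apply: ler_wpM2l; first exact: powR_ge0.
  have [->|cn] := eqVneq c 0; first by rewrite mul0r powR_ge0.
  have c1 : 0 < c by rewrite lt_def cn.
  by apply: ger1_powR => //; rewrite divr_gt0//= ler_pdivrMr// mul1r.
have := lerD (H _ a0 (_ : a <= a + b)) (H _ b0 (_ : b <= a + b)).
rewrite -mulrDr -mulrDl divff// mulr1; apply; [by rewrite lerDl|by rewrite lerDr].
Qed.

Lemma powR_sum_subadd (I : Type) (r : seq I) (P : pred I) (F : I -> R) (x : R) : 0 < x <= 1 ->
  (forall i, P i -> 0 <= F i) -> (\sum_(i <- r | P i) F i) `^ x <= \sum_(i <- r | P i) F i `^ x.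
Proof.
move=> x01 F0; elim: r => [|i r IH]; first by rewrite !big_nil powR0// gt_eqF//; case/andP: x01.
rewrite !big_cons; case: ifP => // Pi.
by apply: le_trans (powR_subadd x01 (F0 _ Pi) _) _; rewrite ?lerD2l// sumr_ge0.
Qed.

(** * Averaging over the choice of one generator *)

Section average.
Variables (N : nat) (N0 : (0 < N)%N) (c : nat -> R) (x : R).
Hypotheses (c0 : forall h, 0 <= c h) (x01 : 0 < x <= 1).

Let T := dual_sum N c.
Let T0 l q : 0 <= T l q. Proof. exact: dual_sum_ge0. Qed.

(** Each list element acts as a convolution with the [c h]. Subadditivity brings the power inside,
    and [q |-> q + h * z] permutes the residues, so each step multiplies the sum by at most
    [\sum_h (c h)^x]. *)
Lemma sum_dual_sum_powR l :
  \sum_(q < N) T l q `^ x <= (\sum_(h < N) c h `^ x) ^+ size l.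
Proof.
have xn0 : x != 0 by rewrite gt_eqF//; case/andP: x01.
elim: l => [|z l IH] /=.
  rewrite expr0 (bigD1 (Ordinal N0))//= /T/= dvdn0 powR1 big1 ?addr0// => q q0.
  suff /negbTE -> : ~~ (N %| q)%N by rewrite powR0.
  by rewrite /dvdn modn_small.
rewrite exprS.
apply: (@le_trans _ _ (\sum_(q < N) \sum_(h < N) c h `^ x * T l (q + h * z) `^ x)).
  apply: ler_sum => q _; rewrite /T/=; apply: le_trans (powR_sum_subadd _ x01 _) _.
    by move=> h _; rewrite mulr_ge0// dual_sum_ge0.
  by apply: ler_sum => h _; rewrite powRM// dual_sum_ge0.
rewrite exchange_big/= mulr_suml; apply: ler_sum => h _.
rewrite -mulr_sumr; apply: ler_wpM2l; first exact: powR_ge0.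
rewrite (eq_bigr (fun q : 'I_N => T l ((q + h * z) %% N) `^ x)); last by move=> q _; rewrite /T dual_sum_mod.
by rewrite (sum_modD (h * z) (fun q => T l q `^ x)).
Qed.

Lemma sum_mulmod_le h (F : nat -> R) : (0 < h)%N -> (forall q, 0 <= F q) ->
  \sum_(w < N) F (h * w %% N)%N <= (gcdn h N)%:R * \sum_(q < N) F q.
Proof.
move=> h0 F0.
have -> : \sum_(w < N) F (h * w %% N)%N = \sum_(w < N) \sum_(q < N | (h * w %% N == q)%N) F q.
  apply: eq_bigr => w _; have lt : (h * w %% N < N)%N by rewrite ltn_mod.
  by rewrite (big_pred1 (Ordinal lt))// => q; rewrite eq_sym -val_eqE.
rewrite (exchange_big_dep xpredT)//= mulr_sumr; apply: ler_sum => q _.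
rewrite sumr_const -[leLHS]mulr_natl; apply: ler_wpM2r => //.
rewrite ler_nat; have := card_mulmod_eq q h0 N0.
by rewrite (eq_card (B := [pred w : 'I_N | (h * w %% N == q)%N])) // => w; rewrite !inE.
Qed.

(** The frequency [h = 0] does not feel [w] and is counted [totient N] times. For [h > 0] the sum is
    extended to all residues [w], and [h * w] meets each residue at most [gcdn h N] times. *)
Lemma sum_coprime_dual_sum l :
  \sum_(w < N | coprime w N) T (val w :: l) 0 `^ x <=
    ((totient N)%:R * c 0 `^ x + \sum_(1 <= h < N) c h `^ x * (gcdn h N)%:R)
      * (\sum_(h < N) c h `^ x) ^+ size l.
Proof.
set A := (_ ^+ size l).
have HA : \sum_(q < N) T l q `^ x <= A := sum_dual_sum_powR l.
have S0 (F : nat -> R) : \sum_(h < N) F h = F 0%N + \sum_(1 <= h < N) F h :> R.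
  by rewrite -(big_mkord xpredT F) big_ltn.
apply: (@le_trans _ _ (\sum_(w < N | coprime w N) \sum_(h < N) c h `^ x * T l (h * w) `^ x)).
  apply: ler_sum => w _; rewrite /T/=; apply: le_trans (powR_sum_subadd _ x01 _) _.
    by move=> h _; rewrite mulr_ge0// dual_sum_ge0.
  by apply: ler_sum => h _; rewrite powRM// dual_sum_ge0.
rewrite exchange_big/= (S0 (fun h => \sum_(w < N | coprime w N) c h `^ x * T l (h * w) `^ x)).
rewrite mulrDl; apply: lerD.
  have -> : (totient N)%:R = \sum_(w < N | coprime w N) 1 :> R.
    rewrite totient_count_coprime big_mkord natr_sum [RHS]big_mkcond/=; apply: eq_bigr => w _.
    by rewrite coprime_sym; case: coprime.
  rewrite !mulr_suml; apply: ler_sum => w _; rewrite mul1r mul0n.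
  apply: ler_wpM2l; first exact: powR_ge0.
  apply: le_trans HA; rewrite (bigD1 (Ordinal N0))//= lerDl; apply: sumr_ge0 => *; exact: powR_ge0.
rewrite mulr_suml !big_nat; apply: ler_sum => h /andP[h1 hN].
rewrite -mulr_sumr -mulrA; apply: ler_wpM2l; first exact: powR_ge0.
apply: (@le_trans _ _ (\sum_(w < N) T l (h * w) `^ x)).
  by rewrite big_mkcond; apply: ler_sum => w _; case: ifP => // _; exact: powR_ge0.
rewrite (eq_bigr (fun w : 'I_N => T l (h * w %% N) `^ x)); last by move=> q _; rewrite /T dual_sum_mod.
apply: le_trans (sum_mulmod_le h1 (F := fun q => T l q `^ x) _) _; first by move=> q; exact: powR_ge0.
by apply: ler_wpM2l.
Qed.

End average.

(* An average over the [w] coprime to [N]: the [x]-th power is subadditive, and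
   [w |-> h * w] takes each value mod [N] at most [gcdn h N] times. *)
Lemma exists_small_dual_sum (K d x : R) (S : finType) (n : nat) : 0 < K -> 0 < d -> 0 < x <= 1 ->
  exists2 C : R, 0 < C & forall N c (l : S -> seq nat), (0 < N)%N ->
    (forall h, 0 <= c h) -> c 0%N `^ x <= K * N%:R^-1 ->
    (forall h, (0 < h < N)%N -> c h `^ x <= K * (h%:R `^ (- (1 + d)) + (N - h)%:R `^ (- (1 + d)))) ->
    (forall u, size (l u) <= n)%N ->
  exists w, [/\ (w < N)%N, coprime w N &
    forall u, dual_sum N c (w :: l u) 0 `^ x <= C * N%:R `^ (2 * d - 1)].
Proof.
move=> K0 d0 x01.
have [D D0 HD] := expS_prod_le d0.
pose Z := 1 + d^-1 : R.
have Z0 : 0 < Z by rewrite addr_gt0 ?invr_gt0.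
(* Bound for [\sum_h (c h)^x]: [K] from [h = 0], and [K * Z] from each of the two families of
   powers, in [h] and in [N - h]. *)
pose A := K * (1 + 2 * Z).
have A0 : 0 < A by rewrite mulr_gt0// addr_gt0 ?mulr_gt0.
(* Up to the power of [N], [E] bounds the average over [w] of the sum over all [u] in [S]: a single
   [w] has to serve every [u], which costs the factor [#|S|]. *)
pose E := #|S|%:R * ((K + K * 2 * Z * D ^+ 2) * (1 + A) ^+ n).
have E0 : 0 <= E by rewrite /E; do ![apply: mulr_ge0|apply: exprn_ge0|apply: addr_ge0] => //; rewrite ?invr_ge0; exact: ltW.
exists (1 + E); first by rewrite ltr_wpDr.
move=> N c l N0 c0 cz ch sl.
have NR : 0 < N%:R :> R by rewrite ltr0n.
have rev (F : nat -> R) : \sum_(1 <= h < N) F (N - h)%N = \sum_(1 <= h < N) F h.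
  rewrite [RHS]big_nat_rev/=; apply: eq_big_nat => h /andP[h1 hN]; congr F; lia.
have HA : \sum_(h < N) c h `^ x <= A.
  rewrite -(big_mkord xpredT (fun h => c h `^ x)) big_ltn// /A mulrDr mulr1; apply: lerD.
    apply: le_trans cz _; rewrite ger_pMr// invf_le1// ler1n//.
  apply: (@le_trans _ _ (\sum_(1 <= h < N) K * (h%:R `^ (- (1 + d)) + (N - h)%:R `^ (- (1 + d))))).
    by apply: ler_sum_nat => h; exact: ch.
  rewrite -mulr_sumr big_split/= (rev (fun h => h%:R `^ (- (1 + d)))) ler_pM2l//.
  by have := sum_powRN_le d0 N; rewrite -/Z; lra.
have A0' : 0 <= \sum_(h < N) c h `^ x by apply: sumr_ge0 => *; exact: powR_ge0.
have HG : \sum_(1 <= h < N) c h `^ x * (gcdn h N)%:R <= K * 2 * Z * (expS_prod N)%:R.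
  apply: (@le_trans _ _ (\sum_(1 <= h < N) K * ((gcdn h N)%:R * h%:R `^ (- (1 + d)) + (gcdn (N - h) N)%:R * (N - h)%:R `^ (- (1 + d))))).
    apply: ler_sum_nat => h /andP[h1 hN].
    have -> : gcdn (N - h) N = gcdn h N by rewrite -[X in gcdn _ X](subnK (ltnW hN)) gcdnDl gcdnC -[X in _ = gcdn _ X](subnK (ltnW hN)) gcdnDr.
    rewrite -mulrDr mulrCA [leLHS]mulrC; apply: ler_wpM2l => //; apply: ch; exact/andP.
  rewrite -mulr_sumr big_split/= (rev (fun h => (gcdn h N)%:R * h%:R `^ (- (1 + d)))) -!mulrA ler_pM2l//.
  have := sum_gcd_powRN_le d0 N0; rewrite -/Z.
  have : (size (divisors N))%:R <= (expS_prod N)%:R :> R by rewrite ler_nat size_divisors_le.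
  by move=> /(ler_wpM2l (ltW Z0)); lra.
have phi0 : 0 < (totient N)%:R :> R by rewrite ltr0n totient_gt0.
have tot : \sum_(w < N | coprime w N) (1 : R) = (totient N)%:R.
  rewrite totient_count_coprime big_mkord natr_sum big_mkcond/=; apply: eq_bigr => w _.
  by rewrite coprime_sym; case: coprime.
have avg : \sum_(w < N | coprime w N) \sum_u dual_sum N c (val w :: l u) 0 `^ x
    <= \sum_(w < N | coprime w N) (E * N%:R `^ (2 * d - 1)).
  rewrite exchange_big/= -[X in _ <= X](eq_bigr _ (fun w _ => mulr1 (E * N%:R `^ (2 * d - 1)))) -mulr_sumr tot.
  have P1 : (N%:R)^-1 <= N%:R `^ (2 * d - 1) :> R.
    by rewrite -powR_inv1 ?ler0n// ler_powR ?ler1n// lerDr mulr_ge0// ltW.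
  (* One factor [expS_prod N] comes from the gcd sum, a second one from exchanging [totient N] for
     [N]; each is at most [D * N^d]. *)
  have P2 : (expS_prod N)%:R <= D ^+ 2 * (totient N)%:R * N%:R `^ (2 * d - 1).
    rewrite powRD ?pnatr_eq0 -?lt0n ?N0 ?implybT// powR_inv1 ?ler0n// mulrA ler_pdivlMr//.
    rewrite (_ : 2 * d = d + d) ?powRD ?pnatr_eq0 -?lt0n ?N0 ?implybT//; last by ring.
    have e1 : N%:R <= (expS_prod N)%:R * (totient N)%:R :> R by rewrite -natrM ler_nat leq_totient_expS_prod.
    apply: le_trans (ler_wpM2l (ler0n _ _) e1) _.
    have := HD _ N0; have : 0 <= (expS_prod N)%:R :> R by [].
    move: (expS_prod N)%:R (N%:R `^ d) (powR_ge0 (N%:R : R) d) => a b b0 a0 ab.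
    have -> : D ^+ 2 * (totient N)%:R * (b * b) = (D * b) ^+ 2 * (totient N)%:R by ring.
    rewrite mulrA ler_pM2r// -expr2.
    by rewrite lerXn2r// nnegrE// mulr_ge0// ltW.
  apply: (@le_trans _ _ (\sum_(u : S) ((K + K * 2 * Z * D ^+ 2) * (1 + A) ^+ n * ((totient N)%:R * N%:R `^ (2 * d - 1))))); last first.
    by rewrite sumr_const -mulr_natl /E !mulrA le_eqVlt; apply/orP; left; apply/eqP; ring.
  apply: ler_sum => u _; apply: le_trans (sum_coprime_dual_sum N0 c0 x01 (l u)) _.
  rewrite [leRHS]mulrAC; apply: ler_pM => //.
  - by rewrite addr_ge0 ?mulr_ge0 ?powR_ge0//; apply: sumr_ge0 => *; rewrite mulr_ge0 ?powR_ge0.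
  - by rewrite exprn_ge0.
  - rewrite mulrDl; apply: lerD.
      rewrite mulrCA ler_pM2l//; apply: le_trans cz _; rewrite ler_pM2l//.
    apply: le_trans HG _; rewrite -[leRHS]mulrA; apply: ler_wpM2l; last by rewrite mulrA.
    by rewrite !mulr_ge0// ltW.
  - apply: (@le_trans _ _ ((1 + A) ^+ size (l u))).
      by apply: lerXn2r; rewrite ?nnegrE ?addr_ge0 ?(ltW A0)//; lra.
    by apply: ler_weXn2l => //; lra.
have P0 : 0 < N%:R `^ (2 * d - 1) :> R by rewrite powR_gt0.
(* The strict gap between [E] and [1 + E] makes a failure for all [w] contradict the average. *)
have [[w wc Hw]|H] := pselect (exists2 w : 'I_N, coprime w N & \sum_u dual_sum N c (val w :: l u) 0 `^ x <= (1 + E) * N%:R `^ (2 * d - 1)).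
  exists (val w); split => [|//|u]; first exact: ltn_ord.
  apply: le_trans Hw.
  by rewrite (bigD1 u)//= lerDl sumr_ge0// => *; exact: powR_ge0.
exfalso; move: avg; apply/negP; rewrite -ltNge.
apply: (@lt_le_trans _ _ (\sum_(w < N | coprime w N) ((1 + E) * N%:R `^ (2 * d - 1)))).
  rewrite -[X in X < _](eq_bigr _ (fun w _ => mulr1 (E * N%:R `^ (2 * d - 1)))).
  rewrite -[X in _ < X](eq_bigr _ (fun w _ => mulr1 ((1 + E) * N%:R `^ (2 * d - 1)))).
  rewrite -!mulr_sumr tot ltr_pM2r// ltr_pM2r//; lra.
apply: ler_sum => w wc; rewrite leNgt; apply/negP => /ltW Hw.
by apply: H; exists w.
Qed.
End dft.

(** * Fourier coefficients of the shift covariance *)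

Section tent.
Context {R : realType}.
Implicit Types (x c : R) (N m h : nat).

(* The covariance of [1_(U <= x)] and [1_({U + c} <= x)] for [U] uniform on
   [(0, 1)]. *)
Definition tent x c : R := Num.max (x - c) 0 + Num.max (x - 1 + c) 0 - x ^+ 2.

Lemma maxr0N x : Num.max x 0 - Num.max (- x) 0 = x.
Proof. by case: (lerP x 0); case: (lerP (- x) 0); lra. Qed.

(** Passing to the complements of both events preserves a covariance. This lets [1 - x] replace [x],
    so that bounds proportional to [x] become bounds in the minimum of [x] and [1 - x]. *)
Lemma tent_compl x c : tent (1 - x) c = tent x c.
Proof.
rewrite /tent; have := maxr0N (x - c); have := maxr0N (x - 1 + c).
have -> : 1 - x - 1 + c = - (x - c) by ring.
have -> : 1 - x - c = - (x - 1 + c) by ring.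
lra.
Qed.

Lemma tent_rev x c : tent x (1 - c) = tent x c.
Proof.
rewrite /tent; have -> : x - (1 - c) = x - 1 + c by ring.
have -> : x - 1 + (1 - c) = x - c by ring.
lra.
Qed.

Lemma tent_bound x c : 0 <= x <= 1 -> 0 <= c <= 1 -> `|tent x c| <= x.
Proof.
move=> x01 c01; rewrite /tent ler_norml.
by case: (lerP (x - c) 0); case: (lerP (x - 1 + c) 0) => H1 H2; apply/andP; split; nra.
Qed.

(** A hinge: nonincreasing, convex and of slope at most one in [m / N]. On the grid [tent] is such a
    hinge plus its mirror image, up to a constant. *)
Definition pos_part N x m : R := Num.max (x - m%:R / N%:R) 0.

Lemma sin_ge_quarter x : 0 <= x <= pi / 2 -> x / 4 <= sin x.
Proof.
move=> /andP[x0 x2]; have [->|xn0] := eqVneq x 0; first by rewrite sin0 mul0r.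
have xp : 0 < x by rewrite lt_def xn0.
have p2 : pi / 2 < 2 :> R by exact: pihalf_lt2.
have pp := @pi_gt0 R.
have [cx|cx] := lerP (1/2) (cos x).
  have [c /[!in_itv]/= /andP[c0 cx'] e] := @MVT R sin cos 0 x xp (fun y _ => is_derive_sin y) (continuous_subspaceT (@continuous_sin R)).
  move: e; rewrite sin0 !subr0 => ->.
  have : cos x <= cos c.
    by apply: ltW; rewrite ltr_cos// in_itv/=; apply/andP; split; lra.
  nra.
have := cos2Dsin2 x; have : 0 <= cos x by rewrite cos_ge0_pihalf// x2 andbT; lra.
have : 0 <= sin x by apply: sin_ge0_pi; lra.
nra.
Qed.

Section bound.
Variables (N : nat) (N0 : (0 < N)%N) (x : R).
Hypothesis x01 : 0 <= x <= 1.

Let p := pos_part N x.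
Let g m := tent x (m%:R / N%:R).
Let NR : 0 < N%:R :> R. Proof. by rewrite ltr0n. Qed.

Lemma tent_gridE m : (m <= N)%N -> g m = p m + p (N - m)%N - x ^+ 2.
Proof.
move=> mN; rewrite /g /p /pos_part /tent; congr (_ + Num.max _ _ - _).
by rewrite natrB// mulrBl divff ?gt_eqF//; ring.
Qed.

Lemma pos_part0 : p 0 = x.
Proof. by rewrite /p /pos_part mul0r subr0 max_l//; case/andP: x01. Qed.

Lemma pos_partN : p N = 0.
Proof. by rewrite /p /pos_part divff ?gt_eqF// max_r// subr_le0; case/andP: x01. Qed.

Let gridS m : m.+1%:R / N%:R = m%:R / N%:R + N%:R^-1 :> R.
Proof. by rewrite -natr1 mulrDl mul1r. Qed.

Lemma pos_part_step m : 0 <= p m - p m.+1 <= N%:R^-1.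
Proof.
rewrite /p /pos_part gridS.
have : 0 < N%:R^-1 :> R by rewrite invr_gt0.
move: (m%:R / N%:R : R) => a; move: (N%:R^-1 : R) => b b0.
by case: (lerP (x - a) 0); case: (lerP (x - (a + b)) 0) => H1 H2; apply/andP; split; lra.
Qed.

Lemma pos_part_convex m : p m + p m.+2 >= 2 * p m.+1.
Proof.
rewrite /p /pos_part !gridS.
have : 0 < N%:R^-1 :> R by rewrite invr_gt0.
move: (m%:R / N%:R : R) => a; move: (N%:R^-1 : R) => b b0.
by case: (lerP (x - a) 0); case: (lerP (x - (a + b)) 0); case: (lerP (x - (a + b + b)) 0) => H1 H2 H3; lra.
Qed.

Lemma tent_grid_compl m : (m <= N)%N -> g (N - m) = g m.
Proof. by move=> mN; rewrite !tent_gridE ?leq_subr// subKn//; ring. Qed.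

(** Both hinges are convex; in the periodic extension the only concave corner is [m = 0] mod [N],
    which is excluded. *)
Lemma tent_grid_convex m : (0 < m < N)%N -> g m.-1 + g m.+1 >= 2 * g m.
Proof.
case: m => // m /= mN.
have l1 : (m <= N)%N by lia. have l2 : (m.+1 <= N)%N by lia. have l3 : (m.+2 <= N)%N by lia.
rewrite !tent_gridE//.
have e1 : (N - m = (N - m.+2).+2)%N by lia.
have e2 : (N - m.+1 = (N - m.+2).+1)%N by lia.
rewrite e1 e2; have := pos_part_convex m; have := pos_part_convex (N - m.+2); lra.
Qed.

Lemma tent_grid_variation : \sum_(m < N) `|g m - g m.+1| <= 2 * x.
Proof.
have tel : \sum_(0 <= m < N) (p m - p m.+1) = x.
  rewrite (telescope_sumr_eq (fun i => - p i))//; last by move=> i _; rewrite opprK addrC.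
  by rewrite opprK pos_partN pos_part0 oppr0 add0r.
have tel2 : \sum_(0 <= m < N) (p (N - m.+1)%N - p (N - m)%N) = x.
  rewrite -[RHS]tel [RHS]big_nat_rev/= add0n; apply: eq_big_nat => m /andP[_ mN].
  by congr (p _ - p _); lia.
rewrite -(big_mkord xpredT (fun m => `|g m - g m.+1|)).
rewrite (_ : 2 * x = x + x); last by ring.
rewrite -{1}tel -tel2 -big_split/=; apply: ler_sum_nat => m /andP[_ mN].
rewrite !tent_gridE ?(ltnW mN)//.
have e2 : (N - m = (N - m.+1).+1)%N by lia.
have /andP[h1 _] := pos_part_step m; have /andP[h2 _] := pos_part_step (N - m.+1).
rewrite e2 ler_norml; apply/andP; split; lra.
Qed.

(** Since [x^2] is the telescoping sum of differences of [(p m)^2], the sum becomes that of [e m].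
    The second factor of [e m] vanishes where the hinge has full slope, the first where the hinge is
    zero; only the cell containing [x] survives. *)
Lemma sum_tent_grid : 0 <= \sum_(m < N) g m /\ \sum_(m < N) g m <= N%:R^-1 /\ \sum_(m < N) g m <= x.
Proof.
pose e m := (p m + p m.+1) * (1 - N%:R * (p m - p m.+1)).
have sE : \sum_(m < N) g m = \sum_(0 <= m < N) e m.
  have tel : \sum_(0 <= m < N) (p m - p m.+1) * (p m + p m.+1) = x ^+ 2.
    rewrite (telescope_sumr_eq (fun i => - p i ^+ 2))//; last by move=> i _; ring.
    by rewrite opprK pos_partN pos_part0; ring.
  have revp : \sum_(0 <= m < N) p (N - m)%N = \sum_(0 <= m < N) p m.+1.
    rewrite [RHS]big_nat_rev/= add0n; apply: eq_big_nat => m /andP[_ mN]; congr p; lia.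
  rewrite -(big_mkord xpredT g) (eq_big_nat _ _ (F2 := fun m => p m + p (N - m)%N - x ^+ 2)); last first.
    by move=> m /andP[_ mN]; rewrite tent_gridE// ltnW.
  rewrite sumrB big_split/= revp -big_split/= sumr_const_nat subn0 -mulr_natl -[in LHS]tel.
  by rewrite mulr_sumr -sumrB; apply: eq_bigr => m _; rewrite /e; ring.
(* [I m - I m.+1] is the indicator of the cell that contains [x]. *)
pose I m : R := if m%:R / N%:R < x then 1 else 0.
have b0 : 0 < N%:R^-1 :> R by rewrite invr_gt0.
have key m : [/\ 0 <= e m, e m <= N%:R^-1 * (I m - I m.+1) & e m <= p m - p m.+1].
  rewrite /e /I /p /pos_part gridS.
  have Nb : N%:R * N%:R^-1 = 1 :> R by rewrite divff// gt_eqF.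
  move: (m%:R / N%:R : R) => a; move: Nb b0; move: (N%:R^-1 : R) => b; move: NR; move: (N%:R : R) => n n0 nb b0'.
  case: (ltP a x) => H1; case: (ltP (a + b) x) => H2; try lra.
  - rewrite !max_l; try lra.
    have -> : 1 - n * (x - a - (x - (a + b))) = 1 - n * b by ring.
    by rewrite nb subrr !mulr0; split; lra.
  - rewrite max_l ?max_r ?subr0 ?addr0; try lra.
    pose r := n * (x - a).
    have xa : x - a = b * r by rewrite /r mulrA [b * n]mulrC nb mul1r.
    have r0 : 0 <= r by rewrite mulr_ge0; lra.
    have r1 : r <= 1 by rewrite -nb /r ler_pM2l//; lra.
    rewrite -/r xa; split; nra.
  - by rewrite !max_r ?addr0 ?mul0r ?subrr ?mulr0; try lra; split.
rewrite sE; split; first by apply: sumr_ge0 => m _; have [] := key m.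
split.
  apply: (@le_trans _ _ (\sum_(0 <= m < N) N%:R^-1 * (I m - I m.+1))).
    by apply: ler_sum => m _; have [] := key m.
  rewrite -mulr_sumr (telescope_sumr_eq (fun i => - I i))//; last by move=> i _; rewrite opprK addrC.
  by rewrite ger_pMr// /I; case: ifP; case: ifP; lra.
apply: (@le_trans _ _ (\sum_(0 <= m < N) (p m - p m.+1))).
  by apply: ler_sum => m _; have [] := key m.
rewrite (telescope_sumr_eq (fun i => - p i))//; last by move=> i _; rewrite opprK addrC.
by rewrite opprK pos_partN pos_part0 oppr0 add0r.
Qed.

Variable h : nat.
Hypothesis hN : (0 < h < N)%N.
Let s : R := sin (pi * (h%:R / N%:R)).

Lemma sin_grid_gt0 : 0 < s.
Proof.
have /andP[h0 h1] := hN.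
rewrite sin_gt0_pi// mulr_gt0 ?pi_gt0 ?divr_gt0 ?ltr0n//=.
by rewrite gtr_pMr ?pi_gt0// ltr_pdivrMr// mul1r ltr_nat.
Qed.

(** The sine is symmetric about [pi / 2], so [h] may be replaced by its distance [k <= N / 2] to the
    multiples of [N]; then [N sin (pi k / N) >= pi k / 4 >= k / 2]. *)
Lemma sin_grid_ge : (minn h (N - h))%:R / 2 <= N%:R * s.
Proof.
have /andP[h0 h1] := hN.
have H k : (k.*2 <= N)%N -> k%:R / 2 <= N%:R * sin (pi * (k%:R / N%:R)) :> R.
  move=> kN; have pp := @pi_ge2 R.
  have : pi * (k%:R / N%:R) / 4 <= sin (pi * (k%:R / N%:R)) :> R.
    apply: sin_ge_quarter; rewrite mulr_ge0 ?divr_ge0 ?pi_ge0//= ler_pM2l ?pi_gt0//.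
    by rewrite ler_pdivrMr// mulrC ler_pdivlMr// -natrM ler_nat muln2.
  move=> /(ler_wpM2l (ltW NR)); apply: le_trans.
  have -> : N%:R * (pi * (k%:R / N%:R) / 4) = pi * k%:R / 4 :> R by field; rewrite gt_eqF.
  have : 0 <= k%:R :> R by [].
  nra.
have [le|gt] := leqP h (N - h); first by apply: H; lia.
have <- : sin (pi * ((N - h)%:R / N%:R)) = s.
  rewrite natrB ?(ltnW h1)// mulrBl divff ?gt_eqF// mulrBr mulr1 /s.
  by rewrite sinB sinpi cospi; ring.
apply: H; lia.
Qed.

(** The shift by half a step makes both difference identities exact: differences of [S'] are
    multiples of the cosine, and differences of the cosine are multiples of [S']. *)
Let S' m : R := sin (pi *+ 2 * (h * m)%:R / N%:R - pi * (h%:R / N%:R)).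

Lemma cosq_S' m : 2 * s * cosq N (h * m) = S' m.+1 - S' m.
Proof.
rewrite /S' /cosq /s.
have -> : pi *+ 2 * (h * m.+1)%:R / N%:R - pi * (h%:R / N%:R) = pi *+ 2 * (h * m)%:R / N%:R + pi * (h%:R / N%:R) :> R.
  by rewrite mulnS natrD; ring.
by rewrite sinD sinB; ring.
Qed.

Lemma S'_cosq m : 2 * s * S' m.+1 = cosq N (h * m) - cosq N (h * m.+1).
Proof.
rewrite /S' /cosq /s.
set a : R := pi * (h%:R / N%:R); set b := pi *+ 2 * (h * m.+1)%:R / N%:R - a.
have -> : pi *+ 2 * (h * m.+1)%:R / N%:R = b + a by rewrite /b; ring.
have -> : pi *+ 2 * (h * m)%:R / N%:R = b - a by rewrite /b /a mulnS natrD; ring.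
by move: b => b; rewrite cosB cosD; ring.
Qed.

Lemma sum_by_parts (u v : nat -> R) : u N * v N = u 0%N * v 0%N ->
  \sum_(m < N) u m * (v m.+1 - v m) = \sum_(m < N) (u m - u m.+1) * v m.+1.
Proof.
move=> e; apply/eqP; rewrite -subr_eq0 -sumrB -(big_mkord xpredT (fun m => u m * (v m.+1 - v m) - (u m - u m.+1) * v m.+1)).
rewrite (telescope_sumr_eq (fun i => u i * v i))//; first by rewrite e subrr.
by move=> i _; ring.
Qed.

Lemma sum_tent_cosq1 : 2 * s * \sum_(m < N) g m * cosq N (h * m) = \sum_(m < N) (g m - g m.+1) * S' m.+1.
Proof.
rewrite -sum_by_parts.
  by rewrite mulr_sumr; apply: eq_bigr => m _; rewrite mulrCA cosq_S'.
have -> : g N = g 0 by rewrite -(tent_grid_compl (leq0n N)) subn0.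
congr (_ * _); rewrite /S' muln0 mulr0 mul0r sub0r.
have -> : pi *+ 2 * (h * N)%:R / N%:R = 0 + pi *+ 2 *+ h :> R.
  by rewrite add0r natrM mulrA mulfK ?gt_eqF// mulr_natr.
by rewrite addrAC (periodicn (@sinD2pi R)) sub0r.
Qed.

(** Writing [1 - cosq] instead of [- cosq] absorbs the boundary term at the concave corner [m = 0].
    Every summand on the right is then a product of nonnegative factors. *)
Lemma sum_tent_cosq2 : 2 * s * \sum_(m < N) (g m - g m.+1) * S' m.+1 =
  \sum_(1 <= m < N) (g m.-1 + g m.+1 - 2 * g m) * (1 - cosq N (h * m)).
Proof.
pose C m := cosq N (h * m) : R; pose d m := g m - g m.+1.
have CN : C N = 1 by rewrite /C cosqM.
have C0 : C 0 = 1 by rewrite /C muln0 /cosq mulr0 mul0r cos0.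
have N1 : (1 < N)%N by lia.
have dN : d N.-1 = - d 0.
  rewrite /d prednK//.
  have -> : g N.-1 = g 1 by rewrite -subn1 tent_grid_compl//.
  have -> : g N = g 0 by rewrite -(tent_grid_compl (leq0n N)) subn0.
  ring.
have -> : 2 * s * \sum_(m < N) (g m - g m.+1) * S' m.+1 = \sum_(0 <= m < N) (d m * C m - d m * C m.+1).
  by rewrite big_mkord mulr_sumr; apply: eq_bigr => m _; rewrite mulrCA S'_cosq /d /C; ring.
rewrite sumrB big_ltn// [X in _ - X](_ : _ = \sum_(1 <= m < N) d m.-1 * C m + d N.-1 * C N); last first.
  rewrite -(prednK N0) big_nat_recr//= big_add1/= prednK//.
rewrite C0 CN dN !mulr1.
have e : \sum_(1 <= m < N) (d m.-1 - d m) = 2 * d 0.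
  rewrite (telescope_sumr_eq (fun i => - d i.-1)) //=; first by rewrite dN; ring.
  by move=> i _; ring.
have -> : \sum_(1 <= m < N) (g m.-1 + g m.+1 - 2 * g m) * (1 - cosq N (h * m)) =
   \sum_(1 <= m < N) (d m.-1 - d m) - (\sum_(1 <= m < N) d m.-1 * C m - \sum_(1 <= m < N) d m * C m).
  rewrite -!sumrB; apply: eq_big_nat => m /andP[m1 _]; rewrite /d prednK// /C; ring.
rewrite e; ring.
Qed.

Lemma sum_tent_cosq_ge0 : 0 <= \sum_(m < N) g m * cosq N (h * m).
Proof.
have s0 := sin_grid_gt0.
have : 0 <= 2 * s * (2 * s * \sum_(m < N) g m * cosq N (h * m)).
  rewrite sum_tent_cosq1 sum_tent_cosq2 big_nat; apply: sumr_ge0 => m mN.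
  by rewrite mulr_ge0 ?subr_ge0 ?cos_le1// tent_grid_convex.
by rewrite pmulr_rge0 ?pmulr_rge0// mulr_gt0.
Qed.

Lemma sum_tent_cosq_le1 : s * \sum_(m < N) g m * cosq N (h * m) <= x.
Proof.
rewrite -(ler_pM2l (_ : 0 < 2 :> R))// mulrA sum_tent_cosq1.
apply: le_trans tent_grid_variation; apply: ler_sum => m _.
apply: le_trans (ler_norm _) _; rewrite normrM; apply: ler_piMr => //; exact: sin_max.
Qed.

(** [1 - cosq] is at most [2], and the second differences over [0 < m < N] telescope to
    [2 (g 0 - g 1) <= 2 / N]. *)
Lemma sum_tent_cosq_le2 : s ^+ 2 * \sum_(m < N) g m * cosq N (h * m) <= N%:R^-1.
Proof.
rewrite -(ler_pM2l (_ : 0 < 4 :> R))//.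
have -> : 4 * (s ^+ 2 * \sum_(m < N) g m * cosq N (h * m)) = 2 * s * (2 * s * \sum_(m < N) g m * cosq N (h * m)) by ring.
rewrite sum_tent_cosq1 sum_tent_cosq2.
apply: (@le_trans _ _ (\sum_(1 <= m < N) (g m.-1 + g m.+1 - 2 * g m) * 2)).
  rewrite !big_nat; apply: ler_sum => m mN; apply: ler_wpM2l; first by rewrite subr_ge0 tent_grid_convex.
  by have := cos_geN1 (pi *+ 2 * (h * m)%:R / N%:R : R); rewrite -/(cosq N (h * m)); lra.
have N1 : (1 < N)%N by lia.
rewrite -mulr_suml (telescope_sumr_eq (fun i => g i - g i.-1)) //=; last by case=> // i _ /=; ring.
have -> : g N.-1 = g 1 by rewrite -subn1 tent_grid_compl//.
have -> : g N = g 0 by rewrite -(tent_grid_compl (leq0n N)) subn0.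
have := pos_part_step 0; have := pos_part_step N.-1; rewrite prednK// => /andP[a _] /andP[_ b].
rewrite !tent_gridE// subn0 subn1; lra.
Qed.

End bound.


Lemma le_powR_interp (a u v k : R) : 0 <= a -> a <= u -> a <= v -> 0 <= k <= 1 ->
  a <= u `^ (1 - k) * v `^ k.
Proof.
move=> a0 au av /andP[k0 k1].
have -> : a = a `^ (1 - k) * a `^ k.
  have [->|an] := eqVneq a 0.
    have [->|kn] := eqVneq k 0; first by rewrite subr0 powRr1// mul0r.
    by rewrite [X in _ * X]powR0// mulr0.
  by rewrite -powRD ?subrK ?powRr1// oner_eq0.
by apply: ler_pM; rewrite ?powR_ge0//; apply: ge0_ler_powR; rewrite ?nnegrE ?subr_ge0//;
  exact: le_trans a0 _.
Qed.

Section dft_tent.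
Variables (N : nat) (N0 : (0 < N)%N).

Definition tent_grid x m : R := tent x ((m %% N)%:R / N%:R).

Lemma dft_tentE x h : dft N (tent_grid x) h = N%:R^-1 * \sum_(m < N) tent x (m%:R / N%:R) * cosq N (h * m).
Proof. by congr (_ * _); apply: eq_bigr => m _; rewrite /tent_grid modn_small. Qed.

Let NR : 0 < N%:R :> R. Proof. by rewrite ltr0n. Qed.

Lemma dft_tent0E x : dft N (tent_grid x) 0 = N%:R^-1 * \sum_(m < N) tent x (m%:R / N%:R).
Proof.
rewrite dft_tentE; congr (_ * _); apply: eq_bigr => m _.
by rewrite mul0n /cosq mulr0 mul0r cos0 mulr1.
Qed.

Lemma dft_tent_ge0 x h : 0 <= x <= 1 -> (h < N)%N -> 0 <= dft N (tent_grid x) h.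
Proof.
move=> x01 hN; case: (posnP h) => [->|h0].
  by rewrite dft_tent0E mulr_ge0 ?invr_ge0//; have [] := sum_tent_grid N0 x01.
by rewrite dft_tentE mulr_ge0 ?invr_ge0// sum_tent_cosq_ge0// h0.
Qed.

(** Interpolates between the bounds [N^(-2)] and [y / N] that follow from [sum_tent_grid]. The free
    [y] will be the tail bound of the distribution function, which controls the minimum of both
    tails only. *)
Lemma dft_tent0_le x y k : 0 <= x <= 1 -> Num.min x (1 - x) <= y -> 0 <= k <= 1 ->
  dft N (tent_grid x) 0 <= N%:R `^ (- (2 - k)) * y `^ k.
Proof.
move=> x01 xy k01.
wlog xy' : x x01 xy / x <= y.
  move=> H; have [xx|xx] := leP x (1 - x); first by apply: H => //; move: xy; rewrite min_l.
  rewrite dft_tent0E; under eq_bigr do rewrite -tent_compl; rewrite -dft_tent0E; apply: H.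
  - by lra.
  - by rewrite subKr minC.
  - by move: xy; rewrite min_r// ltW.
have [S0 [S1 S2]] := sum_tent_grid N0 x01.
rewrite -(dft_tent0E x) in S0 S1 S2 * || rewrite dft_tent0E.
have N1 : 0 < N%:R^-1 :> R by rewrite invr_gt0.
have H1 : N%:R^-1 * \sum_(m < N) tent x (m%:R / N%:R) <= N%:R^-1 `^ 2.
  by rewrite powR_mulrn ?(ltW N1)// expr2 ler_pM2l.
have H2 : N%:R^-1 * \sum_(m < N) tent x (m%:R / N%:R) <= N%:R^-1 * y.
  by rewrite ler_pM2l// (le_trans S2).
have /andP[x0 x1] := x01.
apply: le_trans (le_powR_interp _ H1 H2 k01) _; first by rewrite mulr_ge0// ltW.
rewrite powRM ?(ltW N1) ?(le_trans x0)// -!powRrM mulrA -powRD ?(gt_eqF N1) ?implybT//.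
rewrite -powR_inv1 ?ler0n// -powRrM.
by have -> : -1 * (2 * (1 - k) + k) = - (2 - k) by ring.
Qed.

(** With [a] the minimum of [h] and [N - h], one summation by parts gives [2 y / a] and two give
    [4 / a^2]; the interpolated constant [4^(1-k) 2^k] is at most [4]. *)
Lemma dft_tent_le x y k h : 0 <= x <= 1 -> Num.min x (1 - x) <= y -> 0 <= k <= 1 -> (0 < h < N)%N ->
  dft N (tent_grid x) h <= 4 * (minn h (N - h))%:R `^ (- (2 - k)) * y `^ k.
Proof.
move=> x01 xy k01 hN.
wlog xy' : x x01 xy / x <= y.
  move=> H; have [xx|xx] := leP x (1 - x); first by apply: H => //; move: xy; rewrite min_l.
  rewrite dft_tentE; under eq_bigr do rewrite -tent_compl; rewrite -dft_tentE; apply: H.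
  - by lra.
  - by rewrite subKr minC.
  - by move: xy; rewrite min_r// ltW.
have /andP[x0 x1] := x01.
have hm : 0 < (minn h (N - h))%:R :> R by rewrite ltr0n; lia.
have := sin_grid_ge N0 x01 hN; have := sin_grid_gt0 N0 hN.
have := sum_tent_cosq_ge0 N0 x01 hN.
have := @sum_tent_cosq_le1 N N0 x x01 h; have := sum_tent_cosq_le2 N0 x01 hN.
rewrite dft_tentE.
move: ((minn h (N - h))%:R : R) hm (sin _) (\sum_(m < N) _) => a a0 s S H2 H1 S0 s0 as_.
have Ns : 0 < N%:R * s by rewrite mulr_gt0.
have B1 : N%:R^-1 * S <= 2 * a^-1 * y.
  rewrite -(ler_pM2l Ns).
  have -> : N%:R * s * (N%:R^-1 * S) = s * S by field; rewrite gt_eqF.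
  have y0 : 0 <= y by exact: le_trans xy'.
  apply: le_trans H1 _; apply: le_trans xy' _.
  rewrite -[leLHS]mul1r mulrA; apply: ler_wpM2r => //.
  by rewrite mulrA ler_pdivlMr// mul1r; lra.
have B2 : N%:R^-1 * S <= 4 * (a^-1) `^ 2.
  rewrite powR_mulrn ?invr_ge0 ?(ltW a0)// -(ler_pM2l (mulr_gt0 Ns Ns)).
  have -> : N%:R * s * (N%:R * s) * (N%:R^-1 * S) = N%:R * (s ^+ 2 * S) by field; rewrite gt_eqF.
  apply: (@le_trans _ _ 1); first by rewrite -[X in _ <= X](divff (lt0r_neq0 NR)) ler_pM2l.
  rewrite exprVn mulrA ler_pdivlMr ?exprn_gt0// mul1r; nra.
apply: le_trans (le_powR_interp _ B2 B1 k01) _; first by rewrite mulr_ge0// invr_ge0 ltW.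
have y0 : 0 <= y by exact: le_trans xy'.
have a1 : 0 < a^-1 by rewrite invr_gt0.
rewrite !powRM ?mulr_ge0 ?powR_ge0 ?(ltW a1)// -!powRrM.
have -> : 4 `^ (1 - k) * a^-1 `^ (2 * (1 - k)) * (2 `^ k * a^-1 `^ k * y `^ k) =
  (4 `^ (1 - k) * 2 `^ k) * (a^-1 `^ (2 * (1 - k)) * a^-1 `^ k) * y `^ k by ring.
rewrite -powRD ?(gt_eqF a1) ?implybT//.
have -> : a^-1 `^ (2 * (1 - k) + k) = a `^ (- (2 - k)).
  rewrite -powR_inv1 ?(ltW a0)// -powRrM; congr (_ `^ _); ring.
apply: ler_wpM2r; first exact: powR_ge0.
apply: ler_wpM2r; first exact: powR_ge0.
have /andP[k0 k1] := k01.
have e4 : 4 = 4 `^ (1 - k) * 4 `^ k :> R by rewrite -powRD ?subrK ?powRr1// oner_eq0.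
rewrite [leRHS]e4.
apply: ler_wpM2l; first exact: powR_ge0.
apply: ge0_ler_powR => //; rewrite ?nnegrE//; lra.
Qed.

End dft_tent.
End tent.

(** * The t-distribution *)

Section affine_change.
Context {R : realType}.
Local Notation mu := (@lebesgue_measure R).
Local Open Scope ereal_scope.

Definition affine (c a x : R) : R := (c * x + a)%R.

Lemma measurable_affine c a : measurable_fun setT (affine c a : measurableTypeR R -> measurableTypeR R).
Proof.
by apply: continuous_measurable_fun => x; apply: cvgD; [apply: cvgM; [exact: cvg_cst|exact: cvg_id]|exact: cvg_cst].
Qed.

Definition affine_image (c : {posnum R}) (a : R) : {measure set (measurableTypeR R) -> \bar R} :=
  mscale (c%:num%:nng)%R (measure_function_pushforward__canonical__measure_function_Measure
    (@lebesgue_measure R) (measurable_affine c%:num%R a)).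

(** The scaled image measure agrees with Lebesgue measure on half-open intervals, and these
    determine it. *)
Lemma lebesgue_measure_affine (c : {posnum R}) (a : R) (A : set (measurableTypeR R)) :
  measurable A -> mu A = affine_image c a A.
Proof.
move=> mA; apply: lebesgue_measure_unique => //= _ [[x y]] _ <-.
rewrite /mscale/= /pushforward.
have -> : affine c%:num%R a @^-1` `]x, y] = `]((x - a) / c%:num)%R, ((y - a) / c%:num)%R]%classic.
  apply/seteqP; split => t /=; rewrite !in_itv/= /affine;
    by rewrite ltr_pdivrMr// ler_pdivlMr// ltrBlDr lerBrDr mulrC.
rewrite !lebesgue_measure_itv/= !lte_fin ltr_pM2r ?invr_gt0// ltrD2r.
case: ifP => _; last by rewrite mule0.
by rewrite -EFinM -mulrBl opprB addrA subrK mulrC divfK.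
Qed.

Lemma ge0_integral_affine (c a : R) (f : R -> \bar R) : (0 < c)%R ->
  measurable_fun setT f -> (forall x, 0 <= f x) ->
  \int[mu]_x f x = c%:E * \int[mu]_x f (c * x + a)%R.
Proof.
move=> c0 mf f0; pose cp := PosNum c0.
rewrite (eq_measure_integral (affine_image cp a)); last first.
  by move=> A mA _; exact: (lebesgue_measure_affine cp a).
rewrite /affine_image ge0_integral_mscale//=; congr (_ * _).
rewrite (ge0_integral_pushforward (measurable_affine c a))//=.
Qed.

End affine_change.

Section real_integrands.
Context d (T : measurableType d) {R : realType} (m : {measure set T -> \bar R}).
Implicit Types f g : T -> R.

Lemma ge0_le_integral_EFin f g : measurable_fun setT f -> measurable_fun setT g ->
  (forall x, 0 <= f x) -> (forall x, f x <= g x) ->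
  (\int[m]_x (f x)%:E <= \int[m]_x (g x)%:E)%E.
Proof.
move=> mf mg f0 fg; apply: ge0_le_integral => //.
- by move=> x _; rewrite lee_fin.
- exact/measurable_EFinP.
- exact/measurable_EFinP.
- by move=> x _; rewrite lee_fin.
Qed.

Lemma ge0_integralZl_EFinM f (k : R) : measurable_fun setT f -> (forall x, 0 <= f x) -> 0 <= k ->
  (\int[m]_x (k * f x)%:E = k%:E * \int[m]_x (f x)%:E)%E.
Proof.
move=> mf f0 k0; under eq_integral do rewrite EFinM; apply: ge0_integralZl => //.
- exact/measurable_EFinP.
- by move=> x _; rewrite lee_fin.
Qed.

Lemma integral_EFin_ge0 f : (forall x, 0 <= f x) -> (0 <= \int[m]_x (f x)%:E)%E.
Proof. by move=> f0; apply: integral_ge0 => x _; rewrite lee_fin. Qed.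

Lemma integrable_ge0_lty f : measurable_fun setT f -> (forall x, 0 <= f x) ->
  (\int[m]_x (f x)%:E < +oo)%E -> m.-integrable setT (EFin \o f).
Proof.
move=> mf f0 fi; apply/integrableP; split; first exact/measurable_EFinP.
by under eq_integral do rewrite /= ger0_norm//.
Qed.

Lemma integrable_dominated f g : measurable_fun setT f -> (forall x, `|f x| <= g x) ->
  m.-integrable setT (EFin \o g) -> m.-integrable setT (EFin \o f).
Proof.
move=> mf fg ig; apply: le_integrable ig => //; first exact/measurable_EFinP.
by move=> x _; rewrite /= lee_fin (le_trans (fg x))// ler_norm.
Qed.

End real_integrands.

Section power_integral.
Context {R : realType}.
Local Notation mu := (@lebesgue_measure R).

Definition weight (b t : R) : R := (1 + `|t|) `^ b.

Lemma weight_gt0 b t : 0 < weight b t.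
Proof. by rewrite powR_gt0// ltr_wpDr. Qed.

Lemma continuous_powR_affine b (x : R) : 0 < 1 + x -> {for x, continuous (fun t : R => (1 + t) `^ b)}.
Proof.
move=> x0; apply: differentiable_continuous; apply/derivable1_diffP.
have h2 : is_derive x 1 (fun t : R => 1 + t) 1.
  by rewrite -[X in is_derive _ _ _ X]add0r; apply: is_deriveD.
have [] // := @is_derive1_comp _ (fun y => y `^ b) (fun t : R => 1 + t) x _ _ (is_derive1_powR b x0) h2.
Qed.

Lemma continuous_weight (b : R) : continuous (weight b).
Proof.
move=> t; apply: (@continuous_comp _ _ _ (@Num.norm _ R) (fun u : R => (1 + u) `^ b)).
  exact: norm_continuous.
by apply: continuous_powR_affine; rewrite ltr_wpDr.
Qed.

Lemma measurable_weight b : measurable_fun setT (weight b).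
Proof. by apply: continuous_measurable_fun; exact: continuous_weight. Qed.

Lemma integral_weight_lty (b : R) : 1 < b -> (\int[mu]_t (weight (- b) t)%:E < +oo)%E.
Proof.
move=> b1; rewrite ge0_symfun_integralT; last 3 first.
- by move=> x; exact: powR_ge0.
- exact: continuous_weight.
- by move=> x /=; rewrite /weight normrN.
apply: lte_mul_pinfty => //.
rewrite (_ : [set x | _] = `[0, +oo[%classic); last by apply/seteqP; split => x/=; rewrite in_itv/= andbT.
pose F (t : R) : R := - (b - 1)^-1 * (1 + t) `^ (1 - b).
pose f (t : R) : R := (1 + t) `^ (- b).
have b10 : b - 1 != 0 by rewrite subr_eq0 gt_eqF.
have dF (x : R) : 0 < 1 + x -> is_derive x 1 F (f x).
  move=> x0; rewrite /F /f.
  have h := is_derive1_powR (1 - b) x0.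
  have -> : (1 + x) `^ (- b) = - (b - 1)^-1 * ((1 - b) * (1 + x) `^ (1 - b - 1) * 1) :> R.
    rewrite mulr1 mulrA; have -> : - (b - 1)^-1 * (1 - b) = 1 by field.
    by rewrite mul1r; congr (_ `^ _); ring.
  have h2 : is_derive x 1 (fun t : R => 1 + t) 1.
    by rewrite -[X in is_derive _ _ _ X]add0r; apply: is_deriveD.
  apply: is_deriveZ; exact: (@is_derive1_comp _ (fun y => y `^ (1 - b)) (fun t => 1 + t)).
have -> : (\int[mu]_(x in `[0%R, +oo[) (weight (- b) x)%:E = \int[mu]_(x in `[0%R, +oo[) (f x)%:E)%E.
  by apply: eq_integral => x; rewrite inE/= in_itv/= andbT => x0; rewrite /weight ger0_norm.
rewrite (@ge0_continuous_FTC2y _ f F 0 0); first by rewrite ltry.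
- by move=> x x0; exact: powR_ge0.
- apply: continuous_in_subspaceT => x; rewrite inE/= in_itv/= andbT => x0.
  by apply: continuous_powR_affine; lra.
- rewrite /F -[X in _ --> X](mulr0 (- (b - 1)^-1)); apply: cvgMr.
  apply/cvgr0Pnorm_le => e e0; near=> t.
  rewrite ger0_norm ?powR_ge0// -[1 - b]opprB powRN -[leRHS]invrK lef_pV2 ?posrE ?powR_gt0 ?invr_gt0//; last by rewrite ltr_wpDr.
  have -> : e^-1 = (e^-1 `^ (b - 1)^-1) `^ (b - 1).
    by rewrite -powRrM mulVf// powRr1// invr_ge0 ltW.
  apply: ge0_ler_powR; rewrite ?nnegrE ?powR_ge0//.
  - by rewrite subr_ge0 ltW.
  - by rewrite addr_ge0.
  - by apply: (@le_trans _ _ t); rewrite ?lerDr//; near: t; exact: nbhs_pinfty_ge.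
- move=> x x0; have x1 : 0 < 1 + x by lra.
  by have [] := dF x x1.
- apply: cvg_at_right_filter.
  have h0 : 0 < 1 + 0 :> R by rewrite addr0.
  have [d _] := dF 0 h0.
  by apply: differentiable_continuous; apply/derivable1_diffP.
- move=> x; rewrite in_itv/= andbT => x0; have x1 : 0 < 1 + x by lra.
  by rewrite derive1E; have [_] := dF x x1.
Unshelve. all: by end_near. Qed.

End power_integral.

Section student_density.
Context {R : realType}.
Local Notation mu := (@lebesgue_measure R).
Local Notation mR := (measurableTypeR R).
Variables (nu : R) (nu_gt1 : 1 < nu).

Let nu0 : 0 < nu. Proof. exact: lt_trans nu_gt1. Qed.

Definition t_kernel (t : R) : R := (1 + t ^+ 2 / nu) `^ (- ((nu + 1) / 2)).

Lemma t_base_gt0 (t : R) : 0 < 1 + t ^+ 2 / nu.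
Proof. by rewrite ltr_wpDr// divr_ge0 ?sqr_ge0// ltW. Qed.

Lemma t_kernel_gt0 t : 0 < t_kernel t.
Proof. by rewrite powR_gt0// t_base_gt0. Qed.

Lemma continuous_t_kernel : continuous t_kernel.
Proof.
move=> t; apply: (@continuous_comp _ _ _ (fun u : R => u ^+ 2 / nu) (fun u : R => (1 + u) `^ (- ((nu + 1) / 2)))).
  apply: cvgM; last exact: cvg_cst.
  exact: exprn_continuous.
apply: continuous_powR_affine; exact: t_base_gt0.
Qed.

Lemma measurable_t_kernel : measurable_fun setT t_kernel.
Proof. by apply: continuous_measurable_fun; exact: continuous_t_kernel. Qed.

Lemma t_kernel_le t : t_kernel t <= (2 * nu) `^ ((nu + 1) / 2) * weight (- (nu + 1)) t.
Proof.
have w0 : 0 < 1 + `|t| by rewrite ltr_wpDr.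
have n0 : 0 < 2 * nu by rewrite mulr_gt0.
(* [nu > 1] gives [2 nu (1 + t^2 / nu) >= 2 + 2 t^2 >= (1 + |t|)^2]. *)
have key : (1 + `|t|) ^+ 2 <= 2 * nu * (1 + t ^+ 2 / nu).
  have -> : 2 * nu * (1 + t ^+ 2 / nu) = 2 * nu + 2 * t ^+ 2 by field; rewrite gt_eqF ?nu0.
  have -> : t ^+ 2 = `|t| ^+ 2 by rewrite real_normK ?num_real.
  move: (`|t|) (sqr_ge0 (1 - `|t|)) => a; have := nu_gt1; nra.
have e : weight (- (nu + 1)) t = ((1 + `|t|) ^+ 2) `^ (- ((nu + 1) / 2)).
  by rewrite -powR_mulrn ?(ltW w0)// -powRrM /weight; congr (_ `^ _); field.
have e1 : t_kernel t = (2 * nu) `^ ((nu + 1) / 2) * ((2 * nu) `^ (- ((nu + 1) / 2)) * t_kernel t).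
  by rewrite mulrA -powRD ?subrr ?powRr0 ?mul1r// ?(gt_eqF n0) ?implybT.
rewrite e [leLHS]e1 ler_pM2l ?powR_gt0// -powRM ?(ltW n0) ?(ltW (t_base_gt0 _))//.
rewrite !powRN lef_pV2 ?posrE ?powR_gt0 ?exprn_gt0 ?mulr_gt0 ?t_base_gt0//.
apply: ge0_ler_powR; rewrite ?nnegrE ?sqr_ge0//.
- by rewrite divr_ge0// addr_ge0// ltW.
- by rewrite mulr_ge0 ?ltW// t_base_gt0.
Qed.

Lemma integral_t_kernel_lty : (\int[mu]_t (t_kernel t)%:E < +oo)%E.
Proof.
have mw : measurable_fun setT (fun t : mR => (2 * nu) `^ ((nu + 1) / 2) * weight (- (nu + 1)) t).
  by apply: measurable_realfun.measurable_funM => //; exact: measurable_weight.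
apply: (le_lt_trans (ge0_le_integral_EFin mu measurable_t_kernel mw _ t_kernel_le)).
  by move=> t; rewrite ltW// t_kernel_gt0.
rewrite ge0_integralZl_EFinM ?powR_ge0//.
- apply: lte_mul_pinfty; rewrite ?lee_fin ?powR_ge0//.
  by apply: integral_weight_lty; rewrite ltrDr.
- exact: measurable_weight.
- by move=> t; rewrite ltW// weight_gt0.
Qed.

(** The integrand of [Gamma], extended by zero to the line so that Tonelli applies on the whole
    plane. *)
Definition gamma_fun (a x : R) : R := x `^ (a - 1) * expR (- x) * \1_(`]0, +oo[) x.

Lemma gamma_fun_ge0 a x : 0 <= gamma_fun a x.
Proof. by rewrite !mulr_ge0 ?powR_ge0 ?expR_ge0. Qed.

Lemma measurable_gamma_fun a : measurable_fun setT (gamma_fun a).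
Proof.
apply: measurable_realfun.measurable_funM; last exact: measurable_indic.
apply: measurable_realfun.measurable_funM; first exact: measurable_powR.
by apply: measurableT_comp => //; exact: measurable_realfun.oppr_measurable.
Qed.

Lemma integral_gamma_fun a :
  (\int[mu]_(t in `]0%R, +oo[) (t `^ (a - 1) * expR (- t))%:E = \int[mu]_t (gamma_fun a t)%:E)%E.
Proof.
rewrite integral_mkcond; apply: eq_integral => x _; rewrite /gamma_fun patchE indicE.
by case: ifPn => _; rewrite ?mulr1 ?mulr0.
Qed.

(** The Student kernel as a Gamma mixture of Gaussians. Integrating out the second variable produces
    [t_kernel] times a Gamma integral, integrating out the first a Gaussian integral; comparing the
    two evaluates the normalising constant. *)
Let mixed (z : mR * mR) : R := gamma_fun ((nu + 1) / 2) z.2 * expR (- (z.2 * (z.1 ^+ 2 / nu))).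

Let mixed_ge0 z : 0 <= mixed z.
Proof. by rewrite mulr_ge0 ?gamma_fun_ge0 ?expR_ge0. Qed.

Let measurable_mixed : measurable_fun setT mixed.
Proof.
apply: measurable_realfun.measurable_funM.
  by apply: measurableT_comp; [exact: measurable_gamma_fun|exact: measurable_snd].
apply: measurableT_comp => //.
apply: measurable_realfun.measurable_funN.
apply: measurable_realfun.measurable_funM; first exact: measurable_snd.
apply: measurable_realfun.measurable_funM => //.
by apply: measurable_realfun.measurable_funX; exact: measurable_fst.
Qed.

(** Substitution of [u x] for [x] in the Gamma integral, with [u = 1 + t^2 / nu]. *)
Let inner_gamma t : (\int[mu]_x (mixed (t, x))%:E = (t_kernel t)%:E * \int[mu]_x (gamma_fun ((nu + 1) / 2) x)%:E)%E.
Proof.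
have u0 := t_base_gt0 t; set u := 1 + t ^+ 2 / nu in u0.
rewrite [in RHS](@ge0_integral_affine _ u 0 (fun x => (gamma_fun ((nu + 1) / 2) x)%:E))//; last 2 first.
- by apply/measurable_EFinP; exact: measurable_gamma_fun.
- by move=> x; rewrite lee_fin gamma_fun_ge0.
rewrite muleA -EFinM -ge0_integralZl//; last 3 first.
- apply/measurable_EFinP; apply: measurableT_comp; first exact: measurable_gamma_fun.
  exact: measurable_affine.
- by move=> x _; rewrite lee_fin gamma_fun_ge0.
- by rewrite lee_fin mulr_ge0 ?ltW// t_kernel_gt0.
apply: eq_integral => x _; rewrite -EFinM addr0; congr (_%:E).
rewrite /mixed /= /gamma_fun !indicE !mem_setE !in_itv/= !andbT pmulr_rgt0//.
case: ltP => x0; last by rewrite !mulr0 mul0r.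
rewrite !mulr1 powRM ?(ltW u0) ?(ltW x0)// -mulrA -expRD.
have -> : - x - x * (t ^+ 2 / nu) = - (u * x) by rewrite /u; ring.
rewrite !mulrA; congr (_ * _); rewrite -[LHS]mul1r; congr (_ * _).
rewrite /t_kernel -/u -{2}[u]powRr1 ?(ltW u0)// -!powRD ?(gt_eqF u0) ?implybT//.
by rewrite (_ : - _ + _ + _ = 0) ?powRr0//; ring.
Qed.

(** Scaling by [c = sqrt (x / nu)] reduces to the Gaussian integral; the factor [1 / c] lowers the
    exponent of [x] from [(nu + 1) / 2 - 1] to [nu / 2 - 1]. *)
Let inner_gauss x : (\int[mu]_t (mixed (t, x))%:E = (Num.sqrt (nu * pi))%:E * (gamma_fun (nu / 2) x)%:E)%E.
Proof.
have [x0|x0] := leP x 0.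
  have z a : gamma_fun a x = 0 by rewrite /gamma_fun indicE mem_setE in_itv/= andbT ltNge x0 mulr0.
  by rewrite z mule0; apply: integral0_eq => t _; rewrite /mixed/= z mul0r.
pose c := Num.sqrt (x / nu).
have c0 : 0 < c by rewrite sqrtr_gt0 divr_gt0.
have c2 : c ^+ 2 = x / nu by rewrite sqr_sqrtr// divr_ge0// ltW.
have := @integralT_gauss R.
rewrite (@ge0_integral_affine _ c 0 (fun x => (gauss_fun x)%:E))//; last 2 first.
- by apply/measurable_EFinP; exact: measurable_gauss_fun.
- by move=> y; rewrite lee_fin gauss_fun_ge0.
have -> : (\int[mu]_y (gauss_fun (c * y + 0))%:E = \int[mu]_t (expR (- (x * (t ^+ 2 / nu))))%:E)%E.
  apply: eq_integral => t _; rewrite /gauss_fun addr0 exprMn c2; congr (expR (- _))%:E; ring.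
move=> H.
rewrite /mixed/= ge0_integralZl_EFinM ?gamma_fun_ge0//; last first.
  apply: measurableT_comp => //.
  apply: measurable_realfun.measurable_funN.
  apply: measurable_realfun.measurable_funM => //.
  by apply: measurable_realfun.measurable_funM.
have -> : (\int[mu]_t (expR (- (x * (t ^+ 2 / nu))))%:E = (c^-1 * Num.sqrt pi)%:E)%E.
  by rewrite EFinM -H muleA -EFinM mulVf ?mul1e// gt_eqF.
rewrite -!EFinM; congr (_%:E).
rewrite /gamma_fun !indicE !mem_setE !in_itv/= x0 !mulr1.
have -> : c^-1 = Num.sqrt nu * x `^ (- 2^-1).
  by rewrite powRN powR12_sqrt ?(ltW x0)// /c sqrtrM ?(ltW x0)// sqrtrV ?(ltW nu0)// invfM invrK mulrC.
rewrite sqrtrM ?(ltW nu0)//.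
have -> : x `^ (nu / 2 - 1) = x `^ ((nu + 1) / 2 - 1) * x `^ (- 2^-1).
  by rewrite -powRD ?(gt_eqF x0) ?implybT//; congr (_ `^ _); field.
ring.
Qed.

(** Stated as an identity of products in the extended reals: the finiteness of the Gamma integral at
    [nu / 2], which may be below [1], is deduced from it. *)
Lemma integral_t_kernel :
  (\int[mu]_t (t_kernel t)%:E * \int[mu]_x (gamma_fun ((nu + 1) / 2) x)%:E
    = (Num.sqrt (nu * pi))%:E * \int[mu]_x (gamma_fun (nu / 2) x)%:E)%E.
Proof.
have mg a : measurable_fun setT (fun x => (gamma_fun a x)%:E) by apply/measurable_EFinP; exact: measurable_gamma_fun.
have ge0 a : (0 <= \int[mu]_x (gamma_fun a x)%:E)%E by apply: integral_ge0 => x _; rewrite lee_fin gamma_fun_ge0.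
rewrite -ge0_integralZr//; last 2 first.
- by apply/measurable_EFinP; exact: measurable_t_kernel.
- by move=> t _; rewrite lee_fin ltW// t_kernel_gt0.
under eq_integral => t _ do rewrite -inner_gamma.
rewrite (@fubini_tonelli _ _ _ _ _ mu mu (EFin \o mixed)) /=; last 2 first.
- by apply/measurable_EFinP; exact: measurable_mixed.
- by move=> z; rewrite lee_fin mixed_ge0.
under eq_integral => x _ do rewrite inner_gauss.
under eq_integral => x _ do rewrite -EFinM.
apply: ge0_integralZl_EFinM; first exact: measurable_gamma_fun.
  exact: gamma_fun_ge0.
exact: sqrtr_ge0.
Qed.

End student_density.

(** * Distribution function, tails and quantiles *)

Section student_cdf.
Context {R : realType}.
Local Notation mu := (@lebesgue_measure R).
Local Notation mR := (measurableTypeR R).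

(** [ln u <= u - 1] at [u = y / p]; equality holds at [y = p]. *)
Lemma powR_le_expR (p y : R) : 0 < p -> 0 < y -> y `^ p <= p `^ p * expR (y - p).
Proof.
move=> p0 y0; have yp : 0 < y / p by rewrite divr_gt0.
have -> : y `^ p = p `^ p * (y / p) `^ p.
  by rewrite -powRM ?(ltW p0) ?(ltW yp)// mulrCA divff ?mulr1// gt_eqF.
rewrite ler_pM2l ?powR_gt0// {1}/powR gt_eqF// ler_expR.
have : ln (y / p) <= y / p - 1.
  by have := @le_ln1Dx R (y / p - 1); rewrite addrCA subrr addr0; apply; lra.
by move=> /(ler_wpM2l (ltW p0)); rewrite mulrBr mulr1 mulrCA divff ?mulr1 ?gt_eqF.
Qed.

Lemma integral_gt0_of_ge (f : R -> R) (k a : R) : measurable_fun setT f -> (forall x, 0 <= f x) ->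
  0 < k -> (forall x, a <= x <= a + 1 -> k <= f x) -> (0 < \int[mu]_x (f x)%:E)%E.
Proof.
move=> mf f0 k0 kf.
have mi : measurable_fun setT (\1_(`[a, a + 1]) : mR -> R) by exact: measurable_indic.
have mki : measurable_fun setT (fun x : mR => k * \1_(`[a, a + 1]) x).
  exact: measurable_realfun.measurable_funM.
apply: (@lt_le_trans _ _ (\int[mu]_x (k * \1_(`[a, a + 1]) x)%:E)%E).
  rewrite ge0_integralZl_EFinM// ?(ltW k0)//.
  rewrite integral_indic//= setIT lebesgue_measure_itv/= lte_fin ltrDl ltr01.
  by rewrite -EFinD (addrC a) addrK mule1 lte_fin.
apply: ge0_le_integral_EFin => // [x|x]; first by rewrite mulr_ge0// ltW.
rewrite indicE mem_setE in_itv/=; case: (boolP (_ && _)) => [xa|_]; rewrite ?mulr1 ?mulr0//; exact: kf.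
Qed.

Lemma gamma_fun_le (a x : R) : 1 <= a ->
  gamma_fun a x <= ((a + 1) `^ (a + 1) * expR (- a)) * weight (- 2) x.
Proof.
move=> a1; rewrite /gamma_fun indicE mem_setE in_itv/= andbT.
case: (ltP 0 x) => x0; last by rewrite mulr0 mulr_ge0 ?(ltW (weight_gt0 _ _))// mulr_ge0 ?powR_ge0 ?expR_ge0.
have x1 : 0 < 1 + x by lra.
rewrite mulr1 /weight gtr0_norm// powRN powR_mulrn ?(ltW x1)// ler_pdivlMr ?exprn_gt0//.
apply: (@le_trans _ _ ((1 + x) `^ (a - 1) * expR (- x) * (1 + x) ^+ 2)).
  rewrite ler_pM2r ?exprn_gt0// ler_pM2r ?expR_gt0//; apply: ge0_ler_powR; rewrite ?nnegrE; lra.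
rewrite mulrAC -powR_mulrn ?(ltW x1)// -powRD ?(gt_eqF x1) ?implybT//.
have -> : a - 1 + 2 = a + 1 by ring.
have a0 : 0 < a + 1 by lra.
apply: le_trans (ler_wpM2r (expR_ge0 _) (powR_le_expR a0 x1)) _.
by rewrite -mulrA -expRD (_ : 1 + x - (a + 1) - x = - a)//; ring.
Qed.

Lemma integral_gamma_fun_lty a : 1 <= a -> (\int[mu]_x (gamma_fun a x)%:E < +oo)%E.
Proof.
move=> a1; have mw := @measurable_weight R (- 2).
have mkw : measurable_fun setT (fun x : mR => ((a + 1) `^ (a + 1) * expR (- a)) * weight (- 2) x).
  exact: measurable_realfun.measurable_funM.
apply: (le_lt_trans (ge0_le_integral_EFin mu (measurable_gamma_fun a) mkw (gamma_fun_ge0 a) _)).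
  by move=> x; exact: gamma_fun_le.
have k0 : 0 <= (a + 1) `^ (a + 1) * expR (- a) by rewrite mulr_ge0 ?powR_ge0 ?expR_ge0.
rewrite (ge0_integralZl_EFinM mu mw)//; last by move=> x; rewrite ltW// weight_gt0.
by apply: lte_mul_pinfty; rewrite ?lee_fin//; apply: integral_weight_lty; rewrite ltr1n.
Qed.

Lemma integral_gamma_fun_gt0 a : 1 <= a -> (0 < \int[mu]_x (gamma_fun a x)%:E)%E.
Proof.
move=> a1; apply: (@integral_gt0_of_ge _ (expR (- 2)) 1).
- exact: measurable_gamma_fun.
- exact: gamma_fun_ge0.
- exact: expR_gt0.
- move=> x /andP[x1 x2]; rewrite /gamma_fun indicE mem_setE in_itv/= andbT (lt_le_trans ltr01 x1) mulr1.
  rewrite -[leLHS]mul1r; apply: ler_pM; rewrite ?expR_ge0// ?ler_expR; last by lra.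
  by rewrite -[leLHS](powRr0 x) ler_powR// subr_ge0.
Qed.

Lemma weightD (a b x : R) : weight (a + b) x = weight a x * weight b x.
Proof. by rewrite /weight powRD// (_ : _ != 0) ?implybT// gt_eqF// ltr_wpDr. Qed.

Variables (nu : R) (nu_gt1 : 1 < nu).

Let nu0 : 0 < nu. Proof. exact: lt_trans nu_gt1. Qed.

Lemma integral_t_kernel_gt0 : (0 < \int[mu]_x (t_kernel nu x)%:E)%E.
Proof.
apply: (@integral_gt0_of_ge _ ((1 + nu^-1) `^ (- ((nu + 1) / 2))) 0).
- exact: measurable_t_kernel.
- by move=> x; rewrite ltW// t_kernel_gt0.
- by rewrite powR_gt0// ltr_wpDr// invr_ge0 ltW.
- move=> x /andP[x0]; rewrite add0r => x1; rewrite /t_kernel !powRN.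
  have b := t_base_gt0 nu_gt1 x.
  rewrite lef_pV2 ?posrE ?powR_gt0//; last by rewrite ltr_wpDr// invr_ge0 ltW.
  apply: ge0_ler_powR; rewrite ?nnegrE ?(ltW b)//.
  + by rewrite divr_ge0// addr_ge0// ltW.
  + by rewrite addr_ge0// invr_ge0 ltW.
  + by rewrite lerD2l ler_pdivrMr// mulVf ?gt_eqF// expr_le1.
Qed.

Lemma GammaE (a : R) : Gamma a = fine (\int[mu]_x (gamma_fun a x)%:E)%E.
Proof. by rewrite /Gamma /Rintegral integral_gamma_fun. Qed.

Lemma t_const_kernel : exists X : R, [/\ (\int[mu]_x (t_kernel nu x)%:E = X%:E)%E, 0 < X & t_const nu * X = 1].
Proof.
have a1 : 1 <= (nu + 1) / 2 by have := nu_gt1; lra.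
have hG := integral_t_kernel nu_gt1.
have := integral_t_kernel_gt0; have := integral_t_kernel_lty nu_gt1.
have := integral_gamma_fun_lty a1; have := integral_gamma_fun_gt0 a1.
move: hG; rewrite /t_const !GammaE.
have sq : 0 < Num.sqrt (nu * pi) by rewrite sqrtr_gt0 mulr_gt0// pi_gt0.
case: (\int[mu]_x (t_kernel nu x)%:E)%E => [X| |] //.
case: (\int[mu]_x (gamma_fun ((nu + 1) / 2) x)%:E)%E => [G| |] // + G0 _ _ X0.
(* An infinite Gamma integral at [nu / 2] would make the right-hand side infinite, while the
   left-hand side is finite. *)
case: (\int[mu]_x (gamma_fun (nu / 2) x)%:E)%E => [g| |] /=; last 2 first.
- by rewrite gt0_muley ?lte_fin.
- by rewrite gt0_muleNy ?lte_fin.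
move=> -[e]; exists X; rewrite !lte_fin in G0 X0; split => //.
have g0 : g != 0.
  by apply/eqP => g0; move: e; rewrite g0 mulr0 => /eqP; rewrite mulf_eq0 !gt_eqF.
have -> : Num.sqrt (nu * pi) * g = X * G by rewrite e.
by rewrite -mulrA [_^-1 * X]mulrC [X * _^-1]mulrC invfM mulrC; field; rewrite !gt_eqF.
Qed.

Local Notation Phi := (t_cdf nu).
Local Notation phi := (t_density nu).

Lemma t_const_gt0 : 0 < t_const nu.
Proof.
have [X [_ X0 e]] := t_const_kernel.
by rewrite -(pmulr_lgt0 _ X0) e.
Qed.

Lemma t_densityE t : phi t = t_const nu * t_kernel nu t. Proof. by []. Qed.

Lemma t_density_gt0 t : 0 < phi t.
Proof. by rewrite t_densityE mulr_gt0 ?t_const_gt0 ?t_kernel_gt0. Qed.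

Lemma continuous_t_density : continuous phi.
Proof. by move=> t; apply: cvgM; [exact: cvg_cst|exact: continuous_t_kernel]. Qed.

Lemma measurable_t_density : measurable_fun setT phi.
Proof. by apply: continuous_measurable_fun; exact: continuous_t_density. Qed.

Lemma integral_t_density : (\int[mu]_x (phi x)%:E = 1)%E.
Proof.
have [X [e _ e1]] := t_const_kernel.
rewrite (ge0_integralZl_EFinM mu (measurable_t_kernel nu_gt1)) ?e -?EFinM ?e1//; last exact: ltW t_const_gt0.
by move=> x; rewrite ltW// t_kernel_gt0.
Qed.

Lemma t_density_le : exists2 K, 0 < K & forall t, phi t <= K * weight (- (nu + 1)) t.
Proof.
exists (t_const nu * (2 * nu) `^ ((nu + 1) / 2)).
  by rewrite mulr_gt0 ?t_const_gt0// powR_gt0// mulr_gt0.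
move=> t; rewrite t_densityE -[leRHS]mulrA; apply: ler_wpM2l; first exact: ltW t_const_gt0.
exact: t_kernel_le.
Qed.

Lemma integrable_t_density (D : set mR) : measurable D -> mu.-integrable D (EFin \o phi).
Proof.
move=> mD; apply: (@integrableS _ _ _ _ setT) => //.
apply: integrable_ge0_lty; [exact: measurable_t_density|by move=> x; rewrite ltW// t_density_gt0|].
by rewrite integral_t_density ltry.
Qed.

Lemma t_cdf_EFin t : ((Phi t)%:E = \int[mu]_(x in `]-oo, t]) (phi x)%:E)%E.
Proof.
by rewrite /t_cdf /Rintegral fineK//; apply: integrable_fin_num => //; exact: integrable_t_density.
Qed.

Lemma t_cdf_compl t : ((1 - Phi t)%:E = \int[mu]_(x in `]t, +oo[) (phi x)%:E)%E.
Proof.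
have := integral_t_density; rewrite -(setUv `]-oo, t]) ge0_integral_setU//=; last 4 first.
- exact: measurableC.
- by rewrite setUv; apply/measurable_EFinP; exact: measurable_t_density.
- by move=> x _; rewrite lee_fin ltW// t_density_gt0.
- by apply/disj_setPCl.
rewrite setCitvl -t_cdf_EFin EFinB => <-.
by rewrite addeAC subee// add0e.
Qed.

Lemma t_cdf_ge0 t : 0 <= Phi t.
Proof. by apply: Rintegral_ge0 => x _; rewrite ltW// t_density_gt0. Qed.

Lemma t_cdf_le1 t : Phi t <= 1.
Proof.
rewrite -subr_ge0 -lee_fin t_cdf_compl; apply: integral_ge0 => x _.
by rewrite lee_fin ltW// t_density_gt0.
Qed.

Lemma t_cdf_homo : {homo Phi : x y / x <= y}.
Proof.
move=> x y xy; rewrite -lee_fin !t_cdf_EFin; apply: ge0_subset_integral => //=.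
- by apply/measurable_EFinP/measurable_funTS; exact: measurable_t_density.
- by move=> z _; rewrite lee_fin ltW// t_density_gt0.
- by move=> z /=; rewrite !in_itv/= => /le_trans; apply.
Qed.

Lemma measurable_t_cdf : measurable_fun setT Phi.
Proof. by apply: nondecreasing_measurable; [|exact: t_cdf_homo]. Qed.

Lemma t_cdf_lipschitz : exists2 K, 0 < K & forall x y, x <= y -> Phi y - Phi x <= K * (y - x).
Proof.
have [K K0 HK] := t_density_le.
exists K => // x y xy; rewrite -lee_fin EFinB !t_cdf_EFin.
have e : `]-oo, y]%classic = `]-oo, x]%classic `|` `]x, y]%classic.
  by rewrite -itv_bndbnd_setU// bnd_simp.
rewrite e ge0_integral_setU//=; last 3 first.
- by apply/measurable_EFinP/measurable_funTS; exact: measurable_t_density.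
- by move=> z _; rewrite lee_fin ltW// t_density_gt0.
- apply/disj_setPS => z /= []; rewrite !in_itv/= => zx /andP[xz _].
  by move: (le_lt_trans zx xz); rewrite ltxx.
rewrite addeAC subee ?add0e//; last by rewrite -t_cdf_EFin.
apply: (@le_trans _ _ (\int[mu]_(z in `]x, y]) K%:E)%E).
  apply: ge0_le_integral => //.
  - by move=> z _; rewrite lee_fin ltW// t_density_gt0.
  - by apply/measurable_EFinP/measurable_funTS; exact: measurable_t_density.
  - move=> z _; rewrite lee_fin (le_trans (HK z))// ler_piMr ?(ltW K0)//.
    rewrite /weight powRN invf_le1 ?powR_gt0 ?ltr_wpDr//.
    rewrite -[leLHS](powRr0 (1 + `|z|)) ler_powR ?lerDl//.
    by rewrite addr_ge0// ltW.
rewrite integral_cst//= lebesgue_measure_itv/= lte_fin.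
case: ltP => [_|yx]; first by rewrite -EFinD -EFinM.
by rewrite mule0 lee_fin mulr_ge0 ?(ltW K0)// subr_ge0.
Qed.

(** On [|x| >= |t|] the density bound splits as [weight (- p)] times [weight (- (nu + 1 - p))]: the
    first factor is at most its value at [t], the second is integrable since [p < nu]. *)
Lemma t_cdf_tails (p : R) : 0 <= p < nu -> exists2 W, 0 < W & forall t,
  (t <= 0 -> Phi t <= W * weight (- p) t) /\ (0 <= t -> 1 - Phi t <= W * weight (- p) t).
Proof.
move=> /andP[p0 pnu].
have [K K0 HK] := t_density_le.
have b1 : 1 < nu + 1 - p by rewrite -addrA addrC -addrA ltrDl addrC subr_gt0.
have Wf := integral_weight_lty b1.
have W0 : (0 <= \int[mu]_x (weight (- (nu + 1 - p)) x)%:E)%E.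
  by apply: integral_EFin_ge0 => x; rewrite ltW// weight_gt0.
pose W := fine (\int[mu]_x (weight (- (nu + 1 - p)) x)%:E)%E.
have WE : (W%:E = \int[mu]_x (weight (- (nu + 1 - p)) x)%:E)%E by rewrite /W fineK// ge0_fin_numE.
have W0' : 0 <= W by rewrite -lee_fin WE.
have mwp b : measurable_fun setT (fun x : mR => (weight b x : R)) by exact: measurable_weight.
have key t (D : set mR) : measurable D -> (forall x, D x -> `|t| <= `|x|) ->
    (\int[mu]_(x in D) (phi x)%:E <= (K * (W + 1) * weight (- p) t)%:E)%E.
  move=> mD HD.
  apply: (@le_trans _ _ (\int[mu]_(x in D) ((K * weight (- p) t) * weight (- (nu + 1 - p)) x)%:E)%E).
    apply: ge0_le_integral => //.
    - by move=> z _; rewrite lee_fin ltW// t_density_gt0.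
    - by apply/measurable_EFinP/measurable_funTS; exact: measurable_t_density.
    - by apply/measurable_EFinP/measurable_funTS; apply: measurable_realfun.measurable_funM.
    - move=> z Dz; rewrite lee_fin; apply: le_trans (HK z) _; rewrite -mulrA ler_pM2l//.
      have -> : weight (- (nu + 1)) z = weight (- p) z * weight (- (nu + 1 - p)) z.
        by rewrite -weightD; congr (weight _ _); ring.
      rewrite ler_pM2r ?weight_gt0// /weight !powRN lef_pV2 ?posrE ?powR_gt0 ?ltr_wpDr//.
      by apply: ge0_ler_powR; rewrite ?nnegrE ?addr_ge0// lerD2l; exact: HD.
  apply: (@le_trans _ _ (\int[mu]_x ((K * weight (- p) t) * weight (- (nu + 1 - p)) x)%:E)%E).
    apply: ge0_subset_integral => //.
    - by apply/measurable_EFinP; apply: measurable_realfun.measurable_funM.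
    - by move=> z _; rewrite lee_fin !mulr_ge0 ?(ltW K0) ?(ltW (weight_gt0 _ _)).
  rewrite (ge0_integralZl_EFinM mu (mwp _)) ?mulr_ge0 ?(ltW K0) ?(ltW (weight_gt0 _ _))//; last first.
    by move=> z; rewrite ltW// weight_gt0.
  rewrite -WE -EFinM lee_fin mulrAC -!mulrA; apply: ler_wpM2l; first exact: ltW.
  by rewrite ler_wpM2r ?(ltW (weight_gt0 _ _))// lerDl.
exists (K * (W + 1)); first by rewrite mulr_gt0// ltr_wpDl.
move=> t; split => t0.
  rewrite -lee_fin t_cdf_EFin; apply: key => // x /=; rewrite in_itv/= => xt.
  by rewrite !ler0_norm ?lerN2//; exact: le_trans xt t0.
rewrite -lee_fin t_cdf_compl; apply: key => // x /=; rewrite in_itv/= andbT => tx.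
by rewrite !ger0_norm ?(ltW tx)//; apply: le_trans t0 (ltW tx).
Qed.

Lemma t_cdf_tail (p : R) : 0 <= p < nu -> exists2 W, 0 < W &
  forall t, Num.min (Phi t) (1 - Phi t) <= W * weight (- p) t.
Proof.
move=> /t_cdf_tails[W W0 H]; exists W => // t; have [H1 H2] := H t.
rewrite ge_min; case: (leP t 0) => [/H1 ->//|/ltW/H2 ->]; exact: orbT.
Qed.

Lemma weightN1_small (e : R) : 0 < e -> exists2 T : R, 0 <= T & forall t, T <= `|t| -> weight (- 1) t < e.
Proof.
move=> e0; exists e^-1; first by rewrite invr_ge0 ltW.
move=> t et; have t1 : 0 < 1 + `|t| by rewrite ltr_wpDr.
rewrite /weight powR_inv1 ?(ltW t1)// -[ltRHS]invrK ltf_pV2 ?posrE ?invr_gt0//.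
by apply: le_lt_trans et _; rewrite ltrDr.
Qed.

(** The Galois connection between quantile and distribution function. For [0 < u < 1] the tail
    bounds make the set under the [inf] nonempty and bounded below, and Lipschitz continuity makes
    it closed. *)
Lemma t_quantile_le (u t : R) : 0 < u < 1 -> (t_quantile nu u <= t) = (u <= Phi t).
Proof.
move=> /andP[u0 u1].
have p1 : 0 <= (1 : R) < nu by rewrite ler01.
have [W W0 HW] := t_cdf_tails p1.
have [T T0 HT] : exists2 T : R, 0 <= T & forall t, T <= `|t| -> W * weight (- 1) t < Num.min u (1 - u).
  have m0 : 0 < Num.min u (1 - u) / W by rewrite divr_gt0// lt_min u0 subr_gt0.
  have [T T0 H] := weightN1_small m0; exists T => // s /H; by rewrite ltr_pdivlMr// mulrC.
have ub : u <= Phi T.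
  have [_ /(_ T0) h] := HW T; have := HT T; rewrite ger0_norm// lexx => /(_ isT).
  rewrite lt_min => /andP[_ h2]; lra.
have lb s : u <= Phi s -> - T <= s.
  move=> us; rewrite leNgt; apply/negP => sT; move: us; apply/negP; rewrite -ltNge.
  have s0 : s <= 0 by lra.
  have [/(_ s0) h _] := HW s; have := HT s; rewrite ler0_norm// => /(_ _).
  by rewrite lt_min => /(_ _)/andP[|h2 _]; [lra|exact: le_lt_trans h2].
have hi : has_inf [set s | u <= Phi s].
  by split; [exists T|exists (- T) => s /=; exact: lb].
apply/idP/idP => [qt|ut]; last by apply: ge_inf => //; exact: hi.2.
have [K K0 HK] := t_cdf_lipschitz.
apply/ler_addgt0Pr => e e0.
have eK : 0 < e / K by rewrite divr_gt0.
have [s us st] := inf_adherent eK hi.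
have st' : s <= t + e / K by rewrite ltW// (lt_le_trans st)// lerD2r.
apply: le_trans us _; apply: le_trans (t_cdf_homo st') _.
rewrite -lerBlDl; apply: le_trans (HK _ _ _) _; first by rewrite lerDl ltW.
by rewrite addrAC subrr add0r mulrCA divff ?mulr1 ?gt_eqF.
Qed.

(** For [u <= 0] the set under the [inf] is the whole line and for [u > 1] it is empty, so the
    quantile is constant on each of these rays; the point [1] is treated separately. *)
Lemma measurable_t_quantile : measurable_fun setT (t_quantile nu).
Proof.
have m1 : measurable_fun (`](0 : R), 1[ : set R) (t_quantile nu).
  apply: (measurability (@RGenOInfty.G R)) => [|/= _ [_] [r] -> <-].
    exact: RGenOInfty.measurableE.
  rewrite (_ : _ `&` _ = `](0 : R), 1[ `&` `]Phi r, +oo[).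
    exact: measurableI.
  apply/seteqP; split => u /=; rewrite !in_itv/= !andbT => -[u01].
    by rewrite ltNge (t_quantile_le _ u01) -ltNge.
  by split => //; rewrite ltNge (t_quantile_le _ u01) -ltNge.
have m0 : measurable_fun (`]-oo, (0 : R)] : set R) (t_quantile nu).
  apply: (@eq_measurable_fun _ _ _ _ _ (cst (inf setT))) => // u; rewrite inE/= in_itv/= => u0.
  rewrite /t_quantile; congr inf; apply/seteqP; split => // t _ /=.
  by rewrite (le_trans u0)// t_cdf_ge0.
have m2 : measurable_fun (`](1 : R), +oo[ : set R) (t_quantile nu).
  apply: (@eq_measurable_fun _ _ _ _ _ (cst (inf set0))) => // u; rewrite inE/= in_itv/= andbT => u0.
  rewrite /t_quantile; congr inf; apply/seteqP; split => // t /=.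
  by move=> h; have := le_trans h (t_cdf_le1 t); rewrite leNgt u0.
have -> : [set: R] = (`]-oo, (0 : R)] `|` `](0 : R), 1[) `|` ([set (1 : R)] `|` `](1 : R), +oo[).
  apply/seteqP; split => // u _; rewrite /= !in_itv/= andbT.
  case: (leP u 0) => u0; first by left; left.
  by case: (ltgtP u 1) => u1; [left; right|right; right|right; left].
apply/measurable_funU; [exact: measurableU|exact: measurableU|split].
  by apply/measurable_funU.
apply/measurable_funU => //; split => //; exact: measurable_fun_set1.
Qed.

End student_cdf.

(** * Lebesgue measure on tuples *)

Section product_integrals.
Local Open Scope ereal_scope.
Context d1 d2 (T1 : measurableType d1) (T2 : measurableType d2) (R : realType).
Variables (m1 : {sigma_finite_measure set T1 -> \bar R}) (m2 : {sigma_finite_measure set T2 -> \bar R}).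

Lemma measurable_mul_fst_snd (a : T1 -> R) (b : T2 -> R) :
  measurable_fun setT a -> measurable_fun setT b ->
  measurable_fun setT (fun z : T1 * T2 => (a z.1 * b z.2)%R).
Proof.
move=> ma mb; apply: measurable_realfun.measurable_funM.
  by apply: measurableT_comp => //; exact: measurable_fst.
by apply: measurableT_comp => //; exact: measurable_snd.
Qed.

Lemma integrable_mul (a : T1 -> R) (b : T2 -> R) :
  m1.-integrable setT (EFin \o a) -> m2.-integrable setT (EFin \o b) ->
  (m1 \x m2).-integrable setT (fun z => (a z.1 * b z.2)%:E).
Proof.
move=> ia ib.
have ma : measurable_fun setT a by apply/measurable_EFinP; exact: measurable_int ia.
have mb : measurable_fun setT b by apply/measurable_EFinP; exact: measurable_int ib.
apply/integrable12ltyP; first by apply/measurable_EFinP; exact: measurable_mul_fst_snd.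
have /integrableP[_ ia'] := ia; have /integrableP[_ ib'] := ib.
have -> : \int[m1]_x \int[m2]_y `|(a x * b y)%:E| = \int[m1]_x (`|(a x)%:E| * \int[m2]_y `|(b y)%:E|).
  apply: eq_integral => x _; rewrite -ge0_integralZl//=; first last.
  - by apply/measurable_EFinP; exact: measurableT_comp.
  by apply: eq_integral => y _; rewrite /= normrM EFinM.
rewrite ge0_integralZr//=; first last.
- by apply: integral_ge0.
- by apply/measurable_EFinP; exact: measurableT_comp.
rewrite lte_mul_pinfty//; first exact: integral_ge0.
by rewrite ge0_fin_numE//; exact: integral_ge0.
Qed.

Lemma Rintegral_mul (a : T1 -> R) (b : T2 -> R) :
  m1.-integrable setT (EFin \o a) -> m2.-integrable setT (EFin \o b) ->
  (\int[m1 \x m2]_z (a z.1 * b z.2) = \int[m1]_x a x * \int[m2]_y b y)%R.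
Proof.
move=> ia ib; rewrite /Rintegral -integral12_prod_meas1; last exact: integrable_mul.
have -> : \int[m1]_x fubini_F m2 (fun z => (a z.1 * b z.2)%:E) x = \int[m1]_x ((fine (\int[m2]_y (b y)%:E))%:E * (a x)%:E).
  apply: eq_integral => x _; rewrite /fubini_F/=.
  under eq_integral do rewrite EFinM.
  by rewrite integralZl// muleC fineK//; exact: integrable_fin_num.
by rewrite integralZl// -{1}(fineK (integrable_fin_num _ ia))//= mulrC.
Qed.

Lemma sigma_finite_prod : sigma_finite setT (m1 \x m2).
Proof.
have /sigma_finiteP[F [FT ndF HF]] := @sigma_finiteT _ _ _ m1.
have /sigma_finiteP[G [GT ndG HG]] := @sigma_finiteT _ _ _ m2.
exists (fun n => F n `*` G n).
  apply/seteqP; split => // -[x y] _.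
  have [i _ Fi] : (\bigcup_i F i) x by rewrite -FT.
  have [j _ Gj] : (\bigcup_i G i) y by rewrite -GT.
  exists (maxn i j) => //; split => /=.
    by move: x Fi; apply/subsetPset/ndF/leq_maxl.
  by move: y Gj; apply/subsetPset/ndG/leq_maxr.
move=> k; have [mF lF] := HF k; have [mG lG] := HG k.
split; first exact: measurableX.
by rewrite product_measure1E// lte_mul_pinfty// ge0_fin_numE.
Qed.

End product_integrals.

Section sigma_finite_pack.
Context d (T : measurableType d) (R : realType).
Variables (m : {measure set T -> \bar R}) (m_sigma_finite : sigma_finite setT m).

(* [lebesgue_tuple] carries no sigma-finite structure, which Fubini requires. *)
Definition sigma_finite_pack & sigma_finite setT m : set T -> \bar R := m.
Local Notation m' := (sigma_finite_pack m_sigma_finite).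

Let m'0 : m' set0 = 0%E. Proof. exact: measure0. Qed.
Let m'_ge0 A : (0 <= m' A)%E. Proof. exact: measure_ge0. Qed.
Let m'_sigma_additive : semi_sigma_additive m'. Proof. exact: measure_semi_sigma_additive. Qed.
HB.instance Definition _ := isMeasure.Build _ _ _ m' m'0 m'_ge0 m'_sigma_additive.
HB.instance Definition _ := Measure_isSigmaFinite.Build _ _ _ m' m_sigma_finite.

End sigma_finite_pack.

Section lebesgue_tuple_theory.
Context {R : realType}.
Local Notation mR := (measurableTypeR R).
Local Notation mu := (@lebesgue_measure R).
Local Notation leb n := (@lebesgue_tuple R n).

Definition tuncons n (t : n.+1.-tuple mR) : n.-tuple mR * mR := ([tuple of behead t], thead t).

Lemma tconsK n : cancel (@tcons R n) (@tuncons n).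
Proof. by case=> t x; rewrite /tuncons /tcons theadE; congr (_, _); apply/val_inj. Qed.

Lemma measurable_tuncons n : measurable_fun setT (@tuncons n).
Proof.
apply/measurable_fun_pairP; split => /=.
  apply/measurable_fun_tnthP => i; rewrite (_ : _ \o _ = fun t : n.+1.-tuple mR => tnth t (lift ord0 i)).
    exact: measurable_tnth.
  by apply/funext => t /=; rewrite tnth_behead; congr tnth; apply/val_inj; rewrite /= inordK ?ltnS.
exact: measurable_tnth.
Qed.

Lemma sigma_finite_lebesgue_tuple n : sigma_finite setT (leb n).
Proof.
elim: n => [|n IH].
  exists (fun=> setT); first by rewrite bigcup_const.
  by move=> i; split => //=; rewrite diracE ltry.
pose m : {sigma_finite_measure set (n.-tuple mR) -> \bar R} := sigma_finite_pack IH.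
have [F FT HF] := sigma_finite_prod m mu.
exists (fun i => @tuncons n @^-1` F i).
  by rewrite -preimage_bigcup -FT.
move=> i; have [mF lF] := HF i; split.
  by rewrite -[X in measurable X]setTI; exact: measurable_tuncons.
rewrite /= /lebesgue_cons /pushforward.
have -> : @tcons R n @^-1` (@tuncons n @^-1` F i) = F i by rewrite -comp_preimage; apply/seteqP; split=> z; rewrite /= tconsK.
exact: lF.
Qed.

Definition leb_tuple n : {sigma_finite_measure set (n.-tuple mR) -> \bar R} :=
  sigma_finite_pack (sigma_finite_lebesgue_tuple n).

Lemma integrable_tuple n (f : n.+1.-tuple mR -> \bar R) : measurable_fun setT f ->
  (leb_tuple n \x mu)%E.-integrable setT (f \o @tcons R n) -> (leb n.+1).-integrable setT f.
Proof.
by move=> mf fi; apply: (integrable_pushforward (@measurable_tcons R n)).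
Qed.

Lemma integral_tuple n (f : n.+1.-tuple mR -> \bar R) : measurable_fun setT f ->
  (leb_tuple n \x mu)%E.-integrable setT (f \o @tcons R n) ->
  (\int[leb n.+1]_t f t = \int[leb_tuple n \x mu]_z f (tcons z))%E.
Proof.
move=> mf fi.
rewrite -[LHS]/(\int[pushforward (leb_tuple n \x mu)%E (@tcons R n)]_t f t)%E.
by rewrite (integral_pushforward (@measurable_tcons R n))//= preimage_setT.
Qed.

Lemma measurable_prod_tnth n (h : 'I_n -> R -> R) : (forall i, measurable_fun setT (h i)) ->
  measurable_fun setT (fun t : n.-tuple mR => \prod_(i < n) h i (tnth t i)).
Proof.
move=> mh; apply: measurable_prod => i _; apply: measurableT_comp; first exact: mh.
exact: measurable_tnth.
Qed.

Lemma prod_tcons n (h : 'I_n.+1 -> R -> R) (z : n.-tuple mR * mR) :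
  \prod_(i < n.+1) h i (tnth (tcons z) i) = \prod_(i < n) h (lift ord0 i) (tnth z.1 i) * h ord0 z.2.
Proof.
rewrite big_ord_recl mulrC; congr (_ * _).
by apply: eq_bigr => i _; rewrite /tcons tnthS.
Qed.

Lemma integral_prod_tuple n (h : 'I_n -> R -> R) : (forall i, mu.-integrable setT (EFin \o h i)) ->
  (leb n).-integrable setT (fun t => (\prod_(i < n) h i (tnth t i))%:E) /\
  \int[leb n]_t \prod_(i < n) h i (tnth t i) = \prod_(i < n) \int[mu]_x h i x.
Proof.
elim: n h => [|n IH] h ih.
  split.
    under eq_fun do rewrite big_ord0.
    by apply: finite_measure_integrable_cst.
  rewrite big_ord0; under eq_Rintegral do rewrite big_ord0.
  by rewrite /Rintegral integral_dirac// diracT mul1e.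
have mh i : measurable_fun setT (h i) by apply/measurable_EFinP; exact: measurable_int (ih i).
have [I1 I2] := IH (fun i => h (lift ord0 i)) (fun i => ih _).
have mp : measurable_fun setT (fun t : n.+1.-tuple mR => (\prod_(i < n.+1) h i (tnth t i))%:E).
  by apply/measurable_EFinP; exact: measurable_prod_tnth.
have ii : (leb_tuple n \x mu)%E.-integrable setT ((fun t => (\prod_(i < n.+1) h i (tnth t i))%:E) \o @tcons R n).
  rewrite (_ : _ \o _ = fun z => ((fun t => \prod_(i < n) h (lift ord0 i) (tnth t i)) z.1 * h ord0 z.2)%:E).
    exact: (@integrable_mul _ _ _ _ _ (leb_tuple n) mu (fun t => \prod_(i < n) h (lift ord0 i) (tnth t i)) (h ord0)).
  by apply/funext => z /=; rewrite prod_tcons.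
split; first exact: integrable_tuple.
rewrite /Rintegral integral_tuple//.
have -> : (\int[leb_tuple n \x mu]_z (\prod_(i < n.+1) h i (tnth (tcons z) i))%:E =
   \int[leb_tuple n \x mu]_z ((fun t => \prod_(i < n) h (lift ord0 i) (tnth t i)) z.1 * h ord0 z.2)%:E)%E.
  by apply: eq_integral => z _; rewrite prod_tcons.
rewrite -/(Rintegral (leb_tuple n \x mu)%E setT (fun z => (fun t => \prod_(i < n) h (lift ord0 i) (tnth t i)) z.1 * h ord0 z.2)).
rewrite (@Rintegral_mul _ _ _ _ _ (leb_tuple n) mu _ (h ord0))// big_ord_recl mulrC; congr (_ * _).
exact: I2.
Qed.

End lebesgue_tuple_theory.

(** * Integral representation by mixed derivatives *)

Section decaying_functions.
Context {R : realType}.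
Local Notation mu := (@lebesgue_measure R).
Local Notation mR := (measurableTypeR R).

Lemma weightN_le_harmonic n (t : R) : n%:R <= `|t| -> weight (- 2) t <= n.+1%:R^-1.
Proof.
move=> nt; have t1 : 1 <= 1 + `|t| by rewrite lerDl.
rewrite (@le_trans _ _ (weight (- 1) t))//; first by rewrite ler_powR//; lra.
have t0 : 0 < 1 + `|t| by rewrite ltr_wpDr.
rewrite /weight powR_inv1 ?(ltW t0)// lef_pV2 ?posrE ?ltr0n//.
by rewrite -natr1 addrC lerD2l.
Qed.

Lemma cvg_weightN (h : R -> R) (C : R) (x : nat -> R) : 0 <= C -> (forall t, `|h t| <= C * weight (- 2) t) ->
  (forall n, n%:R <= `|x n|) -> (h \o x) @ \oo --> (0 : R).
Proof.
move=> C0 hC xn; apply: norm_cvg0.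
have cC : (fun n => C * harmonic n) @ \oo --> (0 : R).
  by rewrite -[X in _ --> X](mulr0 C); apply: cvgM; [exact: cvg_cst|exact: cvg_harmonic].
apply: (@squeeze_cvgr _ _ _ _ (fun=> 0) _ _ _ _ (cvg_cst 0) cC).
apply: nearW => n; rewrite normr_ge0/= (le_trans (hC _))// ler_wpM2l//.
exact: weightN_le_harmonic.
Qed.

Lemma integrable_weightN b : 1 < b -> mu.-integrable setT (EFin \o weight (- b)).
Proof.
move=> b1; apply: integrable_ge0_lty; first exact: measurable_weight.
  by move=> x; rewrite ltW ?weight_gt0.
exact: integral_weight_lty.
Qed.

Lemma integral_itv_mul (f : R -> R) (a b : R) :
  (\int[mu]_(t in `[a, b]) (f t)%:E = \int[mu]_t ((a <= t <= b)%R%:R * f t)%:E)%E.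
Proof.
rewrite integral_mkcond; apply: eq_integral => t _; rewrite patchE mem_setE in_itv/=.
by case: ifP => _; rewrite ?mul1r ?mul0r.
Qed.

Lemma measurable_bool_mul (p : pred R) (f : R -> R) :
  measurable_fun setT (p : R -> bool) -> measurable_fun setT f ->
  measurable_fun setT (fun t : mR => (p t)%:R * f t : R).
Proof.
move=> mp mf; rewrite (_ : (fun _ => _) = fun t => if p t then f t else 0); last first.
  by apply/funext => t; case: (p t); rewrite ?mul1r ?mul0r.
exact: measurable_fun_ifT.
Qed.

Lemma measurable_in_itv (a b : R) : measurable_fun setT (fun t : R => a <= t <= b).
Proof.
apply: (measurable_fun_bool true); by rewrite setTI (_ : _ @^-1` _ = `[a, b]%classic).
Qed.

(** The fundamental theorem on [[a n, n]] followed by dominated convergence. The sequence [a] and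
    the limit indicator [p] are free so as to cover both the line and the half-line from [z]. *)
Lemma integral_derivative (h h' : R -> R) (p : pred R) (a : nat -> R) (l : R) :
  (forall t : R, is_derive t 1 h (h' t)) -> continuous h' -> mu.-integrable setT (EFin \o h') ->
  measurable_fun setT (p : R -> bool) ->
  (forall t, \forall n \near \oo, (a n <= t <= n%:R) = p t) ->
  (\forall n \near \oo, a n < n%:R) -> (fun n => h n%:R - h (a n)) @ \oo --> l ->
  \int[mu]_t ((p t)%:R * h' t) = l.
Proof.
move=> dh ch' ih' mp ap an hl.
have mh' : measurable_fun setT h' by exact: continuous_measurable_fun.
have [] := @dominated_convergence _ _ _ mu setT measurableT
  (fun n t => ((a n <= t <= n%:R)%R%:R * h' t)%:E) (fun t => ((p t)%:R * h' t)%:E)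
  (fun t => `|h' t|%:E).
- by move=> n; apply/measurable_EFinP; apply: measurable_bool_mul => //; exact: measurable_in_itv.
- by apply/measurable_EFinP; exact: measurable_bool_mul.
- apply: aeW => t _; apply: cvg_EFin; first by near=> n.
  apply: cvg_near_cst; near=> n => /=; congr (_%:R * _).
  by congr nat_of_bool; near: n; exact: ap.
- exact: (integrable_norm ih').
- apply: aeW => t n _; rewrite lee_fin normrM.
  by case: (_ <= _ <= _); rewrite ?normr1 ?mul1r// normr0 mul0r.
move=> _ _ cv; rewrite /Rintegral.
suff : (fun n => \int[mu]_t ((a n <= t <= n%:R)%R%:R * h' t)%:E)%E @ \oo --> l%:E.
  by move/(cvg_unique (@ereal_hausdorff R) cv) => ->.
have hlE : (fun n => (h n%:R - h (a n))%:E) @ \oo --> l%:E by apply: cvg_EFin hl; near=> n.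
apply: cvg_trans hlE.
apply: near_eq_cvg; near=> n.
have lt_an : a n < n%:R by near: n.
rewrite -integral_itv_mul/= (@continuous_FTC2 _ h' h)//.
- exact: continuous_subspaceT.
- have ch x : {for x, continuous h}.
    by apply: differentiable_continuous; apply/derivable1_diffP; have [] := dh x.
  split.
  + by move=> x _; have [] := dh x.
  + exact/cvg_at_right_filter/ch.
  + exact/cvg_at_left_filter/ch.
- by move=> x _; rewrite derive1E; have [_ ->] := dh x.
Unshelve. all: by end_near. Qed.

Lemma integral_derivative0 (h h' : R -> R) (C : R) :
  (forall t : R, is_derive t 1 h (h' t)) -> continuous h' ->
  (forall t, `|h t| <= C * weight (- 2) t) -> mu.-integrable setT (EFin \o h') ->
  \int[mu]_t h' t = 0.
Proof.
move=> dh ch' hC ih'.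
have C0 : 0 <= C by have := le_trans (normr_ge0 _) (hC 0); rewrite pmulr_lge0 ?weight_gt0.
have <- : \int[mu]_t ((xpredT t)%:R * h' t) = \int[mu]_t h' t.
  by apply: eq_Rintegral => t _; rewrite mul1r.
apply: (@integral_derivative h h' xpredT (fun n => - n%:R)) => //.
- move=> t; near=> n; rewrite -ler_norml; near: n.
  exists (Num.truncn `|t|).+1 => // n /= tn; rewrite (le_trans (ltW (truncnS_gt _)))//.
  by rewrite ler_nat.
- by exists 1%N => // n /= n0; rewrite (@lt_trans _ _ 0) ?oppr_lt0 ?ltr0n.
- rewrite -[X in _ --> X](subr0 0); apply: cvgB.
  + by apply: (@cvg_weightN h C (fun n => n%:R)) => // n; rewrite normr_nat.
  + by apply: (@cvg_weightN h C (fun n => - n%:R)) => // n; rewrite normrN normr_nat.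
Unshelve. all: by end_near. Qed.

Lemma integral_derivative_tail (h h' : R -> R) (C z : R) :
  (forall t : R, is_derive t 1 h (h' t)) -> continuous h' ->
  (forall t, `|h t| <= C * weight (- 2) t) -> mu.-integrable setT (EFin \o h') ->
  \int[mu]_t ((z <= t)%R%:R * h' t) = - h z.
Proof.
move=> dh ch' hC ih'.
have C0 : 0 <= C by have := le_trans (normr_ge0 _) (hC 0); rewrite pmulr_lge0 ?weight_gt0.
apply: (@integral_derivative h h' (fun t => z <= t) (fun=> z)) => //.
- apply: (measurable_fun_bool true); rewrite setTI (_ : _ @^-1` _ = `[z, +oo[%classic)//.
  by apply/seteqP; split => t /=; rewrite in_itv/= andbT.
- move=> t; near=> n; rewrite (_ : t <= n%:R) ?andbT//; near: n.
  exists (Num.truncn `|t|).+1 => // n /= tn; rewrite (le_trans (ler_norm _))// (le_trans (ltW (truncnS_gt _)))//.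
  by rewrite ler_nat.
- exists (Num.truncn `|z|).+1 => // n /= tn; rewrite (le_lt_trans (ler_norm _))// (lt_le_trans (truncnS_gt _))//.
  by rewrite ler_nat.
- rewrite -[X in _ --> X](add0r); apply: cvgB; last exact: cvg_cst.
  by apply: (@cvg_weightN h C (fun n => n%:R)) => // n; rewrite normr_nat.
Unshelve. all: by end_near. Qed.

End decaying_functions.

Section one_dimension.
Context {R : realType} (nu : R) (nu_gt1 : 1 < nu).
Local Notation mu := (@lebesgue_measure R).
Local Notation mR := (measurableTypeR R).
Local Notation Phi := (t_cdf nu).
Local Notation phi := (t_density nu).

Lemma is_derive_t_cdf (t : R) : is_derive t 1 Phi (phi t).
Proof.
have [] := @continuous_FTC1 R phi -oo%O t (t + 1).
- by rewrite ltrDl.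
- by apply: integrable_t_density => //; exact: measurable_itv.
- by rewrite ltNyr.
- exact: continuous_t_density.
by move=> d1 d2; apply: DeriveDef; [exact: d1|rewrite -derive1E; exact: d2].
Qed.

(** The bit tells whether the coordinate is differentiated. *)
Definition kernel1 (b : bool) (z t : R) : R := if b then Phi t - (z <= t)%R%:R else phi t.

Lemma measurable_kernel1 b z : measurable_fun setT (kernel1 b z : mR -> mR).
Proof.
case: b; last exact: measurable_t_density.
apply: measurable_realfun.measurable_funB; first exact: measurable_t_cdf.
rewrite (_ : (fun _ => _) = fun t : mR => (z <= t)%R%:R * (1 : R)); last by apply/funext => t; rewrite mulr1.
apply: measurable_bool_mul => //.
apply: (measurable_fun_bool true); rewrite setTI (_ : _ @^-1` _ = `[z, +oo[%classic)//.
by apply/seteqP; split => t /=; rewrite in_itv/= andbT.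
Qed.

Lemma kernel1_bounded : exists2 K : R, 0 < K & forall b z t, `|kernel1 b z t| <= K.
Proof.
have [K K0 hK] := t_density_le nu_gt1; exists (K + 1); first by rewrite addr_gt0.
case=> z t /=.
  have := t_cdf_ge0 nu_gt1 t; have := t_cdf_le1 nu_gt1 t.
  by rewrite ler_norml; case: (z <= t) => /=; lra.
rewrite gtr0_norm ?t_density_gt0// (le_trans (hK t))// ler_wpDr// ler_piMr// ?(ltW K0)//.
rewrite /weight -[leRHS](powRr0 (1 + `|t|)) ler_powR ?lerDl//.
by have := nu_gt1; lra.
Qed.

(** [g * Phi] vanishes at both ends and has derivative [g * phi + g' * Phi], whose integral is
    therefore [0]; the integral of [g'] from [z] on is [- g z]. *)
Lemma representation1 (g g' : R -> R) (C z : R) :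
  (forall t : R, is_derive t 1 g (g' t)) -> continuous g' ->
  (forall t, `|g t| <= C * weight (- 2) t) -> (forall t, `|g' t| <= C * weight (- 2) t) ->
  g z = \int[mu]_t (g t * kernel1 false z t) + \int[mu]_t (g' t * kernel1 true z t).
Proof.
move=> dg cg' gC g'C.
have C0 : 0 <= C by have := le_trans (normr_ge0 _) (gC 0); rewrite pmulr_lge0 ?weight_gt0.
have cg : continuous g.
  by move=> t; apply: differentiable_continuous; apply/derivable1_diffP; have [] := dg t.
have cPhi : continuous Phi.
  by move=> t; apply: differentiable_continuous; apply/derivable1_diffP; have [] := is_derive_t_cdf t.
have cphi := continuous_t_density nu_gt1.
have iw : mu.-integrable setT (EFin \o (fun t => C * weight (- 2) t)).
  rewrite (_ : _ \o _ = fun t => (C%:E * (EFin \o weight (- 2)) t)%E)//.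
  by apply: integrableZl => //; apply: integrable_weightN; rewrite ltr1n.
have mphi : measurable_fun setT (phi : mR -> R) by exact: measurable_t_density.
have mPhi : measurable_fun setT (Phi : mR -> R) by exact: measurable_t_cdf.
have mg : measurable_fun setT (g : mR -> R) by exact: continuous_measurable_fun.
have mg' : measurable_fun setT (g' : mR -> R) by exact: continuous_measurable_fun.
have [K K0 hK] := kernel1_bounded.
have bnd b (f : R -> R) : measurable_fun setT (f : mR -> R) -> (forall t, `|f t| <= C * weight (- 2) t) ->
    mu.-integrable setT (EFin \o (fun t => f t * kernel1 b z t)).
  move=> mf fC; apply: (@integrable_dominated _ _ _ mu _ (fun t => K * (C * weight (- 2) t))).
  - by apply: measurable_realfun.measurable_funM => //; exact: measurable_kernel1.
  - by move=> t; rewrite normrM mulrC ler_pM.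
  - rewrite (_ : _ \o _ = fun t => (K%:E * (EFin \o (fun t => (C * weight (- 2) t)%R)) t)%E)//.
    exact: integrableZl.
have ig' : mu.-integrable setT (EFin \o g') by apply: integrable_dominated iw.
have iPhi : mu.-integrable setT (EFin \o (fun t => g' t * Phi t)).
  apply: (@integrable_dominated _ _ _ mu _ (fun t => C * weight (- 2) t)) => //.
    exact: measurable_realfun.measurable_funM.
  move=> t; rewrite normrM -[leRHS]mulr1 ler_pM//.
  by rewrite ger0_norm ?t_cdf_le1 ?t_cdf_ge0.
have iphi : mu.-integrable setT (EFin \o (fun t => g t * phi t)) by exact: (bnd false).
have i1 : mu.-integrable setT (EFin \o (fun t => (z <= t)%R%:R * g' t)).
  apply: (integrable_dominated _ _ iw).
    apply: measurable_bool_mul => //.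
    apply: (measurable_fun_bool true); rewrite setTI (_ : _ @^-1` _ = `[z, +oo[%classic)//.
    by apply/seteqP; split => t /=; rewrite in_itv/= andbT.
  by move=> t; rewrite normrM; case: (z <= t); rewrite ?normr1 ?mul1r// normr0 mul0r (le_trans _ (g'C t)).
have E1 : \int[mu]_t (g t * phi t + g' t * Phi t) = 0.
  apply: (@integral_derivative0 _ (fun t => g t * Phi t) _ C) => //.
  - move=> t; have := is_deriveM (dg t) (is_derive_t_cdf t).
    by move=> /(@is_derive_eq _ _ _ _ _ _ _ _); apply; rewrite /GRing.scale/= (mulrC (Phi t)).
  - move=> t; apply: cvgD; apply: cvgM; [exact: cg|exact: cphi|exact: cg'|exact: cPhi].
  - move=> t; rewrite normrM -[leRHS]mulr1 ler_pM//.
    by rewrite ger0_norm ?t_cdf_le1 ?t_cdf_ge0.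
  - exact: (integrableD measurableT iphi iPhi).
have E2 := integral_derivative_tail z dg cg' gC ig'.
rewrite /kernel1.
have -> : \int[mu]_t (g' t * (Phi t - (z <= t)%R%:R)) = \int[mu]_t (g' t * Phi t) - \int[mu]_t ((z <= t)%R%:R * g' t).
  by rewrite -RintegralB//; apply: eq_Rintegral => t _; rewrite mulrBr (mulrC _%:R).
by rewrite E2 opprK addrA -RintegralD// E1 add0r.
Qed.

End one_dimension.

(** * Joint measurability from separate continuity *)

Section caratheodory.
Context d (T : measurableType d) {R : realType}.
Local Notation mR := (measurableTypeR R).

Lemma measurable_floor_family (F : T -> int -> R) (c : R) : (forall k, measurable_fun setT (F^~ k)) ->
  measurable_fun setT (fun z : T * mR => F z.1 (Num.floor (c * z.2))).
Proof.
move=> mF _ A mA; rewrite setTI.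
have -> : (fun z : T * mR => F z.1 (Num.floor (c * z.2))) @^-1` A =
    \bigcup_(k in [set: int]) ((F^~ k @^-1` A) `*` [set y : mR | c * y \in `[k%:~R, (k + 1)%:~R[]).
  apply/seteqP; split => -[x y] /=.
    by move=> AF; exists (Num.floor (c * y)) => //; split => //=; rewrite in_itv/= floor_itv.
  by move=> [k _ [/= AF]]; rewrite in_itv/= => /floor_def ->.
apply: countable_bigcupT_measurable; first exact: countableP.
move=> k; apply: measurableX; first by rewrite -[X in measurable X]setTI; exact: mF.
have mc : measurable_fun setT ( *%R c : mR -> mR) by exact: mulrl_measurable.
by rewrite -[X in measurable X]setTI; apply: (mc measurableT _ (measurable_itv `[k%:~R, (k + 1)%:~R[)).
Qed.

Lemma cvg_floor_div (y : R) : (fun m => (Num.floor (m.+1%:R * y))%:~R / m.+1%:R) @ \oo --> y.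
Proof.
have c1 : (fun m => y - @harmonic R m) @ \oo --> y.
  by rewrite -[X in _ --> X](subr0 y); apply: cvgB; [exact: cvg_cst|exact: cvg_harmonic].
apply: (squeeze_cvgr _ c1 (cvg_cst y)); apply: nearW => m /=.
have m0 : 0 < m.+1%:R :> R by rewrite ltr0n.
have /andP[f1 f2] := floor_itv (m.+1%:R * y).
rewrite ler_pdivrMr// (mulrC y) f1 andbT ler_pdivlMr// mulrBl mulVf ?gt_eqF// (mulrC y).
by rewrite lerBlDr (le_trans (ltW f2))// intrD.
Qed.

(** [y] is replaced by the grid value [floor (m y) / m], which takes countably many values;
    continuity in [y] passes to the limit. *)
Lemma measurable_caratheodory (f : T -> R -> R) : (forall y, measurable_fun setT (f^~ y)) ->
  (forall x, continuous (f x)) -> measurable_fun setT (fun z : T * mR => f z.1 z.2).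
Proof.
move=> mf cf.
apply: (@measurable_fun_cvg _ _ _ _ (fun m (z : T * mR) => f z.1 ((Num.floor (m.+1%:R * z.2))%:~R / m.+1%:R))).
  by move=> m; apply: (@measurable_floor_family (fun x k => f x (k%:~R / m.+1%:R)) m.+1%:R).
move=> z _; have h1 := @cvg_floor_div (z.2 : R); have h2 := cf z.1 (z.2 : R).
exact: (cvg_comp _ _ h1 h2).
Qed.

End caratheodory.

Section separately_continuous.
Context {R : realType}.
Local Notation mR := (measurableTypeR R).

Fixpoint separately_continuous n (f : seq R -> R) : Prop :=
  if n is m.+1 then
    (forall l, size l = m -> continuous (fun x => f (x :: l))) /\
    forall x, separately_continuous m (fun l => f (x :: l))
  else True.

Lemma measurable_separately_continuous n f : separately_continuous n f ->
  measurable_fun setT (fun t : n.-tuple mR => f t).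
Proof.
elim: n f => [f _|n IH f [cf sf]].
  rewrite (_ : (fun _ => _) = fun=> f [::]); first exact: measurable_cst.
  by apply/funext => t; rewrite [t]tuple0.
rewrite (_ : (fun _ => _) = (fun z : n.-tuple mR * mR => f (z.2 :: z.1)) \o @tuncons R n); last first.
  by apply/funext => t; rewrite {1}[t]tuple_eta.
apply: measurableT_comp; last exact: measurable_tuncons.
apply: (@measurable_caratheodory _ (n.-tuple mR) R (fun l x => f (x :: l))).
  by move=> y; exact: IH (sf y).
by move=> x; apply: cf; rewrite size_tuple.
Qed.

End separately_continuous.

Section Rintegral_sum.
Context d (T : measurableType d) {R : realType} (m : {measure set T -> \bar R}).

Lemma Rintegral_sum (I : eqType) (s : seq I) (f : I -> T -> R) :
  (forall i, i \in s -> m.-integrable setT (EFin \o f i)) ->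
  m.-integrable setT (EFin \o (fun x => \sum_(i <- s) f i x)) /\
  \int[m]_x (\sum_(i <- s) f i x) = \sum_(i <- s) \int[m]_x f i x.
Proof.
elim: s => [|i s IH] is_.
  split; first by rewrite (_ : _ \o _ = cst 0%E); [exact: integrable0|apply/funext => x /=; rewrite big_nil].
  by rewrite big_nil /Rintegral integral0_eq// => x _; rewrite big_nil.
have [I1 I2] := IH (fun j js => is_ j (mem_behead (s := i :: s) js)).
have ii := is_ i (mem_head _ _).
split.
  rewrite (_ : _ \o _ = ((EFin \o f i) \+ (EFin \o (fun x => (\sum_(i <- s) f i x)%R)))%E); last first.
    by apply/funext => x /=; rewrite big_cons.
  exact: integrableD.
under eq_Rintegral do rewrite big_cons.
by rewrite RintegralD// I2 big_cons.
Qed.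

End Rintegral_sum.

Section representation.
Context {R : realType} (nu : R) (nu_gt1 : 1 < nu).
Local Notation mu := (@lebesgue_measure R).
Local Notation mR := (measurableTypeR R).
Local Notation leb n := (@lebesgue_tuple R n).
Local Notation kernel1 := (kernel1 nu).
Implicit Types F : seq bool -> seq R -> R.

(* [F b] stands for the mixed derivative of [F [:: false; ...; false]] in the
   coordinates marked [true] in [b]; the first coordinate is differentiated
   last, so only derivatives in the leading coordinate are ever compared. *)
Fixpoint mixed_derivatives n F : Prop :=
  if n is m.+1 then
    (forall b l, size b = m -> size l = m ->
      (forall x : R, is_derive x 1 (fun x => F (false :: b) (x :: l)) (F (true :: b) (x :: l))) /\
      continuous (fun x => F (true :: b) (x :: l))) /\
    forall c x, mixed_derivatives m (fun b l => F (c :: b) (x :: l))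
  else True.

Definition weight_bounded n F (C : R) := forall b l, size b = n -> size l = n ->
  `|F b l| <= C * \prod_(x <- l) weight (- 2) x.

Fixpoint allbits n : seq (seq bool) :=
  if n is m.+1 then map (cons false) (allbits m) ++ map (cons true) (allbits m)
  else [:: [::]].

Lemma size_allbits n b : b \in allbits n -> size b = n.
Proof.
elim: n b => [|n IH] b /=; first by rewrite inE => /eqP ->.
by rewrite mem_cat => /orP[] /mapP[b' /IH <- ->].
Qed.

Lemma mixed_derivatives_continuous n F b : size b = n -> mixed_derivatives n F ->
  separately_continuous n (F b).
Proof.
elim: n F b => [|n IH] F [|c b]//= [sb] [h1 h2]; split; last by move=> x; exact: IH (h2 c x).
move=> l sl; have [d1 d2] := h1 b l sb sl; case: c => //.
by move=> x; apply: differentiable_continuous; apply/derivable1_diffP; have [] := d1 x.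
Qed.

Definition kernel b z n (t : n.-tuple R) : R := \prod_(i < n) kernel1 (nth false b i) (nth 0 z i) (tnth t i).

Lemma kernel_tcons b c x z n (t : n.-tuple mR * mR) :
  kernel (c :: b) (x :: z) (tcons t) = kernel b z t.1 * kernel1 c x t.2.
Proof.
by rewrite /kernel (prod_tcons (fun i => kernel1 (nth false (c :: b) i) (nth 0 (x :: z) i))).
Qed.

Lemma measurable_kernel b z n : measurable_fun setT (@kernel b z n).
Proof. by apply: (@measurable_prod_tnth _ n (fun i => kernel1 _ _)) => i; exact: measurable_kernel1. Qed.

Lemma kernel_bounded n : exists2 K : R, 0 < K & forall b z (t : n.-tuple R), `|kernel b z t| <= K.
Proof.
have [K K0 hK] := kernel1_bounded nu_gt1; exists (K ^+ n); first exact: exprn_gt0.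
move=> b z t; rewrite normr_prod -[n in K ^+ n]card_ord -prodr_const.
by apply: ler_prod => i _; rewrite normr_ge0 hK.
Qed.

Lemma integrable_weight_prod n :
  (leb n).-integrable setT (fun t => (\prod_(i < n) weight (- 2) (tnth t i))%:E).
Proof.
apply: (proj1 (@integral_prod_tuple R n (fun=> weight (- 2)) _)) => i.
by apply: integrable_weightN; rewrite ltr1n.
Qed.

Lemma weight_boundedP n F C b (t : n.-tuple R) : weight_bounded n F C -> size b = n ->
  `|F b t| <= C * \prod_(i < n) weight (- 2) (tnth t i).
Proof. by move=> bF sb; rewrite -(big_tuple _ _ t xpredT (weight (- 2))) bF ?size_tuple. Qed.

Lemma integrable_representation n F C b z : mixed_derivatives n F -> weight_bounded n F C -> size b = n ->
  (leb n).-integrable setT (fun t => (F b t * kernel b z t)%:E).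
Proof.
move=> dF bF sb; have [K K0 hK] := kernel_bounded n.
apply: (@integrable_dominated _ _ _ (leb n) (fun t => F b t * kernel b z t)
    (fun t => K * (C * \prod_(i < n) weight (- 2) (tnth t i)))).
- apply: measurable_realfun.measurable_funM; last exact: measurable_kernel.
  by apply: measurable_separately_continuous; exact: mixed_derivatives_continuous.
- by move=> t; rewrite normrM mulrC ler_pM// weight_boundedP.
- rewrite (_ : _ \o _ = fun t => ((K * C)%:E * (\prod_(i < n) weight (- 2) (tnth t i))%:E)%E).
    by apply: integrableZl => //; exact: integrable_weight_prod.
  by apply/funext => t /=; rewrite -EFinM mulrA.
Qed.

(** Fubini for one bit word. [lebesgue_tuple] pairs the tail with the head, so the inner integral is
    over the tail with the head [y] fixed. Integrability of [H] is recorded for the later exchange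
    with the finite sum over words. *)
Lemma representation_step n F C b c z x : mixed_derivatives n.+1 F -> weight_bounded n.+1 F C -> size b = n ->
  let H y := (\int[leb n]_t (F (c :: b) (y :: t) * kernel b z t)) * kernel1 c x y in
  mu.-integrable setT (EFin \o H) /\
  \int[mu]_y H y = \int[leb n.+1]_t (F (c :: b) t * kernel (c :: b) (x :: z) t).
Proof.
move=> dF bF sb H.
have C0 : 0 <= C.
  have := le_trans (normr_ge0 _) (bF (nseq n.+1 false) (nseq n.+1 0) (size_nseq _ _) (size_nseq _ _)).
  by rewrite pmulr_lge0// prodr_gt0// => y _; exact: weight_gt0.
pose Q (t : n.+1.-tuple R) := F (c :: b) t * kernel (c :: b) (x :: z) t.
have [K K0 hK] := kernel_bounded n.+1.
have mQ : measurable_fun setT (Q : n.+1.-tuple mR -> R).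
  apply: measurable_realfun.measurable_funM; last exact: measurable_kernel.
  apply: measurable_separately_continuous.
  by apply: mixed_derivatives_continuous => //=; rewrite sb.
have iQ : (leb_tuple n \x mu)%E.-integrable setT ((EFin \o Q) \o @tcons R n).
  apply: (@integrable_dominated _ _ _ (leb_tuple n \x mu)%E (Q \o @tcons R n)
     (fun p => (K * C) * ((\prod_(i < n) weight (- 2) (tnth p.1 i)) * weight (- 2) p.2))).
  - exact: (measurableT_comp mQ (@measurable_tcons R n)).
  - move=> p /=; rewrite /Q normrM mulrC -mulrA ler_pM//.
    have := @weight_boundedP n.+1 F C (c :: b) (tcons p) bF _.
    by rewrite (prod_tcons (fun i => weight (- 2)) p) => -> //=; rewrite sb.
  - rewrite (_ : _ \o _ = fun p => ((K * C)%:E * ((\prod_(i < n) weight (- 2) (tnth p.1 i)) * weight (- 2) p.2)%:E)%E)//.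
    apply: integrableZl => //.
    apply: (@integrable_mul _ _ _ _ _ (leb_tuple n) mu (fun t => \prod_(i < n) weight (- 2) (tnth t i)) (weight (- 2))).
      exact: integrable_weight_prod.
    by apply: integrable_weightN; rewrite ltr1n.
have HE y : (H y)%:E = fubini_G (leb_tuple n) ((EFin \o Q) \o @tcons R n) y.
  rewrite /fubini_G /H EFinM /Rintegral.
  have iy := @integrable_representation n (fun b l => F (c :: b) (y :: l)) (C * weight (- 2) y) b z.
  rewrite fineK; last first.
    apply: integrable_fin_num => //; apply: iy => //; first exact: dF.2.
    by move=> b' l sb' sl; rewrite -mulrA -(big_cons _ _ y l xpredT) bF//= ?sb' ?sl.
  rewrite muleC -integralZl//; last first.
    apply: iy => //; first exact: dF.2.
    by move=> b' l sb' sl; rewrite -mulrA -(big_cons _ _ y l xpredT) bF//= ?sb' ?sl.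
  apply: eq_integral => t _; rewrite /= /Q kernel_tcons -EFinM; congr EFin.
  by rewrite mulrC mulrA.
split.
  rewrite (_ : _ \o _ = fubini_G (leb_tuple n) ((EFin \o Q) \o @tcons R n)); last exact/funext.
  have mQt : measurable_fun setT ((EFin \o Q) \o @tcons R n) by exact: measurable_int iQ.
  apply/integrableP; split; first exact: (measurable_fubini_G iQ).
  apply: le_lt_trans ((integrable21ltyP (leb_tuple n) mu mQt).1 iQ).
  apply: ge0_le_integral => //.
  - by apply: measurableT_comp => //; exact: (measurable_fubini_G iQ).
  - have mQa : measurable_fun setT (fun z => `|((EFin \o Q) \o @tcons R n) z|%E) by exact: measurableT_comp.
    exact: (@measurable_fun_fubini_tonelli_G _ _ _ _ _ (leb_tuple n) _ mQa (fun=> abse_ge0 _)).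
  - move=> y _; apply: le_abse_integral => //.
    exact: (measurable_fun_pair1 _ mQt).
rewrite /Rintegral; congr fine; under eq_integral do rewrite HE.
rewrite integral21_prod_meas1// integral_tuple//.
exact/measurable_EFinP.
Qed.

(** [representation1] in the head and the induction hypothesis in the tail, with
    [C * weight (- 2) y] as the constant of the slice at [y]. The bit of the head yields the two
    halves of [allbits n.+1]. *)
Theorem representation n F C z : mixed_derivatives n F -> weight_bounded n F C -> size z = n ->
  F (nseq n false) z = \sum_(b <- allbits n) \int[leb n]_t (F b t * kernel b z t).
Proof.
elim: n F C z => [|n IH] F C z dF bF.
  move=> /size0nil ->; rewrite big_seq1 /Rintegral integral_dirac//.
    by rewrite diracT mul1e/= /kernel big_ord0 mulr1.
  apply/measurable_EFinP; apply: measurable_realfun.measurable_funM; last exact: measurable_kernel.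
  exact: (@measurable_separately_continuous R 0).
case: z => [//|x z] [sz].
have bF' c y : weight_bounded n (fun b l => F (c :: b) (y :: l)) (C * weight (- 2) y).
  by move=> b' l sb' sl; rewrite -mulrA -(big_cons _ _ y l xpredT) bF//= ?sb' ?sl.
have IH' c y : F (c :: nseq n false) (y :: z) =
    \sum_(b <- allbits n) \int[leb n]_t (F (c :: b) (y :: t) * kernel b z t).
  exact: (IH _ _ _ (dF.2 c y) (bF' c y) sz).
have [d1 d2] := dF.1 (nseq n false) z (size_nseq _ _) sz.
rewrite /= (@representation1 _ _ nu_gt1 (fun y => F (false :: nseq n false) (y :: z))
  (fun y => F (true :: nseq n false) (y :: z)) (C * \prod_(y <- z) weight (- 2) y) x)//.
- rewrite big_cat !big_map/=.
  have step c : \int[mu]_y (F (c :: nseq n false) (y :: z) * kernel1 c x y) =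
      \sum_(b <- allbits n) \int[leb n.+1]_t (F (c :: b) t * kernel (c :: b) (x :: z) t).
    under eq_Rintegral do rewrite IH' mulr_suml.
    rewrite (proj2 (@Rintegral_sum _ _ _ mu _ (allbits n) (fun b y => (\int[leb n]_t (F (c :: b) (y :: t) * kernel b z t)) * kernel1 c x y) _)).
      by apply: eq_big_seq => b /size_allbits sb; exact: (proj2 (representation_step c z x dF bF sb)).
    by move=> b /size_allbits sb; exact: (proj1 (representation_step c z x dF bF sb)).
  by rewrite !step.
- by move=> t; rewrite mulrAC -mulrA -(big_cons _ _ t z xpredT) bF//= ?size_nseq ?sz.
- by move=> t; rewrite mulrAC -mulrA -(big_cons _ _ t z xpredT) bF//= ?size_nseq ?sz.
Qed.

End representation.

(** * The mean squared error over the shift *)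

Local Notation frac := Defs.frac.

Section fractional_part.
Context {R : realType}.
Implicit Types x y : R.

Lemma frac_itv x : 0 <= frac x < 1.
Proof. by rewrite /frac subr_ge0 floor_le ltrBlDl -intrD1 floorD1_gt. Qed.

Lemma fracD1 x (k : int) : frac (x + k%:~R) = frac x.
Proof. by rewrite /frac floorDrz ?intr_int// intrKfloor intrD; ring. Qed.

Lemma frac_id x : 0 <= x < 1 -> frac x = x.
Proof. by move=> x01; rewrite /frac (@floor_def _ x 0) ?subr0// add0r. Qed.

Lemma fracE x : x = frac x + (Num.floor x)%:~R.
Proof. by rewrite /frac subrK. Qed.

Lemma frac_opp x : frac (- x) = if frac x == 0 then 0 else 1 - frac x.
Proof.
rewrite {1}(fracE x) opprD -intrN fracD1; have /andP[x0 x1] := frac_itv x.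
case: eqP => [->|/eqP xn0]; first by rewrite oppr0 frac_id// lexx ltr01.
rewrite -(@fracD1 _ 1) frac_id; first by rewrite addrC.
have : 0 < frac x by rewrite lt_neqAle eq_sym xn0.
by rewrite /=; lra.
Qed.

Lemma frac_natdiv (N m : nat) : (0 < N)%N -> frac (m%:R / N%:R : R) = (m %% N)%:R / N%:R.
Proof.
move=> N0; have NR : 0 < N%:R :> R by rewrite ltr0n.
rewrite {1}(divn_eq m N) natrD natrM mulrDl mulfK ?gt_eqF// addrC.
rewrite -[(m %/ N)%:R]/((m %/ N)%:Z%:~R) fracD1 frac_id//.
by rewrite divr_ge0//= ltr_pdivrMr// mul1r ltr_nat ltn_mod.
Qed.

Lemma measurable_frac : measurable_fun setT (frac : measurableTypeR R -> measurableTypeR R).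
Proof.
have h := @measurable_floor_family _ (measurableTypeR R) R (fun x k => x - k%:~R) 1 _.
rewrite (_ : frac = (fun z : measurableTypeR R * measurableTypeR R => z.1 - (Num.floor (1 * z.2))%:~R) \o (fun x => (x, x))).
  apply: measurableT_comp; last exact: measurable_fun_pair.
  apply: h => k; apply: measurable_realfun.measurable_funB => //.
by apply/funext => x; rewrite /= mul1r.
Qed.

Lemma tent_frac_opp x c : tent x (frac (- c)) = tent x (frac c).
Proof.
rewrite frac_opp; case: eqP => [->//|_]; exact: tent_rev.
Qed.

End fractional_part.

Section periodic.
Context {R : realType}.
Local Notation mu := (@lebesgue_measure R).
Local Notation mR := (measurableTypeR R).
Local Open Scope ereal_scope.

Lemma integral_mul_bool (D : set R) (f : R -> \bar R) (p : pred R) : (forall x, D x <-> p x) ->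
  \int[mu]_(x in D) f x = \int[mu]_x ((p x)%:R%:E * f x).
Proof.
move=> Dp; rewrite integral_mkcond; apply: eq_integral => x _; rewrite patchE.
case: ifPn => [|]; first by rewrite inE => /Dp ->; rewrite mul1e.
by rewrite notin_setE => /Dp/negP/negbTE ->; rewrite mul0e.
Qed.

Lemma ge0_integral_shift (a : R) (f : R -> \bar R) : measurable_fun setT f -> (forall x, 0 <= f x) ->
  \int[mu]_x f (x + a)%R = \int[mu]_x f x.
Proof.
move=> mf f0; rewrite [RHS](@ge0_integral_affine R 1 a)// mul1e.
by apply: eq_integral => x _; rewrite mul1r.
Qed.

Let ind (a b x : R) : \bar R := ((a <= x < b)%R%:R)%:E.

Let measurable_ind a b : measurable_fun setT (ind a b : mR -> \bar R).
Proof.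
apply/measurable_EFinP.
rewrite (_ : (fun _ => _) = \1_(`[a, b[%classic : set mR)); first exact: measurable_indic.
by apply/funext => x; rewrite indicE mem_setE in_itv.
Qed.

Let mind a b (f : R -> \bar R) : measurable_fun setT (f : mR -> \bar R) ->
  measurable_fun setT (fun x : mR => ind a b x * f x).
Proof. by move=> mf; apply: emeasurable_funM => //; exact: measurable_ind. Qed.

(** After reduction to [0 <= a < 1] the translated period from [a] to [1 + a] is cut at [1] and its
    upper part moved back by [1]. Half-open periods tile exactly, so the open interval is first
    closed at [0]. *)
Lemma integral_periodic (p : R -> R) (a : R) : measurable_fun setT (p : mR -> R) -> (forall x, (0 <= p x)%R) ->
  (forall x (k : int), p (x + k%:~R)%R = p x) ->
  \int[mu]_(x in `]0%R, 1%R[) (p (x + a)%R)%:E = \int[mu]_(x in `]0%R, 1%R[) (p x)%:E.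
Proof.
move=> mp p0 pp.
have mp' b : measurable_fun setT (fun x : mR => p (x + b)%R : R).
  apply: measurableT_comp => //; exact: measurable_realfun.measurable_funD.
have open_closed b : \int[mu]_(x in `]0%R, 1%R[) (p (x + b)%R)%:E = \int[mu]_x (ind 0 1 x * (p (x + b)%R)%:E).
  rewrite integral_itv_obnd_cbnd; last first.
    by apply: measurable_funTS; apply/measurable_EFinP; exact: mp'.
  by apply: integral_mul_bool => x; rewrite /= in_itv.
wlog a01 : a / (0 <= a < 1)%R => [hw|].
  rewrite -(hw (frac a) (frac_itv a)); apply: eq_integral => x _; congr EFin.
  by rewrite {1}(fracE a) addrA pp.
have [a0 a1] := andP a01.
rewrite open_closed; under [RHS]eq_integral do rewrite -[X in p X]addr0.
rewrite open_closed.
under [RHS]eq_integral do rewrite addr0.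
have mpE : measurable_fun setT (fun x : mR => (p x)%:E) by apply/measurable_EFinP.
have sh : \int[mu]_x (ind 0 1 x * (p (x + a)%R)%:E) = \int[mu]_x (ind a (1 + a)%R x * (p x)%:E).
  rewrite -(@ge0_integral_shift a (fun x => ind a (1 + a)%R x * (p x)%:E)).
  - by apply: eq_integral => x _; rewrite /ind lerDr ltrD2r.
  - exact: mind.
  - by move=> x; rewrite mule_ge0// lee_fin.
rewrite sh.
have -> : \int[mu]_x (ind a (1 + a)%R x * (p x)%:E) =
    \int[mu]_x (ind a 1 x * (p x)%:E) + \int[mu]_x (ind 1 (1 + a)%R x * (p x)%:E).
  rewrite -ge0_integralD//.
  - apply: eq_integral => x _; rewrite -muleDl// -EFinD; congr (_%:E * _).
    case: (ltP x 1%R) => x1 /=.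
      by rewrite andbT addr0 (lt_le_trans x1) ?lerDl// andbT.
    by rewrite andbF add0r (le_trans (ltW a1) x1).
  - by move=> x _; rewrite mule_ge0// lee_fin.
  - exact: mind.
  - by move=> x _; rewrite mule_ge0// lee_fin.
  - exact: mind.
rewrite -(@ge0_integral_shift 1 (fun x => ind 1 (1 + a)%R x * (p x)%:E)); last 2 first.
  - exact: mind.
  - by move=> x; rewrite mule_ge0// lee_fin.
rewrite -ge0_integralD//.
- apply: eq_integral => x _; rewrite -[X in p (x + X)%R]/(1%:~R)%R pp -muleDl// -EFinD; congr (_%:E * _).
  rewrite lerDr (addrC x 1)%R ltrD2l; case: (ltP x a) => xa /=.
    by rewrite add0r andbT (lt_trans xa a1) andbT.
  by rewrite andbF addr0 (le_trans a0 xa).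
- by move=> x _; rewrite mule_ge0// lee_fin.
- exact: mind.
- by move=> x _; rewrite mule_ge0// lee_fin.
- apply: emeasurable_funM; first by apply: (measurableT_comp (measurable_ind _ _)); exact: measurable_realfun.measurable_funD.
  by apply/measurable_EFinP; exact: mp'.
Qed.

End periodic.

Section covariance.
Context {R : realType} (nu : R) (nu_gt1 : 1 < nu).
Local Notation mu := (@lebesgue_measure R).
Local Notation mR := (measurableTypeR R).
Local Notation Phi := (t_cdf nu).
Local Notation q := (t_quantile nu).
Local Notation D := (`]0, 1[%classic : set mR).

(** Agrees with the indicator of [frac y <= Phi t] away from the integers, where the quantile is
    read at [0] and takes a default value. *)
Definition below (t y : R) : R := (q (frac y) <= t)%R%:R.

Lemma measurable_below t : measurable_fun setT (below t : mR -> R).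
Proof.
rewrite (_ : below t = (\1_(`]-oo, t] : set mR) \o (q \o frac))); last first.
  by apply/funext => y; rewrite /= /below indicE mem_setE in_itv.
apply: measurableT_comp; first exact: measurable_indic.
by apply: measurableT_comp; [exact: measurable_t_quantile|exact: measurable_frac].
Qed.

Lemma below01 t y : 0 <= below t y <= 1.
Proof. by rewrite /below; case: (q (frac y) <= t); rewrite ?lexx ?ler01. Qed.

Lemma belowE t y : 0 < y < 1 -> below t y = (y <= Phi t)%R%:R.
Proof.
move=> y01; have [y0 y1] := andP y01.
by rewrite /below frac_id ?(ltW y0)// (t_quantile_le nu_gt1).
Qed.

Lemma below_periodic t y (k : int) : below t (y + k%:~R) = below t y.
Proof. by rewrite /below fracD1. Qed.

Lemma integral_itv_cc (a b : R) : 0 <= a -> b <= 1 ->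
  (\int[mu]_(x in D) ((a <= x <= b)%R%:R)%:E = (Num.max (b - a) 0)%:E)%E.
Proof.
move=> a0 b1; transitivity (\int[mu]_(x in D) (\1_(`[a, b]%classic : set mR) x)%:E)%E.
  by apply: eq_integral => x _; rewrite indicE mem_setE in_itv.
rewrite integral_indic// setIC.
have len (i : interval R) : i = `]a, b[%R \/ i = `[a, b]%R -> mu [set` i] = (Num.max (b - a) 0)%:E.
  move=> ii; have -> : mu [set` i] = (if (a < b)%R then (b - a)%:E else 0)%E.
    by case: ii => ->; rewrite lebesgue_measure_itv/= lte_fin EFinB.
  by rewrite -subr_gt0; case: ltP.
apply/eqP; rewrite eq_le; apply/andP; split.
  rewrite -(len `[a, b]%R); last by right.
  by apply: le_measure; rewrite ?inE//; exact: measurableI.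
rewrite -(len `]a, b[%R); last by left.
apply: le_measure; rewrite ?inE//; first exact: measurableI.
move=> x /=; rewrite !in_itv/= => /andP[ax xb].
by rewrite (ltW ax) (ltW xb) (le_lt_trans a0 ax) (lt_le_trans xb b1).
Qed.

Lemma integral_below t a : (\int[mu]_(x in D) (below t (x + a))%:E = (Phi t)%:E)%E.
Proof.
have x0 := t_cdf_ge0 nu_gt1 t; have x1 := t_cdf_le1 nu_gt1 t.
rewrite integral_periodic; first last.
- exact: below_periodic.
- by move=> x; have /andP[] := below01 t x.
- exact: measurable_below.
transitivity (\int[mu]_(x in D) ((0 <= x <= Phi t)%R%:R)%:E)%E.
  apply: eq_integral => y; rewrite inE/= in_itv/= => y01; rewrite belowE//.
  by have [y0 _] := andP y01; rewrite (ltW y0).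
by rewrite integral_itv_cc// subr0 max_l.
Qed.

(** For [x < 1 - c] the shifted point is [x + c], for [x > 1 - c] it is [x + c - 1]: the two
    conditions become the intervals [[0, Phi t - c]] and [[1 - c, Phi t]]. The point [1 - c] is
    discarded as a null set. *)
Lemma integral_below2 t c : 0 <= c < 1 ->
  (\int[mu]_(x in D) (below t x * below t (x + c))%:E = (Num.max (Phi t - c) 0 + Num.max (Phi t - 1 + c) 0)%:E)%E.
Proof.
move=> c01; have [c0 c1] := andP c01; have x0 := t_cdf_ge0 nu_gt1 t.
have x1 := t_cdf_le1 nu_gt1 t.
pose g y : R := (0 <= y <= Phi t - c)%R%:R + (1 - c <= y <= Phi t)%R%:R.
have mg1 a b : measurable_fun setT (fun y : mR => (a <= y <= b)%R%:R : R).
  rewrite (_ : (fun _ => _) = \1_(`[a, b]%classic : set mR)); first exact: measurable_indic.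
  by apply/funext => x; rewrite indicE mem_setE in_itv.
have mg : measurable_fun setT (g : mR -> R) by apply: measurable_realfun.measurable_funD; exact: mg1.
have mb : measurable_fun setT (fun y : mR => below t y * below t (y + c) : R).
  apply: measurable_realfun.measurable_funM; first exact: measurable_below.
  apply: measurableT_comp; first exact: measurable_below.
  exact: measurable_realfun.measurable_funD.
transitivity (\int[mu]_(y in D) (g y)%:E)%E.
  apply: ae_eq_integral => //.
  - by apply: measurable_funTS; exact/measurable_EFinP.
  - by apply: measurable_funTS; exact/measurable_EFinP.
  exists [set 1 - c]; split => //; first exact: lebesgue_measure_set1.
  move=> y /=; apply: contra_notP => yc; rewrite /= in_itv/= => y01; have [y0 y1] := andP y01.
  congr EFin; rewrite belowE//.
  have [yc1|yc1] := ltP (y + c) 1.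
    rewrite belowE; last by rewrite yc1 andbT ltr_wpDr.
    rewrite /g lerBlDr (leNgt 1) yc1/= addr0 (ltW y0)/= lerBrDr.
    case: (leP (y + c) (Phi t)) => yx; rewrite ?mulr0// mulr1.
    by rewrite (le_trans _ yx)// lerDl.
  have {}yc1 : 1 < y + c.
    by rewrite lt_neqAle yc1 andbT; apply/eqP => yc'; apply: yc; rewrite yc' addrK.
  rewrite -(below_periodic t (y + c) (-1)) belowE; last first.
    by rewrite /= ; apply/andP; split; rewrite mulrN1z; move: c0 c1 y0 y1 yc1 => ? ? ? ? ?; lra.
  rewrite mulrN1z /g [1 - c <= y]lerBlDr (ltW yc1)/= lerBrDr [X in _ && X]leNgt (le_lt_trans x1 yc1) andbF add0r.
  case: (leP y (Phi t)) => yx; rewrite ?mul0r// mul1r.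
  by rewrite (le_trans _ yx)// -addrA gerDl subr_le0 (ltW c1).
under eq_integral do rewrite /g EFinD.
rewrite ge0_integralD//; first last.
- by apply: measurable_funTS; exact/measurable_EFinP.
- by apply: measurable_funTS; exact/measurable_EFinP.
rewrite !integral_itv_cc//; [|lra|lra].
by rewrite subr0 -EFinD; congr (_ + Num.max _ _)%:E; ring.
Qed.

(** Both indicators have mean [Phi t], so this is their covariance, and by periodicity it depends on
    [a - a'] mod [1] only. *)
Lemma shift_covariance t a a' :
  \int[mu]_x ((0 < x < 1)%R%:R * (kernel1 nu true (q (frac (a + x))) t * kernel1 nu true (q (frac (a' + x))) t))
  = tent (Phi t) (frac (a - a')).
Proof.
transitivity (\int[mu]_(x in D) ((Phi t - below t (x + a)) * (Phi t - below t (x + a')))).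
  rewrite [RHS]Rintegral_mkcond; apply: eq_Rintegral => x _.
  rewrite patchE mem_setE in_itv/= /kernel1 /below (addrC a) (addrC a').
  by case: ifP; rewrite ?mul1r ?mul0r.
have mD : measurable D by exact: measurable_itv.
have mb b : measurable_fun setT (fun x : mR => below t (x + b) : R).
  apply: measurableT_comp; first exact: measurable_below.
  exact: measurable_realfun.measurable_funD.
have muD1 : mu D = 1%E by rewrite lebesgue_measure_itv/= lte01 sube0.
have muD : (mu D < +oo)%E by rewrite muD1 ltry.
have bi (f : R -> R) (M : R) : measurable_fun setT (f : mR -> R) -> (forall x, `|f x| <= M) -> mu.-integrable D (EFin \o f).
  move=> mf f1; apply: measurable_bounded_integrable => //.
  - exact: measurable_funTS.
  - by exists M; split; rewrite ?num_real// => x x1 y _; apply: (le_trans (f1 y)); exact: ltW.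
have n1 b x : `|below t (x + b)| <= 1.
  by have /andP[b0 b1] := below01 t (x + b); rewrite ger0_norm.
have i1 b : mu.-integrable D (EFin \o (fun x => below t (x + b))) by apply: (bi _ 1).
have i2 : mu.-integrable D (EFin \o (fun x => below t (x + a) * below t (x + a'))).
  apply: (bi _ 1); first exact: measurable_realfun.measurable_funM.
  by move=> x; rewrite normrM mulr_ile1.
have ic (c : R) : mu.-integrable D (EFin \o cst c).
  by apply: (bi _ `|c|).
have E1 b : \int[mu]_(x in D) below t (x + b) = Phi t by rewrite /Rintegral integral_below.
have E2 : \int[mu]_(x in D) (below t (x + a) * below t (x + a')) =
    Num.max (Phi t - frac (a' - a)) 0 + Num.max (Phi t - 1 + frac (a' - a)) 0.
  rewrite /Rintegral.
  transitivity (fine (\int[mu]_(x in D) (below t (x + a) * below t ((x + a) + frac (a' - a)))%:E)%E).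
    congr fine; apply: eq_integral => x _; congr (_ * _)%:E.
    rewrite -[RHS](below_periodic t _ (Num.floor (a' - a))) -addrA -fracE.
    by congr below; ring.
  rewrite (@integral_periodic _ (fun y => below t y * below t (y + frac (a' - a)))).
  - by rewrite integral_below2// frac_itv.
  - apply: measurable_realfun.measurable_funM; [exact: measurable_below|exact: mb].
  - by move=> x; rewrite mulr_ge0//; have /andP[] := below01 t x; have /andP[] := below01 t (x + frac (a' - a)).
  - by move=> x k; rewrite below_periodic addrAC below_periodic.
transitivity (\int[mu]_(x in D) ((Phi t ^+ 2 - Phi t * (below t (x + a))) - (Phi t * below t (x + a') - below t (x + a) * below t (x + a')))).
  by apply: eq_Rintegral => x _; ring.
have iZ b : mu.-integrable D (EFin \o (fun x => Phi t * below t (x + b))).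
  rewrite (_ : _ \o _ = fun x => ((Phi t)%:E * (EFin \o (fun x => below t (x + b))) x)%E)//.
  exact: integrableZl.
have EZ b : \int[mu]_(x in D) (Phi t * below t (x + b)) = Phi t ^+ 2 by rewrite RintegralZl// E1 expr2.
have EB1 : \int[mu]_(x in D) (Phi t ^+ 2 - Phi t * below t (x + a)) = 0.
  rewrite RintegralB// ?EZ ?Rintegral_cst//; last exact: ic.
  by rewrite [X in _ * X - _](_ : _ = 1) ?mulr1 ?subrr//; exact: (congr1 fine muD1).
have EB2 : \int[mu]_(x in D) (Phi t * below t (x + a') - below t (x + a) * below t (x + a')) =
   Phi t ^+ 2 - (Num.max (Phi t - frac (a' - a)) 0 + Num.max (Phi t - 1 + frac (a' - a)) 0).
  by rewrite RintegralB// EZ E2.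
rewrite RintegralB//.
- rewrite EB1 EB2 -(opprB a' a) tent_frac_opp /tent; ring.
- exact: (integrableB mD (ic _) (iZ a)).
- exact: (integrableB mD (iZ a') i2).
Qed.

End covariance.

Section cauchy_schwarz.
Context d (T : measurableType d) {R : realType} (m : {measure set T -> \bar R}).

(** If the right-hand integral is infinite there is nothing to prove; otherwise
    [2 |f g| <= l f^2 / w + g^2 w / l] is integrated for every [l > 0]. *)
Lemma weighted_cauchy_schwarz (f g w : T -> R) (A : R) :
  measurable_fun setT f -> measurable_fun setT g -> measurable_fun setT w -> (forall x, 0 < w x) ->
  0 < A -> (\int[m]_x (f x ^+ 2 * (w x)^-1)%:E <= A%:E)%E ->
  m.-integrable setT (EFin \o (fun x => f x * g x)) ->
  (((\int[m]_x (f x * g x)) ^+ 2)%:E <= A%:E * \int[m]_x (g x ^+ 2 * w x)%:E)%E.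
Proof.
move=> mf mg mw w0 A0 fA ifg.
have mw' : measurable_fun setT (fun x => (w x)^-1).
  rewrite (_ : (fun _ => _) = fun x => (w x) `^ (-1)); last by apply/funext => x; rewrite powR_inv1// ltW.
  by apply: (measurableT_comp (measurable_powR _)).
have m1 : measurable_fun setT (fun x => f x ^+ 2 * (w x)^-1).
  by apply: measurable_realfun.measurable_funM => //; exact: measurable_realfun.measurable_funX.
have m2 : measurable_fun setT (fun x => g x ^+ 2 * w x).
  by apply: measurable_realfun.measurable_funM => //; exact: measurable_realfun.measurable_funX.
have g1 x : 0 <= f x ^+ 2 * (w x)^-1 by rewrite mulr_ge0 ?sqr_ge0// invr_ge0 ltW.
have g2 x : 0 <= g x ^+ 2 * w x by rewrite mulr_ge0 ?sqr_ge0// ltW.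
have [Boo|Bfin] := eqVneq (\int[m]_x (g x ^+ 2 * w x)%:E)%E +oo%E.
  by rewrite Boo gt0_muley ?lte_fin// leey.
have B0 : (0 <= \int[m]_x (g x ^+ 2 * w x)%:E)%E by exact: integral_EFin_ge0.
have [r rE] : exists r : R, (\int[m]_x (g x ^+ 2 * w x)%:E)%E = r%:E.
  exists (fine (\int[m]_x (g x ^+ 2 * w x)%:E)%E); rewrite fineK// ge0_fin_numE// lt_neqAle Bfin leey//.
rewrite rE -EFinM lee_fin; have r0 : 0 <= r by rewrite -lee_fin -rE.
set X := \int[m]_x _; pose Y := \int[m]_x `|f x * g x|.
have XY : `|X| <= Y by exact: le_normr_Rintegral.
have key (l : R) : 0 < l -> 2 * Y <= l * A + l^-1 * r.
  move=> l0; rewrite -lee_fin EFinD !EFinM -rE.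
  have -> : (Y%:E = \int[m]_x (`|f x * g x|)%:E)%E.
    by rewrite /Y /Rintegral fineK//; apply: integrable_fin_num => //; exact: (integrable_norm ifg).
  have mfg : measurable_fun setT (fun x => `|f x * g x|).
    by apply: measurableT_comp => //; exact: measurable_realfun.measurable_funM.
  rewrite -(@ge0_integralZl_EFinM _ _ _ m (fun x => `|f x * g x|) 2 mfg (fun=> normr_ge0 _))//.
  rewrite -(@ge0_integralZl_EFinM _ _ _ m (fun x => g x ^+ 2 * w x) l^-1 m2 g2) ?invr_ge0 ?(ltW l0)//.
  apply: (@le_trans _ _ (\int[m]_x (l * (f x ^+ 2 * (w x)^-1))%:E + \int[m]_x (l^-1 * (g x ^+ 2 * w x))%:E))%E; last first.
    apply: leeD => //.
    by rewrite (@ge0_integralZl_EFinM _ _ _ m (fun x => f x ^+ 2 * (w x)^-1) l m1 g1) ?(ltW l0)// lee_wpmul2l// lee_fin ltW.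
  rewrite -ge0_integralD//; last 4 first.
  - by move=> x _; rewrite lee_fin mulr_ge0// ltW.
  - by apply/measurable_EFinP; exact: measurable_realfun.measurable_funM.
  - by move=> x _; rewrite lee_fin mulr_ge0// invr_ge0 ltW.
  - by apply/measurable_EFinP; exact: measurable_realfun.measurable_funM.
  under [leRHS]eq_integral do rewrite -EFinD.
  apply: ge0_le_integral_EFin => //.
  - exact: measurable_realfun.measurable_funM.
  - by apply: measurable_realfun.measurable_funD; exact: measurable_realfun.measurable_funM.
  move=> x; have wx := w0 x; rewrite normrM -(real_normK (num_real (f x))) -(real_normK (num_real (g x))).
  rewrite -subr_ge0; have -> : l * (`|f x| ^+ 2 * (w x)^-1) + l^-1 * (`|g x| ^+ 2 * w x) - 2 * (`|f x| * `|g x|) =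
     (l * `|f x| - w x * `|g x|) ^+ 2 / (l * w x) by field; rewrite !gt_eqF.
  by rewrite divr_ge0 ?sqr_ge0// mulr_ge0// ltW.
have Y0 : 0 <= Y := le_trans (normr_ge0 _) XY.
have X2 : X ^+ 2 <= Y ^+ 2 by rewrite -real_normK ?num_real// lerXn2r ?nnegrE.
apply: (le_trans X2); move: Y0; rewrite le_eqVlt => /predU1P[<-|Y0].
  by rewrite expr0n/= mulr_ge0// ltW.
(* The choice [l = Y / A] turns [key] into [Y^2 <= A r] and avoids square roots. *)
have := key (Y / A) (divr_gt0 Y0 A0); rewrite invf_div divfK ?gt_eqF//.
by rewrite mulr2n mulrDl mul1r lerD2l mulrAC ler_pdivlMr.
Qed.

Lemma sqr_sum_le (I : Type) (s : seq I) (x : I -> R) :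
  (\sum_(i <- s) x i) ^+ 2 <= (size s)%:R * \sum_(i <- s) x i ^+ 2.
Proof.
rewrite expr2 mulr_suml; under eq_bigr do rewrite mulr_sumr.
apply: (@le_trans _ _ (\sum_(i <- s) \sum_(j <- s) (x i ^+ 2 / 2 + x j ^+ 2 / 2))).
  apply: ler_sum => i _; apply: ler_sum => j _; rewrite -subr_ge0.
  have -> : x i ^+ 2 / 2 + x j ^+ 2 / 2 - x i * x j = (x i - x j) ^+ 2 / 2 by field.
  by rewrite divr_ge0 ?sqr_ge0.
under eq_bigr do rewrite big_split/= big_const_seq count_predT iter_addr_0.
rewrite big_split/= big_const_seq count_predT iter_addr_0 sumrMnl -mulrnDl -!mulr_suml.
by rewrite -splitr mulr_natl.
Qed.

End cauchy_schwarz.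

Section mean_squared_error.
Context {R : realType} (nu : R) (nu_gt1 : 1 < nu) (alpha : R) (alpha_gt0 : 0 < alpha) (alpha_lt : 2 * alpha + 1 < nu).
Local Notation mu := (@lebesgue_measure R).
Local Notation mR := (measurableTypeR R).
Local Notation leb n := (@lebesgue_tuple R n).
Local Notation Phi := (t_cdf nu).
Local Notation phi := (t_density nu).
Local Notation q := (t_quantile nu).
Local Notation kernel := (kernel nu).
Local Notation kernel1 := (kernel1 nu).

Definition t_energy : R := \int[mu]_t (phi t ^+ 2).

Lemma integrable_t_density2 : mu.-integrable setT (EFin \o (fun t => phi t ^+ 2)).
Proof.
have [K K0 hK] := kernel1_bounded nu_gt1.
apply: (@integrable_dominated _ _ _ mu _ (fun t => K * phi t)).
- by apply: measurable_realfun.measurable_funX; exact: measurable_t_density.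
- move=> t; rewrite normrX expr2 [in leRHS]mulrC -(gtr0_norm (t_density_gt0 nu_gt1 t)) normr_id.
  by rewrite ler_wpM2l// (hK false 0 t).
- rewrite (_ : _ \o _ = fun t => (K%:E * (EFin \o phi) t)%E)//.
  by apply: integrableZl => //; exact: integrable_t_density.
Qed.

Lemma t_energy_gt0 : 0 < t_energy.
Proof.
have e0 : 0 <= t_energy by apply: Rintegral_ge0 => t _; exact: sqr_ge0.
rewrite lt_neqAle e0 andbT; apply/eqP => /esym e.
have : (\int[mu]_t (`|(phi t ^+ 2)%:E|) = 0)%E.
  transitivity (\int[mu]_t (phi t ^+ 2)%:E)%E.
    by apply: eq_integral => t _; rewrite gee0_abs// lee_fin sqr_ge0.
  rewrite -(fineK (integrable_fin_num _ integrable_t_density2))//.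
  by rewrite -/(Rintegral _ _ _) -/t_energy e.
have m2 : measurable_fun setT (fun t : mR => (phi t ^+ 2)%:E).
  by apply/measurable_EFinP; apply: measurable_realfun.measurable_funX; exact: measurable_t_density.
move/(ae_eq_integral_abs mu measurableT m2) => ae0.
have : (\int[mu]_t (phi t)%:E = 0)%E.
  transitivity (\int[mu]_(t in [set: mR]) (cst 0%E t))%E; last by rewrite integral0.
  apply: ae_eq_integral => //.
    by apply/measurable_EFinP; exact: measurable_t_density.
  apply: filterS ae0 => t /= h _; move: (h I) => /eqP; rewrite eqe expf_eq0/= => /eqP ->//.
by rewrite integral_t_density// => /eqP; rewrite eqe oner_eq0.
Qed.

(* Cauchy-Schwarz weights: after averaging over the shift, a coordinate
   contributes [theta] if it is differentiated and the factor [1] otherwise. *)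
Definition tilt (c : bool) (t : R) : R := if c then (psi alpha t ^+ 2)^-1 else t_energy^-1.

Lemma psi_gt0 t : 0 < psi alpha t. Proof. exact: (weight_gt0 (- alpha)). Qed.

Lemma psi_le1 t : psi alpha t <= 1.
Proof.
rewrite /psi -[leRHS](powRr0 (1 + `|t|)) ler_powR ?lerDl//.
by rewrite oppr_le0; exact: ltW alpha_gt0.
Qed.

Lemma tilt_gt0 c t : 0 < tilt c t.
Proof. by case: c; rewrite invr_gt0 ?t_energy_gt0// exprn_gt0// psi_gt0. Qed.

Lemma tilt_trueE t : tilt true t = weight (2 * alpha) t.
Proof.
rewrite /tilt /psi -powR_mulrn ?powR_ge0// -powRrM -powRN; congr (_ `^ _); ring.
Qed.

Lemma measurable_tilt c : measurable_fun setT (tilt c : mR -> R).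
Proof.
case: c; last exact: measurable_cst.
by rewrite (_ : tilt true = weight (2 * alpha)); [exact: measurable_weight|apply/funext => t; rewrite tilt_trueE].
Qed.

Lemma tilt_inv_le c t : (tilt c t)^-1 <= 1 + t_energy.
Proof.
have e0 := t_energy_gt0; case: c; rewrite /tilt invrK; last by rewrite lerDr.
by rewrite (@le_trans _ _ 1) ?lerDl ?(ltW e0)// expr_le1 ?psi_le1// ltW ?psi_gt0.
Qed.

Definition covariance1 (c : bool) (x t : R) : R := if c then tent (Phi t) x else phi t ^+ 2.

Lemma integrable_tent_tilt x : 0 <= x <= 1 -> mu.-integrable setT (EFin \o (fun t => tent (Phi t) x * tilt true t)).
Proof.
(* The midpoint of [2 alpha + 1] and [nu]: below [nu] for the tail bound, and with [p - 2 alpha > 1]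
   for integrability. *)
move=> x01; pose p := (2 * alpha + 1 + nu) / 2.
have p_nu : 0 <= p < nu by have := alpha_gt0; have := alpha_lt; rewrite /p; lra.
have [W W0 hW] := t_cdf_tail nu_gt1 p_nu.
apply: (@integrable_dominated _ _ _ mu _ (fun t => W * weight (- (p - 2 * alpha)) t)).
- apply: measurable_realfun.measurable_funM; last exact: measurable_tilt.
  have mPhi := measurable_t_cdf nu_gt1.
  apply: measurable_realfun.measurable_funB; last exact: measurable_realfun.measurable_funX.
  apply: measurable_realfun.measurable_funD; apply: measurable_maxr => //.
    exact: measurable_realfun.measurable_funB.
  by apply: measurable_realfun.measurable_funD => //; exact: measurable_realfun.measurable_funB.
- move=> t; rewrite normrM (gtr0_norm (tilt_gt0 _ _)) tilt_trueE.
  have -> : - (p - 2 * alpha) = - p + 2 * alpha by ring.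
  rewrite weightD mulrA ler_wpM2r ?(ltW (weight_gt0 _ _))//; apply: le_trans (hW t).
  have P0 := t_cdf_ge0 nu_gt1 t; have P1 := t_cdf_le1 nu_gt1 t.
  rewrite le_min tent_bound ?P0 ?P1//= -tent_compl tent_bound// subr_ge0 P1/=.
  by rewrite gerBl.
- rewrite (_ : _ \o _ = fun t => (W%:E * (EFin \o weight (- (p - 2 * alpha))) t)%E)//.
  apply: integrableZl => //; apply: integrable_weightN.
  by have := alpha_lt; rewrite /p; lra.
Qed.

Lemma integral_covariance1 c x : 0 <= x <= 1 ->
  mu.-integrable setT (EFin \o (fun t => covariance1 c x t * tilt c t)) /\
  \int[mu]_t (covariance1 c x t * tilt c t) = if c then theta nu alpha x else 1.
Proof.
move=> x01; case: c; split.
- exact: integrable_tent_tilt.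
- by [].
- rewrite (_ : _ \o _ = fun t => (t_energy^-1%:E * (EFin \o (fun t => phi t ^+ 2)%R) t)%E).
    by apply: integrableZl => //; exact: integrable_t_density2.
  by apply/funext => t /=; rewrite -EFinM mulrC.
- rewrite /covariance1 /tilt RintegralZr//; last exact: integrable_t_density2.
  by rewrite -/t_energy divff// gt_eqF// t_energy_gt0.
Qed.

Variable n : nat.
Implicit Types (a : 'I_n -> R) (Delta t : n.-tuple R).

Definition shifted a Delta : seq R := [seq q (frac (a i + tnth Delta i)) | i <- enum 'I_n].

Lemma size_shifted a Delta : size (shifted a Delta) = n.
Proof. by rewrite size_map size_enum_ord. Qed.

Lemma nth_shifted a Delta (i : 'I_n) : nth 0 (shifted a Delta) i = q (frac (a i + tnth Delta i)).
Proof. by rewrite (nth_map i) ?size_enum_ord// nth_ord_enum. Qed.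

Definition unif (x : R) : R := (0 < x < 1)%R%:R.

Lemma measurable_unif : measurable_fun setT (unif : mR -> R).
Proof.
rewrite (_ : unif = \1_(`]0, 1[%classic : set mR)); first exact: measurable_indic.
by apply/funext => x; rewrite indicE mem_setE in_itv.
Qed.

Lemma integral_unif : (\int[mu]_x (unif x)%:E = 1)%E.
Proof.
transitivity (\int[mu]_x (\1_(`]0%R, 1%R[%classic : set mR) x)%:E)%E.
  by apply: eq_integral => x _; rewrite indicE mem_setE in_itv.
rewrite integral_indic// setIT; have := @lebesgue_measure_itv R `]0%R, 1%R[.
by rewrite /= lte01 sube0.
Qed.

Lemma integrable_unif : mu.-integrable setT (EFin \o unif).
Proof.
apply: integrable_ge0_lty; first exact: measurable_unif.
  by move=> x; rewrite /unif ler0n.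
by rewrite integral_unif ltry.
Qed.

Lemma measurable_below_pair d (T : measurableType d) (f g : T -> R) c :
  measurable_fun setT f -> measurable_fun setT g -> measurable_fun setT (fun x => kernel1 c (f x) (g x)).
Proof.
move=> mf mg; case: c; last by apply: measurableT_comp => //; exact: measurable_t_density.
apply: measurable_realfun.measurable_funB.
  by apply: measurableT_comp => //; exact: measurable_t_cdf.
rewrite (_ : (fun _ => _) = fun x => if f x <= g x then 1 else 0 : R); last first.
  by apply/funext => x; case: (f x <= g x).
by apply: measurable_fun_ifT => //; exact: measurable_fun_ler.
Qed.

Lemma measurable_shift (a : R) : measurable_fun setT (fun x : mR => q (frac (a + x)) : mR).
Proof.
apply: measurableT_comp; first exact: measurable_t_quantile.
apply: measurableT_comp; first exact: measurable_frac.
exact: measurable_realfun.measurable_funD.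
Qed.

Lemma integral_unif_kernel1 c (a a' t : R) :
  mu.-integrable setT (EFin \o (fun x => unif x * (kernel1 c (q (frac (a + x))) t * kernel1 c (q (frac (a' + x))) t))) /\
  \int[mu]_x (unif x * (kernel1 c (q (frac (a + x))) t * kernel1 c (q (frac (a' + x))) t)) =
  covariance1 c (frac (a - a')) t.
Proof.
have [K K0 hK] := kernel1_bounded nu_gt1.
have mk b : measurable_fun setT (fun x : mR => kernel1 c (q (frac (b + x))) t).
  by apply: measurable_below_pair => //; exact: measurable_shift.
have i1 : mu.-integrable setT (EFin \o (fun x => unif x * (kernel1 c (q (frac (a + x))) t * kernel1 c (q (frac (a' + x))) t))).
  apply: (@integrable_dominated _ _ _ mu _ (fun x => (K * K) * unif x)).
  - apply: measurable_realfun.measurable_funM; first exact: measurable_unif.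
    exact: measurable_realfun.measurable_funM.
  - move=> x; have u0 : 0 <= unif x by rewrite ler0n.
    by rewrite normrM (ger0_norm u0) mulrC ler_wpM2r// normrM ler_pM.
  - rewrite (_ : _ \o _ = fun x => ((K * K)%:E * (EFin \o unif) x)%E)//.
    by apply: integrableZl => //; exact: integrable_unif.
split => //; case: c mk i1 => mk i1; first exact: shift_covariance.
rewrite /covariance1 /kernel1.
under eq_Rintegral do rewrite -expr2.
rewrite RintegralZr//; last exact: integrable_unif.
by rewrite /Rintegral integral_unif mul1r.
Qed.

Section points.
Variables (N : nat) (A : 'I_N -> 'I_n -> R).

Definition mean_kernel b Delta t : R := N%:R^-1 * \sum_(k < N) kernel b (shifted (A k) Delta) t.

Definition tilt_prod b t : R := \prod_(i < n) tilt (nth false b i) (tnth t i).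

Definition cube_density Delta : R := \prod_(i < n) unif (tnth Delta i).

Definition lattice_energy b : R := N%:R^-1 ^+ 2 * \sum_(k < N) \sum_(k' < N)
  \prod_(i < n | nth false b i) theta nu alpha (frac (A k i - A k' i)).

Lemma kernel_shifted b a Delta t : kernel b (shifted a Delta) t =
  \prod_(i < n) kernel1 (nth false b i) (q (frac (a i + tnth Delta i))) (tnth t i).
Proof. by apply: eq_bigr => i _; rewrite nth_shifted. Qed.

Lemma measurable_cube_density : measurable_fun setT (cube_density : n.-tuple mR -> R).
Proof. by apply: (measurable_prod_tnth (h := fun=> unif)) => i; exact: measurable_unif. Qed.

Lemma cube_density_ge0 Delta : 0 <= cube_density Delta.
Proof. by apply: prodr_ge0 => i _; rewrite /unif ler0n. Qed.

Lemma tilt_prod_gt0 b t : 0 < tilt_prod b t.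
Proof. by apply: prodr_gt0 => i _; exact: tilt_gt0. Qed.

Lemma measurable_tilt_prod b : measurable_fun setT (tilt_prod b : n.-tuple mR -> R).
Proof. by apply: (measurable_prod_tnth (h := fun i => tilt (nth false b i))) => i; exact: measurable_tilt. Qed.

Lemma measurable_mean_kernel b :
  measurable_fun setT (fun z : n.-tuple mR * n.-tuple mR => mean_kernel b z.1 z.2).
Proof.
apply: measurable_realfun.measurable_funM => //.
apply: measurable_sum => k.
rewrite (_ : (fun _ => _) = fun z => \prod_(i < n) kernel1 (nth false b i) (q (frac (A k i + tnth z.1 i))) (tnth z.2 i)); last first.
  by apply/funext => z; rewrite kernel_shifted.
apply: measurable_prod => i _; apply: measurable_below_pair.
  apply: (measurableT_comp (measurable_shift _)).
  by apply: (measurableT_comp (measurable_tnth i)); exact: measurable_fst.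
by apply: (measurableT_comp (measurable_tnth i)); exact: measurable_snd.
Qed.

Definition spread b (z : n.-tuple R * n.-tuple R) : R := cube_density z.1 * (mean_kernel b z.1 z.2 ^+ 2 * tilt_prod b z.2).

Lemma measurable_spread b : measurable_fun setT (spread b : n.-tuple mR * n.-tuple mR -> R).
Proof.
apply: measurable_realfun.measurable_funM.
  by apply: (measurableT_comp measurable_cube_density); exact: measurable_fst.
apply: measurable_realfun.measurable_funM.
  by apply: measurable_realfun.measurable_funX; exact: measurable_mean_kernel.
by apply: (measurableT_comp (measurable_tilt_prod b)); exact: measurable_snd.
Qed.

Lemma spread_ge0 b z : 0 <= spread b z.
Proof. by rewrite mulr_ge0 ?cube_density_ge0// mulr_ge0 ?sqr_ge0// (ltW (tilt_prod_gt0 _ _)). Qed.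

(** The squared mean is a double sum over pairs of points; each summand is a product over the
    coordinates, which makes the shift integral factorise. *)
Lemma spreadE b Delta t : spread b (Delta, t) = \sum_(p <- enum {: 'I_N * 'I_N})
  (N%:R^-1 ^+ 2 * tilt_prod b t) * \prod_(i < n)
   (unif (tnth Delta i) * (kernel1 (nth false b i) (q (frac (A p.1 i + tnth Delta i))) (tnth t i) *
     kernel1 (nth false b i) (q (frac (A p.2 i + tnth Delta i))) (tnth t i))).
Proof.
rewrite /spread/= /mean_kernel big_enum/=.
under [RHS]eq_bigr do rewrite big_split/= big_split/=.
rewrite -mulr_sumr -mulr_sumr -/(cube_density Delta).
set S := \sum_(k < N) _.
suff -> : \sum_(p in {: 'I_N * 'I_N}) \prod_(i < n) kernel1 (nth false b i) (q (frac (A p.1 i + tnth Delta i))) (tnth t i) *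
   \prod_(i < n) kernel1 (nth false b i) (q (frac (A p.2 i + tnth Delta i))) (tnth t i) = S * S by ring.
rewrite mulr_suml; under [RHS]eq_bigr do rewrite mulr_sumr.
by rewrite pair_big/=; apply: eq_bigr => p _; rewrite !kernel_shifted.
Qed.

Lemma integral_spread_shift b t : (\int[leb n]_Delta (spread b (Delta, t))%:E =
  (\sum_(p <- enum {: 'I_N * 'I_N}) N%:R^-1 ^+ 2 * \prod_(i < n)
     (covariance1 (nth false b i) (frac (A p.1 i - A p.2 i)) (tnth t i) * tilt (nth false b i) (tnth t i)))%:E)%E.
Proof.
pose h (p : 'I_N * 'I_N) (i : 'I_n) (x : R) := unif x * (kernel1 (nth false b i) (q (frac (A p.1 i + x))) (tnth t i) *
     kernel1 (nth false b i) (q (frac (A p.2 i + x))) (tnth t i)).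
have ih (p : 'I_N * 'I_N) (i : 'I_n) := proj1 (integral_unif_kernel1 (nth false b i) (A p.1 i) (A p.2 i) (tnth t i)).
have H p := integral_prod_tuple (ih p).
have := @Rintegral_sum _ _ _ (leb n) _ (enum {: 'I_N * 'I_N})
  (fun p Delta => (N%:R^-1 ^+ 2 * tilt_prod b t) * \prod_(i < n) h p i (tnth Delta i)).
case.
  move=> p _; rewrite (_ : _ \o _ = fun Delta => ((N%:R^-1 ^+ 2 * tilt_prod b t)%:E * (\prod_(i < n) h p i (tnth Delta i))%:E)%E)//.
  by apply: integrableZl => //; exact: (H p).1.
move=> iS ES.
transitivity ((\int[leb n]_Delta (\sum_(p <- enum {: 'I_N * 'I_N}) (N%:R^-1 ^+ 2 * tilt_prod b t) * \prod_(i < n) h p i (tnth Delta i)))%:E).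
  rewrite /Rintegral fineK; last exact: integrable_fin_num iS.
  by apply: eq_integral => Delta _; rewrite spreadE.
rewrite ES; congr EFin; apply: eq_bigr => p _.
rewrite RintegralZl//; last exact: (H p).1.
rewrite -mulrA; congr (_ * _); rewrite (H p).2 mulrC -big_split/=.
by apply: eq_bigr => i _; rewrite (proj2 (integral_unif_kernel1 _ _ _ _)).
Qed.

(** Tonelli: once the shift has been integrated out, the integral over [t] factorises over the
    coordinates as well. *)
Lemma integral_spread b :
  (\int[leb n]_Delta \int[leb n]_t (spread b (Delta, t))%:E = (lattice_energy b)%:E)%E.
Proof.
rewrite (@fubini_tonelli _ _ _ _ _ (leb_tuple n) (leb_tuple n) (EFin \o spread b)); last 2 first.
- by apply/measurable_EFinP; exact: measurable_spread.
- by move=> z; rewrite lee_fin spread_ge0.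
under eq_integral do rewrite integral_spread_shift.
pose h (p : 'I_N * 'I_N) (i : 'I_n) (x : R) :=
  covariance1 (nth false b i) (frac (A p.1 i - A p.2 i)) x * tilt (nth false b i) x.
have fr (p : 'I_N * 'I_N) i : 0 <= frac (A p.1 i - A p.2 i) <= 1.
  by have /andP[-> /ltW ->] := frac_itv (A p.1 i - A p.2 i).
have H p := integral_prod_tuple (fun i : 'I_n => proj1 (integral_covariance1 (nth false b i) (fr p i))).
have := @Rintegral_sum _ _ _ (leb n) _ (enum {: 'I_N * 'I_N})
  (fun p t => N%:R^-1 ^+ 2 * \prod_(i < n) h p i (tnth t i)).
case.
  move=> p _; rewrite (_ : _ \o _ = fun t => ((N%:R^-1 ^+ 2)%:E * (\prod_(i < n) h p i (tnth t i))%:E)%E)//.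
  by apply: integrableZl => //; exact: (H p).1.
move=> iS ES.
rewrite -(fineK (integrable_fin_num _ iS))// -/(Rintegral _ _ _); congr EFin.
rewrite ES big_enum/= /lattice_energy pair_big/= mulr_sumr; apply: eq_bigr => p _.
rewrite RintegralZl//; last exact: (H p).1.
congr (_ * _); rewrite (H p).2 [RHS]big_mkcond/=; apply: eq_bigr => i _.
by rewrite (proj2 (integral_covariance1 _ (fr p i))).
Qed.

End points.
End mean_squared_error.

Lemma allbits_nseq n : allbits n = nseq n false :: behead (allbits n).
Proof. by elim: n => //= n ->. Qed.

Lemma has_behead_allbits n b : b \in behead (allbits n) -> has id b.
Proof.
elim: n b => [//|n IH] b; rewrite /= {1}allbits_nseq/= mem_cat => /orP[] /mapP[b' b'n ->]//=.
exact: IH.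
Qed.

Section quadrature_error.
Context {R : realType} (nu : R) (nu_gt1 : 1 < nu) (alpha : R) (alpha_gt0 : 0 < alpha) (alpha_lt : 2 * alpha + 1 < nu).
Local Notation mR := (measurableTypeR R).
Local Notation leb n := (@lebesgue_tuple R n).
Variables (n : nat) (F : seq bool -> seq R -> R) (C : R).
Hypotheses (dF : mixed_derivatives n F) (bF : weight_bounded n F C).

Let weight_prod (t : n.-tuple R) : R := \prod_(i < n) weight (- 2) (tnth t i).

(* The summand [1] only serves positivity. *)
Definition energy_bound : R := C ^+ 2 * (1 + t_energy nu) ^+ n * \int[leb n]_t weight_prod t + 1.

Lemma weight_le1 (x : R) : weight (- 2) x <= 1.
Proof. by rewrite /weight -[leRHS](powRr0 (1 + `|x|)) ler_powR ?lerDl//; lra. Qed.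

Lemma energy_bound_gt0 : 0 < energy_bound.
Proof.
rewrite ltr_wpDl// mulr_ge0//.
  by rewrite mulr_ge0 ?sqr_ge0// exprn_ge0// addr_ge0// ltW// t_energy_gt0.
by apply: Rintegral_ge0 => t _; apply: prodr_ge0 => i _; rewrite (ltW (weight_gt0 _ _)).
Qed.

(** One of the two factors [weight_prod] in the square is discarded, being at most [1], and every
    inverse tilt is at most [1 + t_energy nu]. *)
Lemma integral_energy_le b : size b = n ->
  (\int[leb n]_t (F b t ^+ 2 * (tilt_prod nu alpha b t)^-1)%:E <= energy_bound%:E)%E.
Proof.
move=> sb; have e0 := t_energy_gt0 nu_gt1.
have iw := integrable_weight_prod (R := R) n.
have w0 t : 0 <= weight_prod t by apply: prodr_ge0 => i _; rewrite (ltW (weight_gt0 _ _)).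
have k0 : 0 <= C ^+ 2 * (1 + t_energy nu) ^+ n.
  by rewrite mulr_ge0 ?sqr_ge0// exprn_ge0// addr_ge0// ltW.
apply: (@le_trans _ _ (\int[leb n]_t (C ^+ 2 * (1 + t_energy nu) ^+ n * weight_prod t)%:E)%E); last first.
  rewrite ge0_integralZl_EFinM//; last first.
    by apply: (measurable_prod_tnth (h := fun=> weight (- 2))) => i; exact: measurable_weight.
  rewrite -(fineK (integrable_fin_num _ iw))// -EFinM lee_fin /energy_bound.
  by rewrite lerDl.
apply: ge0_le_integral_EFin.
- apply: measurable_realfun.measurable_funM.
    apply: measurable_realfun.measurable_funX; apply: measurable_separately_continuous.
    exact: mixed_derivatives_continuous.
  rewrite (_ : (fun _ => _) = fun t : n.-tuple mR => (tilt_prod nu alpha b t) `^ (-1)); last first.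
    by apply/funext => t; rewrite powR_inv1// ltW// tilt_prod_gt0.
  apply: (measurableT_comp (measurable_powR _)).
  exact: measurable_tilt_prod.
- apply: measurable_realfun.measurable_funM => //.
  by apply: (measurable_prod_tnth (h := fun=> weight (- 2))) => i; exact: measurable_weight.
- by move=> t; rewrite mulr_ge0 ?sqr_ge0// invr_ge0 ltW// tilt_prod_gt0.
- move=> t; rewrite [leRHS]mulrAC ler_pM ?sqr_ge0 ?invr_ge0 ?(ltW (tilt_prod_gt0 nu_gt1 _ _ _))//.
  + have h := @weight_boundedP R n F C b t bF sb.
    rewrite -(real_normK (num_real (F b t))).
    apply: (@le_trans _ _ ((C * weight_prod t) ^+ 2)).
      by rewrite lerXn2r ?nnegrE// (le_trans _ h).
    rewrite exprMn ler_wpM2l ?sqr_ge0// expr2 ler_piMr// prodr_ile1// => i.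
    by rewrite (ltW (weight_gt0 _ _)) weight_le1.
  + rewrite /tilt_prod -prodfV -[n in _ ^+ n]card_ord -prodr_const.
    apply: ler_prod => i _; rewrite invr_ge0 (ltW (tilt_gt0 nu_gt1 _ _ _))/=.
    exact: tilt_inv_le.
Qed.

Section points.
Variables (N : nat) (N_gt0 : (0 < N)%N) (A : 'I_N -> 'I_n -> R).

Definition quadrature_error (Delta : n.-tuple R) : R :=
  (\int[leb n]_t (F (nseq n false) t * \prod_(i < n) t_density nu (tnth t i))) -
  N%:R^-1 * \sum_(k < N) F (nseq n false) (shifted nu (A k) Delta).

Let term b Delta : R := \int[leb n]_t (F b t * mean_kernel nu A b Delta t).

Lemma integral_mean_kernel b Delta : size b = n ->
  (leb n).-integrable setT (EFin \o (fun t : n.-tuple R => F b t * mean_kernel nu A b Delta t)) /\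
  term b Delta = N%:R^-1 * \sum_(k < N) \int[leb n]_t (F b t * kernel nu b (shifted nu (A k) Delta) t).
Proof.
move=> sb; have ik k : (leb n).-integrable setT (EFin \o (fun t : n.-tuple R => F b t * kernel nu b (shifted nu (A k) Delta) t)).
  exact: integrable_representation bF sb.
have [] := @Rintegral_sum _ _ _ (leb n) _ (enum 'I_N)
  (fun k t => N%:R^-1 * (F b t * kernel nu b (shifted nu (A k) Delta) t)).
  move=> k _; rewrite (_ : _ \o _ = fun t => (N%:R^-1%:E * (EFin \o (fun t : n.-tuple R => F b t * kernel nu b (shifted nu (A k) Delta) t)%R) t)%E)//.
  exact: integrableZl.
have E : (fun t : n.-tuple R => \sum_(k <- enum 'I_N) N%:R^-1 * (F b t * kernel nu b (shifted nu (A k) Delta) t)) =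
   (fun t => F b t * mean_kernel nu A b Delta t).
  by apply/funext => t; rewrite big_enum/= -mulr_sumr -mulr_sumr mulrCA.
rewrite E => i1 E1; split => //; rewrite /term E1 big_enum/= mulr_sumr.
by apply: eq_bigr => k _; rewrite RintegralZl.
Qed.

(** When the representation is averaged over the points, the all-[false] word gives the integral
    itself: its kernel is the density, independent of the point. The other words remain, with a
    minus sign. *)
Lemma quadrature_errorE Delta : quadrature_error Delta = - \sum_(b <- behead (allbits n)) term b Delta.
Proof.
have sb b : b \in allbits n -> size b = n by exact: size_allbits.
rewrite /quadrature_error.
have -> : N%:R^-1 * \sum_(k < N) F (nseq n false) (shifted nu (A k) Delta) = \sum_(b <- allbits n) term b Delta.
  under eq_bigr do rewrite (representation nu_gt1 dF bF (size_shifted _ _ _)).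
  rewrite exchange_big/= mulr_sumr; apply: eq_big_seq => b /sb sbn.
  by rewrite (proj2 (integral_mean_kernel Delta sbn)).
rewrite {1}allbits_nseq big_cons/= opprD addrA.
suff -> : term (nseq n false) Delta = \int[leb n]_t (F (nseq n false) t * \prod_(i < n) t_density nu (tnth t i)).
  by rewrite subrr add0r.
apply: eq_Rintegral => t _; congr (_ * _); rewrite /mean_kernel.
have NR : N%:R != 0 :> R by rewrite pnatr_eq0 -lt0n.
rewrite (eq_bigr (fun=> \prod_(i < n) t_density nu (tnth t i))).
  by rewrite sumr_const card_ord -(mulr_natl (\prod_(i < n) _)) mulKf.
by move=> k _; apply: eq_bigr => i _; rewrite nth_nseq; case: ifP.
Qed.

Lemma measurable_quadrature_error : measurable_fun setT (quadrature_error : n.-tuple mR -> R).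
Proof.
apply: measurable_realfun.measurable_funB => //.
apply: measurable_realfun.measurable_funM => //; apply: measurable_sum => k.
pose T (Delta : n.-tuple mR) : n.-tuple mR := [tuple t_quantile nu (frac (A k i + tnth Delta i)) | i < n].
rewrite (_ : (fun _ => _) = (fun t : n.-tuple mR => F (nseq n false) t) \o T); last first.
  by apply/funext => Delta /=; congr F.
apply: measurableT_comp.
  apply: measurable_separately_continuous; apply: mixed_derivatives_continuous => //.
  by rewrite size_nseq.
apply/measurable_fun_tnthP => i.
rewrite (_ : _ \o _ = (fun x : mR => t_quantile nu (frac (A k i + x)) : mR) \o (fun t : n.-tuple mR => tnth t i)).
  by apply: measurableT_comp; [exact: measurable_shift|exact: measurable_tnth].
by apply/funext => Delta /=; rewrite tnth_mktuple.
Qed.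

Lemma integral_unit_cube (g : n.-tuple R -> R) :
  (\int[leb n]_(Delta in unit_cube) (g Delta)%:E = \int[leb n]_Delta (cube_density Delta * g Delta)%:E)%E.
Proof.
rewrite integral_mkcond; apply: eq_integral => Delta _; rewrite patchE /cube_density.
case: ifPn => [|]; rewrite ?notin_setE ?inE/= /unit_cube/= => h.
  by rewrite big1 ?mul1r// => i _; rewrite /unif h.
have /existsNP[i hi] := h.
have /negP/negbTE hi' := hi; by rewrite (bigD1 i)//= {1}/unif hi' !mul0r.
Qed.

(** Cauchy-Schwarz is applied at each fixed shift, with values in the extended reals; the finite
    value [lattice_energy] only appears after averaging over the shift. *)
Lemma mean_squared_error_le :
  (\int[leb n]_(Delta in unit_cube) (`|quadrature_error Delta| ^+ 2)%:E <=
  ((size (behead (allbits n)))%:R * energy_bound * \sum_(b <- behead (allbits n)) lattice_energy nu alpha A b)%:E)%E.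
Proof.
set s := behead (allbits n).
have ss b : b \in s -> size b = n by move=> /mem_behead; exact: size_allbits.
have e0 := energy_bound_gt0.
have K0 : 0 <= (size s)%:R * energy_bound by rewrite mulr_ge0// ltW.
have msp b := @measurable_spread R nu nu_gt1 alpha n N A b.
have sp0 b z : 0 <= spread nu alpha A b z by exact: spread_ge0.
have mG b : measurable_fun setT (fun Delta : n.-tuple mR => (\int[leb n]_t (spread nu alpha A b (Delta, t))%:E)%E).
  exact: (@measurable_fun_fubini_tonelli_F _ _ _ _ _ (leb_tuple n) (EFin \o spread nu alpha A b)
     ((measurable_EFinP _ _).2 (msp b)) (fun z => sp0 b z)).
have G0 b Delta : (0 <= \int[leb n]_t (spread nu alpha A b (Delta, t))%:E)%E by apply: integral_EFin_ge0.
rewrite integral_unit_cube.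
apply: (@le_trans _ _ (\int[leb n]_Delta (((size s)%:R * energy_bound)%:E * \sum_(b <- s) \int[leb n]_t (spread nu alpha A b (Delta, t))%:E))%E); last first.
  rewrite ge0_integralZl//; last 2 first.
  - by apply: emeasurable_sum.
  - by move=> Delta _; apply: sume_ge0 => b _.
  rewrite ge0_integral_sum// [leRHS]EFinM lee_wpmul2l ?lee_fin// -sumEFin.
  by apply: lee_sum => b _; rewrite integral_spread.
apply: ge0_le_integral => //.
- by move=> Delta _; rewrite lee_fin mulr_ge0 ?sqr_ge0// cube_density_ge0.
- apply/measurable_EFinP; apply: measurable_realfun.measurable_funM; first exact: measurable_cube_density.
  apply: measurable_realfun.measurable_funX; apply: measurableT_comp => //; exact: measurable_quadrature_error.
- by apply: measurable_funeM; apply: emeasurable_sum.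
move=> Delta _; rewrite quadrature_errorE normrN real_normK ?num_real// EFinM.
apply: (@le_trans _ _ ((cube_density Delta)%:E * ((size s)%:R%:E * \sum_(b <- s) (term b Delta ^+ 2)%:E)))%E.
  by rewrite lee_wpmul2l ?lee_fin ?cube_density_ge0// sumEFin -EFinM lee_fin sqr_sum_le.
rewrite muleCA EFinM -muleA lee_wpmul2l ?lee_fin//.
rewrite ge0_sume_distrr; last by move=> b _; rewrite lee_fin sqr_ge0.
rewrite ge0_sume_distrr; last by [].
rewrite big_seq [leRHS]big_seq; apply: lee_sum => b /ss sb.
have mk : measurable_fun setT (mean_kernel nu A b Delta : n.-tuple mR -> R).
  exact: (measurable_fun_pair2 Delta (@measurable_mean_kernel R nu nu_gt1 n N A b)).
have mt := @measurable_tilt_prod R nu alpha n b.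
have -> : (\int[leb n]_t (spread nu alpha A b (Delta, t))%:E =
    (cube_density Delta)%:E * \int[leb n]_t (mean_kernel nu A b Delta t ^+ 2 * tilt_prod nu alpha b t)%:E)%E.
  rewrite -ge0_integralZl_EFinM ?cube_density_ge0//.
  - apply: measurable_realfun.measurable_funM => //; exact: measurable_realfun.measurable_funX.
  - by move=> t; rewrite mulr_ge0 ?sqr_ge0// ltW// tilt_prod_gt0.
rewrite muleCA lee_wpmul2l ?lee_fin ?cube_density_ge0//.
apply: (@weighted_cauchy_schwarz _ _ _ (leb n)) => //.
- by apply: measurable_separately_continuous; exact: mixed_derivatives_continuous.
- by move=> t; exact: tilt_prod_gt0.
- exact: integral_energy_le.
- exact: (proj1 (integral_mean_kernel Delta sb)).
Qed.

End points.
End quadrature_error.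

(** * The component-by-component construction *)

Section theta_dft.
Context {R : realType} (nu : R) (nu_gt1 : 1 < nu) (alpha : R) (alpha_gt0 : 0 < alpha) (alpha_lt : 2 * alpha + 1 < nu).
Local Notation mu := (@lebesgue_measure R).
Local Notation Phi := (t_cdf nu).

Definition theta_grid N m : R := theta nu alpha ((m %% N)%:R / N%:R).

Lemma theta_gridE N m : (0 < N)%N -> theta_grid N m = theta nu alpha (frac (m%:R / N%:R)).
Proof. by move=> N0; rewrite /theta_grid frac_natdiv. Qed.

Lemma grid_itv N m : (0 < N)%N -> 0 <= ((m %% N)%:R / N%:R : R) <= 1.
Proof.
move=> N0; have NR : 0 < N%:R :> R by rewrite ltr0n.
by rewrite divr_ge0//= ler_pdivrMr// mul1r ler_nat ltnW// ltn_mod.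
Qed.

Lemma theta_rev x : theta nu alpha (1 - x) = theta nu alpha x.
Proof.
by apply: eq_Rintegral => t _; congr (_ / _); exact: tent_rev.
Qed.

Lemma theta_grid_mod N m : theta_grid N (m %% N) = theta_grid N m.
Proof. by rewrite /theta_grid modn_mod. Qed.

Lemma theta_grid_compl N m : (0 < N)%N -> (m <= N)%N -> theta_grid N (N - m) = theta_grid N m.
Proof.
move=> N0 mN; rewrite /theta_grid; case: (posnP m) => [->|m0]; first by rewrite subn0 modnn mod0n.
move: mN; rewrite leq_eqVlt => /predU1P[->|mN]; first by rewrite subnn modnn mod0n.
rewrite !modn_small ?ltn_subrL ?m0// natrB ?(ltnW mN)// mulrBl divff ?theta_rev//.
by rewrite pnatr_eq0 -lt0n.
Qed.

Lemma dft_thetaE N h : (0 < N)%N ->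
  mu.-integrable setT (EFin \o (fun t => dft N (tent_grid N (Phi t)) h * tilt nu alpha true t)) /\
  dft N (theta_grid N) h = \int[mu]_t (dft N (tent_grid N (Phi t)) h * tilt nu alpha true t).
Proof.
move=> N0.
have it m := integrable_tent_tilt nu_gt1 alpha_gt0 alpha_lt (grid_itv m N0).
have [] := @Rintegral_sum _ _ _ mu _ (enum 'I_N)
  (fun m t => (N%:R^-1 * cosq N (h * m)) * (tent (Phi t) ((m %% N)%:R / N%:R) * tilt nu alpha true t)).
  move=> m _; rewrite (_ : _ \o _ = fun t => ((N%:R^-1 * cosq N (h * m))%:E *
    (EFin \o (fun t => tent (Phi t) ((m %% N)%:R / N%:R) * tilt nu alpha true t)%R) t)%E)//.
  by apply: integrableZl => //; exact: it.
rewrite (_ : (fun x : R => \sum_(m <- enum 'I_N) _) = (fun t => dft N (tent_grid N (Phi t)) h * tilt nu alpha true t)).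
  move=> i1 ->; split => //; rewrite big_enum/= /dft mulr_sumr; apply: eq_bigr => m _.
  rewrite [RHS](RintegralZl _ measurableT (it m)).
  by rewrite -[RHS]mulrA [in RHS](mulrC (cosq _ _)).
apply/funext => t; rewrite big_enum/= /dft mulr_sumr mulr_suml; apply: eq_bigr => m _.
rewrite /tent_grid; ring.
Qed.

(** The coefficient of [tent (Phi t)] is bounded with [y = W * weight (- p) t]; against [psi^(-2)]
    the factor [y^k] becomes [(1 + |t|)^(-(p k - 2 alpha))] up to a constant, integrable since
    [p k > 2 alpha + 1]. *)
Lemma dft_theta_bounds (p k : R) : 0 <= p < nu -> 0 <= k <= 1 -> 2 * alpha + 1 < p * k ->
  exists2 V : R, 0 < V & forall N, (0 < N)%N ->
    [/\ forall h, (h < N)%N -> 0 <= dft N (theta_grid N) h,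
        dft N (theta_grid N) 0 <= V * N%:R `^ (- (2 - k)) &
        forall h, (0 < h < N)%N -> dft N (theta_grid N) h <= V * (minn h (N - h))%:R `^ (- (2 - k))].
Proof.
move=> p_nu k01 pk; have [W W0 hW] := t_cdf_tail nu_gt1 p_nu.
have iw : mu.-integrable setT (EFin \o weight (- (p * k - 2 * alpha))).
  by apply: integrable_weightN; lra.
pose w := fun t => weight (- (p * k - 2 * alpha)) t.
have w0 : 0 <= \int[mu]_t w t by apply: Rintegral_ge0 => t _; rewrite (ltW (weight_gt0 _ _)).
have wE t : (W * weight (- p) t) `^ k * tilt nu alpha true t = W `^ k * w t.
  rewrite powRM ?(ltW W0) ?(ltW (weight_gt0 _ _))// tilt_trueE /w -mulrA; congr (_ * _).
  have -> : - (p * k - 2 * alpha) = - p * k + 2 * alpha by ring.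
  by rewrite weightD; congr (_ * _); rewrite /weight -powRrM.
have P01 t : 0 <= Phi t <= 1 by rewrite t_cdf_ge0 ?t_cdf_le1.
have T0 t : 0 < tilt nu alpha true t by exact: tilt_gt0.
pose V := 4 * W `^ k * (1 + \int[mu]_t w t).
exists V; first by rewrite !mulr_gt0 ?powR_gt0// ltr_wpDr.
move=> N N0.
have bound h A : 0 <= A -> (forall t, dft N (tent_grid N (Phi t)) h <= 4 * A * (W * weight (- p) t) `^ k) ->
    dft N (theta_grid N) h <= V * A.
  move=> A0 hA; have [ih ->] := dft_thetaE h N0.
  apply: (@le_trans _ _ (\int[mu]_t (4 * A * W `^ k * w t))).
    apply: le_Rintegral => //.
      rewrite (_ : _ \o _ = fun t => ((4 * A * W `^ k)%:E * (EFin \o weight (- (p * k - 2 * alpha))) t)%E)//.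
      exact: integrableZl.
    by move=> t _; rewrite -[leRHS]mulrA -wE mulrA ler_wpM2r ?(ltW (T0 _)).
  rewrite RintegralZl// /V.
  have -> : 4 * W `^ k * (1 + \int[mu]_t w t) * A = 4 * A * W `^ k * (1 + \int[mu]_t w t) by ring.
  by rewrite ler_wpM2l ?lerDr// !mulr_ge0 ?powR_ge0.
split.
- move=> h hN; have [_ ->] := dft_thetaE h N0; apply: Rintegral_ge0 => t _.
  by rewrite mulr_ge0 ?(ltW (T0 _))// dft_tent_ge0.
- apply: bound; first exact: powR_ge0.
  move=> t; apply: (le_trans (dft_tent0_le N0 (P01 t) (hW t) k01)).
  by rewrite -mulrA ler_peMl ?mulr_ge0 ?powR_ge0// ler1n.
- move=> h hN; apply: bound; first exact: powR_ge0.
  by move=> t; exact: (dft_tent_le N0 (P01 t) (hW t) k01 hN).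
Qed.

End theta_dft.

Section cbc.
Context {R : realType} (nu : R) (nu_gt1 : 1 < nu) (alpha : R) (alpha_gt0 : 0 < alpha) (alpha_lt : 2 * alpha + 1 < nu).
Variable s : nat.
Implicit Types (N : nat) (z : 'I_s -> nat) (u v : {set 'I_s}).
Local Notation tg N := (theta_grid nu alpha N).

(** The sum [S_u]; [gamma u * set_error N z u] is the term of [u] in the squared CBC criterion. *)
Definition set_error N z u : R :=
  N%:R^-1 * \sum_(k < N) \prod_(j in u) theta nu alpha (frac (k%:R * (z j)%:R / N%:R)).

Lemma set_error_grid N z u : (0 < N)%N ->
  set_error N z u = N%:R^-1 * \sum_(k < N) \prod_(j in u) tg N (k * z j)%N.
Proof.
move=> N0; congr (_ * _); apply: eq_bigr => k _; apply: eq_bigr => j _.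
by rewrite theta_gridE// natrM.
Qed.

(* [dual_sum] only reads the frequencies [h < N]. *)
Definition dual_coef N h : R := if (h < N)%N then dft N (tg N) h else dft N (tg N) 0.

Lemma dual_coef_ge0 N h : (0 < N)%N -> 0 <= dual_coef N h.
Proof.
move=> N0; rewrite /dual_coef.
have pos h' : (h' < N)%N -> 0 <= dft N (tg N) h'.
  move=> hN; have [_ ->] := dft_thetaE nu_gt1 alpha_gt0 alpha_lt h' N0; apply: Rintegral_ge0 => t _.
  by rewrite mulr_ge0 ?(ltW (tilt_gt0 _ _ _ _))// dft_tent_ge0// t_cdf_ge0 ?t_cdf_le1.
by case: ifP => hN; exact: pos.
Qed.

Lemma dual_sum_set_error N (l : seq nat) : (0 < N)%N ->
  N%:R^-1 * \sum_(k < N) \prod_(w <- l) tg N (k * w)%N = dual_sum N (dual_coef N) l 0.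
Proof.
move=> N0; have NR : N%:R != 0 :> R by rewrite pnatr_eq0 -lt0n.
apply: (mulfI NR); rewrite mulVKf//.
rewrite (@dual_sumE _ N (dual_coef N) (tg N) l 0)//.
- by apply: eq_bigr => k _; rewrite muln0 /cosq mulr0 mul0r cos0 mul1r.
- move=> h; rewrite leq_eqVlt => /predU1P[->|hN].
    by rewrite subnn /dual_coef N0 ltnn.
  rewrite /dual_coef hN; case: (posnP h) => [->|h0]; first by rewrite subn0 ltnn.
  by rewrite ltn_subrL h0 N0/= dft_compl// ltnW.
- move=> m; rewrite {1}(@dft_inv _ N N0 (tg N) (theta_grid_mod _ _ _) (fun m => @theta_grid_compl _ _ _ N m N0) m).
  by apply: eq_bigr => h _; rewrite /dual_coef ltn_ord.
Qed.

Lemma set_errorE N z u : (0 < N)%N ->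
  set_error N z u = dual_sum N (dual_coef N) [seq z i | i <- enum u] 0.
Proof.
move=> N0; rewrite set_error_grid// -dual_sum_set_error//; congr (_ * _); apply: eq_bigr => k _.
by rewrite big_map big_enum.
Qed.

Lemma set_error_ge0 N z u : (0 < N)%N -> 0 <= set_error N z u.
Proof.
by move=> N0; rewrite set_errorE// dual_sum_ge0// => h; exact: dual_coef_ge0.
Qed.

Lemma eq_set_error N z z' u : {in u, z =1 z'} -> set_error N z u = set_error N z' u.
Proof. by move=> zz; congr (_ * _); apply: eq_bigr => k _; apply: eq_bigr => j /zz ->. Qed.

(** The factor of [j] is brought to the head of the list, where a new value [w] can be chosen with
    the rest fixed. *)
Lemma set_error_replace N z u j w : (0 < N)%N -> j \in u ->
  set_error N (replace z j w) u = dual_sum N (dual_coef N) (w :: [seq z i | i <- enum (u :\ j)%SET]) 0.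
Proof.
move=> N0 ju; rewrite set_error_grid// -dual_sum_set_error//; congr (_ * _); apply: eq_bigr => k _.
rewrite (big_setD1 j)//= big_cons/= /replace eqxx; congr (_ * _).
rewrite big_map big_enum/=; apply: eq_bigr => i; rewrite in_setD1 => /andP[/negbTE -> _] //.
Qed.

(** The product depends on the difference of [k] and [k'] mod [N] only, so the [N] inner sums
    coincide and the double average collapses to a single one. *)
Lemma lattice_energyE N z b : (0 < N)%N ->
  lattice_energy nu alpha (fun (k : 'I_N) i => k%:R * (z i)%:R / N%:R) b =
  set_error N z [set i : 'I_s | nth false b i]%SET.
Proof.
move=> N0; have NR : N%:R != 0 :> R by rewrite pnatr_eq0 -lt0n.
rewrite set_error_grid//.
pose P m := \prod_(i in [set i : 'I_s | nth false b i]%SET) tg N (m * z i)%N.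
have PM m : P (m %% N)%N = P m.
  by apply: eq_bigr => i _; rewrite -theta_grid_mod modnMml theta_grid_mod.
have -> : lattice_energy nu alpha (fun (k : 'I_N) i => k%:R * (z i)%:R / N%:R) b =
    N%:R^-1 ^+ 2 * \sum_(k < N) \sum_(k' < N) P ((k' + (N - k)) %% N)%N.
  rewrite /lattice_energy exchange_big/=; congr (_ * _); apply: eq_bigr => k _; apply: eq_bigr => k' _.
  rewrite PM /P; apply: eq_big => [i|i _]; first by rewrite inE.
  rewrite theta_gridE//; congr theta.
  rewrite -[LHS](fracD1 _ (z i)%:Z); congr frac.
  rewrite natrM natrD natrB ?(ltnW (ltn_ord k))// /intr/=.
  by field.
under eq_bigr do rewrite (sum_modD _ P N0).
rewrite sumr_const card_ord -(mulr_natl (\sum_(i < N) _)) expr2 -mulrA mulKf//.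
Qed.

Lemma e_sh_sqrt (gamma : {set 'I_s} -> R) N d z :
  e_sh gamma nu alpha N d z = Num.sqrt (\sum_(u : {set 'I_s} |
     (u != finset.set0) && (u \subset [set i : 'I_s | (i < d)%N]%SET)) gamma u * set_error N z u).
Proof. by congr Num.sqrt; apply: eq_bigr => u _; rewrite /set_error mulrA. Qed.

Lemma eq_e_sh (gamma : {set 'I_s} -> R) N d z z' : (forall i : 'I_s, (i < d)%N -> z i = z' i) ->
  e_sh gamma nu alpha N d z = e_sh gamma nu alpha N d z'.
Proof.
move=> zz; rewrite !e_sh_sqrt; congr Num.sqrt; apply: eq_bigr => u /andP[_ /fintype.subsetP ud]; congr (_ * _).
by apply: eq_set_error => i /ud; rewrite inE => /zz.
Qed.

(** Coordinates are built one by one. The condition on coordinate [j] reads [z] up to [j] only, so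
    it survives later changes; [1] is always an admissible candidate. *)
Lemma cbc_vector_exists (gamma : {set 'I_s} -> R) N : (2 <= N)%N -> exists z, cbc_vector gamma nu alpha N z.
Proof.
move=> N2; pose cond z (j : 'I_s) := if j == 0%N :> nat then z j = 1%N
    else [/\ (z j < N)%N, coprime (z j) N &
      forall w, (w < N)%N -> coprime w N ->
        e_sh gamma nu alpha N j.+1 z <= e_sh gamma nu alpha N j.+1 (replace z j w)].
suff : forall d, (d <= s)%N -> exists z, forall j : 'I_s, (j < d)%N -> cond z j.
  by move=> /(_ s (leqnn s))[z hz]; exists z => j; exact: hz.
elim=> [_|d IH ds]; first by exists (fun=> 0%N).
have [z hz] := IH (ltnW ds); pose jd := Ordinal ds.
have keep w (j : 'I_s) : (j < d)%N -> cond (replace z jd w) j.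
  move=> jltd; have := hz j jltd; rewrite /cond.
  have jn : (j == jd) = false by apply/negbTE; rewrite -val_eqE/= ltn_eqF.
  have zj : replace z jd w j = z j by rewrite /replace jn.
  rewrite zj; case: ifP => [_ //|_ [h1 h2 h3]]; split; [exact: h1|exact: h2|move=> w' w'N cw'].
  have low (i : 'I_s) : (i < j.+1)%N -> (i == jd) = false.
    by move=> ij; apply/negbTE; rewrite -val_eqE/= ltn_eqF// (leq_trans ij).
  rewrite (@eq_e_sh gamma N j.+1 (replace z jd w) z); last by move=> i /low ij; rewrite /replace ij.
  rewrite (@eq_e_sh gamma N j.+1 (replace (replace z jd w) j w') (replace z j w')) ?h3//.
  by move=> i /low ij; rewrite /replace ij.
have split_d z' (j : 'I_s) : (j < d.+1)%N -> ((j < d)%N -> cond z' j) -> cond z' jd -> cond z' j.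
  rewrite ltnS leq_eqVlt => /predU1P[jd_|jd_] h1 h2; last exact: h1.
  by rewrite (_ : j = jd)//; exact: val_inj.
have [d0|d0] := posnP d.
  exists (replace z jd 1%N) => j jd1; apply: split_d => //; first exact: keep.
  by rewrite /cond/= d0 eqxx /replace eqxx.
have N1 : (1 < N)%N by [].
pose w0 : 'I_N := Ordinal N1.
have c1 : coprime w0 N by rewrite /= coprime1n.
pose obj (w : 'I_N) : R := e_sh gamma nu alpha N d.+1 (replace z jd w).
have [w cw hw] := @Order.TotalTheory.arg_minP _ _ 'I_N w0 (fun w : 'I_N => coprime w N) obj c1.
exists (replace z jd w) => j jd1; apply: split_d => //; first exact: keep.
rewrite /cond/= gtn_eqF//; split.
- by rewrite /replace eqxx.
- by rewrite /replace eqxx.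
move=> w' w'N cw'; apply: le_trans (hw (Ordinal w'N) cw') _.
rewrite /obj /= le_eqVlt; apply/orP; left; apply/eqP; apply: eq_e_sh => i _.
by rewrite /replace; case: ifP.
Qed.

(* If [d] is the largest element of [u], then [set_error z u] is one of the
   nonnegative terms of the squared error that depend on [z d], and all of them
   are small for a good choice of [z d], whatever the previous coordinates are:
   no induction on [d] is needed. *)
Lemma cbc_set_error (gamma : {set 'I_s} -> R) (p k d x : R) : (forall u, 0 < gamma u) ->
  0 <= p < nu -> 0 <= k <= 1 -> 2 * alpha + 1 < p * k -> 0 < d -> 0 < x <= 1 -> (2 - k) * x = 1 + d ->
  exists2 C : R, 0 < C & forall N z, (2 <= N)%N -> cbc_vector gamma nu alpha N z ->
    forall u, u != finset.set0 -> set_error N z u <= C * N%:R `^ ((2 * d - 1) / x).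
Proof.
move=> g0 p_nu k01 pk d0 x01 kx; have [x0 x1] := andP x01.
have [V V0 hV] := dft_theta_bounds nu_gt1 alpha_gt0 alpha_lt p_nu k01 pk.
have K0 : 0 < V `^ x by rewrite powR_gt0.
have [C C0 hC] := @exists_small_dual_sum R (V `^ x) d x {set 'I_s} s K0 d0 x01.
(* Loss in passing from the [gamma]-weighted sum to a single term: the weight of [u] is divided out
   and the weights of all competing sets are bounded by their sum. *)
pose Gam := (\sum_(u : {set 'I_s}) gamma u) * (\sum_(u : {set 'I_s}) (gamma u)^-1).
have sg0 : 0 < \sum_(u : {set 'I_s}) gamma u.
  rewrite (bigD1 finset.set0)//= ltr_wpDr// sumr_ge0// => u _; exact: ltW.
have le_inv u : (gamma u)^-1 <= \sum_(u : {set 'I_s}) (gamma u)^-1.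
  by rewrite (bigD1 u)//= lerDl sumr_ge0// => v _; rewrite invr_ge0 ltW.
have si0 : 0 < \sum_(u : {set 'I_s}) (gamma u)^-1.
  by apply: lt_le_trans (le_inv finset.set0); rewrite invr_gt0.
(* [V] covers the set consisting of the first coordinate alone, whose generator is imposed; the
   second summand covers every other [u]. *)
exists (V + Gam * C `^ x^-1); first by rewrite ltr_wpDr// mulr_ge0 ?powR_ge0// mulr_ge0// ltW.
move=> N z N2 cz u u0; have N0 : (0 < N)%N by exact: leq_trans N2.
have NR : 0 < N%:R :> R by rewrite ltr0n.
have N1 : 1 <= N%:R :> R by rewrite ler1n.
have [D0 D1 D2] := hV N N0.
have c0E : dual_coef N 0 = dft N (tg N) 0 by rewrite /dual_coef N0.
have c0 : dual_coef N 0 `^ x <= V `^ x * N%:R^-1.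
  rewrite c0E; apply: (@le_trans _ _ ((V * N%:R `^ (- (2 - k))) `^ x)).
    by rewrite ge0_ler_powR ?nnegrE ?(ltW x0)// ?D0// mulr_ge0 ?powR_ge0// ltW.
  rewrite powRM ?powR_ge0 ?(ltW V0)// ler_wpM2l ?powR_ge0// -powRrM mulNr kx.
  by rewrite -powR_inv1 ?(ltW NR)// ler_powR//; lra.
have ch h : (0 < h < N)%N -> dual_coef N h `^ x <=
    V `^ x * (h%:R `^ (- (1 + d)) + (N - h)%:R `^ (- (1 + d))).
  move=> hN; have [h0 hltN] := andP hN; rewrite /dual_coef hltN.
  apply: (@le_trans _ _ ((V * (minn h (N - h))%:R `^ (- (2 - k))) `^ x)).
    by rewrite ge0_ler_powR ?nnegrE ?(ltW x0)// ?D0 ?D2// mulr_ge0 ?powR_ge0// ltW.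
  rewrite powRM ?powR_ge0 ?(ltW V0)// ler_wpM2l ?powR_ge0// -powRrM mulNr kx.
  by case: leqP => _; rewrite ?lerDl ?lerDr powR_ge0.
have dc0 h : 0 <= dual_coef N h by exact: dual_coef_ge0.
have expo : N%:R `^ (- (2 - k)) <= N%:R `^ ((2 * d - 1) / x) :> R.
  by rewrite ler_powR// ler_pdivlMr// mulNr kx; lra.
have /set0Pn[i0 i0u] := u0.
have [j ju jmax] := @arg_maxnP _ i0 (mem u) (fun i : 'I_s => i : nat) i0u.
have uj : u \subset [set i : 'I_s | (i < j.+1)%N]%SET by apply/fintype.subsetP => i iu; rewrite inE ltnS; exact: jmax.
(* In the first coordinate nothing is minimised: [u] is a singleton with generator [1], and among
   the frequencies below [N] only [h = 0] is divisible by [N]. *)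
have := cz j; case: ifP => [/eqP j0 zj|j0 [zN zc zmin]].
  have -> : u = [set j]%SET.
    apply/setP => i; rewrite inE; apply/idP/eqP => [iu|->//].
    by apply: val_inj => /=; rewrite j0; have : (i <= j)%N := jmax i iu; rewrite j0 leqn0 => /eqP.
  rewrite set_errorE// enum_set1/= zj.
  rewrite (bigD1 (Ordinal N0))//= big1 ?addr0; last first.
    move=> h hn; rewrite muln1 add0n gtnNdvd ?mulr0//.
    by rewrite lt0n; apply: contraNneq hn => h0; apply/eqP/val_inj.
  rewrite mul0n dvdn0 mulr1 c0E mulrDl (le_trans D1)// (@le_trans _ _ (V * N%:R `^ ((2 * d - 1) / x)))//.
    by rewrite ler_wpM2l// ltW.
  by rewrite lerDl mulr_ge0 ?powR_ge0// mulr_ge0 ?powR_ge0// mulr_ge0// ltW.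
(* One [w] is good for all sets at once, as required by a criterion that compares sums over sets. *)
have [w [wN wc hw]] := hC N (dual_coef N) (fun v : {set 'I_s} => [seq z i | i <- enum (v :\ j)%SET]) N0 dc0 c0 ch
  (fun v => eq_ind_r (fun m => (m <= s)%N) (leq_trans (max_card (mem (v :\ j)%SET)) (eq_leq (card_ord s)))
     (etrans (size_map _ _) (esym (cardE _)))).
have := zmin w wN wc; rewrite !e_sh_sqrt.
pose Q v := (v != finset.set0) && (v \subset [set i : 'I_s | (i < j.+1)%N]%SET).
have term0 z' v : 0 <= gamma v * set_error N z' v by rewrite mulr_ge0 ?set_error_ge0// ltW.
rewrite ler_sqrt; last by apply: sumr_ge0 => v _; exact: term0.
(* The sets without [j] contribute equally for both choices of the coordinate and cancel. *)
rewrite (bigID (fun v : {set 'I_s} => j \in v))/= [leRHS](bigID (fun v : {set 'I_s} => j \in v))/=.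
have -> : \sum_(v : {set 'I_s} | Q v && (j \notin v)) gamma v * set_error N (replace z j w) v =
          \sum_(v : {set 'I_s} | Q v && (j \notin v)) gamma v * set_error N z v.
  apply: eq_bigr => v /andP[_ jv]; congr (_ * _); apply: eq_set_error => i iv.
  by rewrite /replace; case: eqP => // ij; move: jv; rewrite -ij iv.
rewrite lerD2r => hsum.
have small v : j \in v -> set_error N (replace z j w) v <= C `^ x^-1 * N%:R `^ ((2 * d - 1) / x).
  move=> jv; rewrite set_error_replace//.
  have h0 := dual_sum_ge0 N (w :: [seq z i | i <- enum (v :\ j)%SET]) 0 dc0.
  rewrite -[leLHS](powRr1 h0) -[X in _ `^ X <= _](mulfV (lt0r_neq0 x0)) [leLHS]powRrM.
  apply: (@le_trans _ _ ((C * N%:R `^ (2 * d - 1)) `^ x^-1)).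
    by rewrite ge0_ler_powR ?nnegrE ?powR_ge0 ?invr_ge0 ?(ltW x0)// ?hw// mulr_ge0 ?powR_ge0// ltW.
  by rewrite powRM ?powR_ge0 ?(ltW C0)// -powRrM.
have step : gamma u * set_error N z u <= (\sum_(v : {set 'I_s}) gamma v) * (C `^ x^-1 * N%:R `^ ((2 * d - 1) / x)).
  apply: le_trans (le_trans _ hsum) _.
    rewrite (bigD1 u)/=; last by rewrite /Q u0 uj.
    by rewrite lerDl sumr_ge0.
  rewrite mulr_suml big_mkcond/=; apply: ler_sum => v _; case: ifP => [/andP[_ jv]|_].
    by rewrite ler_wpM2l ?small// ltW.
  by rewrite mulr_ge0 ?(ltW (g0 _))// mulr_ge0 ?powR_ge0.
rewrite mulrDl (@le_trans _ _ (Gam * C `^ x^-1 * N%:R `^ ((2 * d - 1) / x)))//; last first.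
  by rewrite lerDr mulr_ge0 ?powR_ge0// ltW.
move: step; rewrite -ler_pdivlMl// => /le_trans; apply.
rewrite /Gam -!mulrA mulrCA ler_wpM2l ?(ltW sg0)// ler_wpM2r//.
by rewrite mulr_ge0 ?powR_ge0.
Qed.

End cbc.

(** * Differential calculus in several variables *)

Section directional_derivatives.
Context {R : realType} {V : normedModType R}.
Implicit Types (h : V -> R) (x u v : V).

Lemma is_derive_line h x v (t : R) : derivable h (x + t *: v) v ->
  is_derive t (1 : R) (fun r : R => h (x + r *: v)) ('D_v h (x + t *: v)).
Proof.
move=> dh.
have E : (fun k : R => k^-1 *: (((fun r : R => h (x + r *: v)) \o shift t) (k *: (1 : R)) - h (x + t *: v))) =
         (fun k : R => k^-1 *: ((h \o shift (x + t *: v)) (k *: v) - h (x + t *: v))).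
  apply/funext => k /=; congr (_ *: (h _ - _)).
  have -> : k *: (1 : R) = k by rewrite /GRing.scale/= mulr1.
  by rewrite scalerDl addrCA.
by apply: DeriveDef; [rewrite /derivable E; exact: dh|rewrite /derive E].
Qed.

Lemma is_derive_translate h x c v : derivable h (x + c) v ->
  is_derive x v (fun y => h (y + c)) ('D_v h (x + c)).
Proof.
move=> dh.
have E : (fun k : R => k^-1 *: (((fun y => h (y + c)) \o shift x) (k *: v) - h (x + c))) =
         (fun k : R => k^-1 *: ((h \o shift (x + c)) (k *: v) - h (x + c))).
  by apply/funext => k /=; rewrite addrA.
by apply: DeriveDef; [rewrite /derivable E; exact: dh|rewrite /derive E].
Qed.

Lemma mean_value_line h x v (t : R) : (forall y, derivable h y v) ->
  exists2 r : R, `|r| <= `|t| & h (x + t *: v) - h x = t * 'D_v h (x + r *: v).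
Proof.
move=> dh; pose g (r : R) := h (x + r *: v); pose dg (r : R) := 'D_v h (x + r *: v).
have dgE (r : R) : is_derive r (1 : R) g (dg r) by exact: is_derive_line.
have cg : continuous g.
  by move=> r; apply: differentiable_continuous; apply/derivable1_diffP; have [] := dgE r.
have g0 : h x = g 0 by rewrite /g scale0r addr0.
have [t0|t0] := leP 0 t.
  have [r] := @MVT_segment R g dg 0 t t0 (fun r _ => dgE r) (continuous_subspaceT cg).
  rewrite in_itv/= subr0 => /andP[r0 rt] E; exists r; first by rewrite !ger0_norm.
  by rewrite g0 -/(g t) E mulrC.
have [r] := @MVT_segment R g dg t 0 (ltW t0) (fun r _ => dgE r) (continuous_subspaceT cg).
rewrite in_itv/= sub0r => /andP[rt r0] E; exists r; first by rewrite ler0_norm// ltr0_norm// lerN2.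
by rewrite g0 -/(g t) -opprB E mulrN opprK mulrC.
Qed.

Lemma cvg_box x u v (p q : R -> R) : (forall k, `|p k| <= `|k|) -> (forall k, `|q k| <= `|k|) ->
  (fun k : R => x + p k *: u + q k *: v) @ 0^' --> x.
Proof.
move=> pk qk.
have small (r : R -> R) : (forall k, `|r k| <= `|k|) -> r @ 0^' --> (0 : R).
  move=> rk; apply: norm_cvg0; apply: (@squeeze_cvgr _ _ _ _ (fun=> 0) (fun k : R => `|k|)).
  - by apply: nearW => k; rewrite normr_ge0 rk.
  - exact: cvg_cst.
  - rewrite -[X in _ --> X](@normr0 _ R); apply: cvg_norm; apply: cvg_within.
suff : (fun k : R => x + p k *: u + q k *: v) @ 0^' --> x + 0 *: u + 0 *: v by rewrite !scale0r !addr0.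
apply: cvgD; first apply: cvgD; first exact: cvg_cst.
  by apply: cvgZr_tmp; exact: small.
by apply: cvgZr_tmp; exact: small.
Qed.

(** Only directional derivatives are assumed to exist: the increment is taken along [u], then along
    [v], and the mean value theorem on the second leg leaves ['D_v h] at a point tending to [x]. *)
Lemma is_derive_dirD h x u v : (forall y, derivable h y u) -> (forall y, derivable h y v) ->
  {for x, continuous ('D_v h)} -> is_derive x (u + v) h ('D_u h x + 'D_v h x).
Proof.
move=> du dv cv.
have /choice[r hr] : forall k : R, exists r : R, `|r| <= `|k| /\
    h (x + k *: u + k *: v) - h (x + k *: u) = k * 'D_v h (x + k *: u + r *: v).
  by move=> k; have [r r1 r2] := mean_value_line (x + k *: u) k dv; exists r.
have c1 : (fun k : R => 'D_v h (x + k *: u + r k *: v)) @ 0^' --> 'D_v h x.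
  apply: (cvg_comp (fun k : R => x + k *: u + r k *: v) ('D_v h) _ cv).
  by apply: (@cvg_box x u v id r) => // k; have [] := hr k.
have c2 : (fun k : R => k^-1 *: ((h \o shift x) (k *: u) - h x)) @ 0^' --> 'D_u h x by exact: du.
have c3 : (fun k : R => k^-1 *: ((h \o shift x) (k *: (u + v)) - h x)) @ 0^' --> 'D_u h x + 'D_v h x.
  apply: cvg_trans (cvgD c2 c1); apply: near_eq_cvg; near=> k.
  have k0 : k != 0 by near: k; exact: nbhs_dnbhs_neq.
  have [_ E] := hr k; rewrite fctE /= (addrC (k *: u)) (addrC (k *: (u + v))) (scalerDr k u v) addrA.
  have -> : 'D_v h (x + k *: u + r k *: v) = k^-1 * (h (x + k *: u + k *: v) - h (x + k *: u)) by rewrite E mulKf.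
  by rewrite /GRing.scale/= -mulrDr [X in _ * X]addrC subrKA.
by apply: DeriveDef; [apply/cvg_ex; eexists; exact: c3|exact: cvg_lim c3].
Unshelve. all: by end_near. Qed.

Lemma second_difference h x u v (k : R) : (forall y, derivable h y u) -> (forall y, derivable ('D_u h) y v) ->
  exists r r' : R, [/\ `|r| <= `|k|, `|r'| <= `|k| &
    h (x + k *: u + k *: v) - h (x + k *: u) - (h (x + k *: v) - h x) =
    k * (k * 'D_v ('D_u h) (x + r *: u + r' *: v))].
Proof.
move=> du dvu; pose m y := h (y + k *: v) - h y.
have dm y : is_derive y u m ('D_u h (y + k *: v) - 'D_u h y).
  by apply: is_deriveB; [exact: is_derive_translate|exact: DeriveDef].
have [r rk E] := mean_value_line x k (fun y => @ex_derive _ _ _ _ _ _ _ (dm y)).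
have [r' rk' E'] := mean_value_line (x + r *: u) k dvu.
exists r, r'; split => //; rewrite -E' -(@derive_val _ _ _ _ _ _ _ (dm _)) -E /m.
by rewrite (addrAC x).
Qed.

(** Schwarz's theorem: the second difference of [h] over the parallelogram spanned by [k u] and
    [k v] is symmetric in [u] and [v], and divided by [k^2] it tends to either mixed derivative. *)
Lemma derive_commute h x u v : (forall y, derivable h y u) -> (forall y, derivable h y v) ->
  (forall y, derivable ('D_u h) y v) -> (forall y, derivable ('D_v h) y u) ->
  {for x, continuous ('D_v ('D_u h))} -> {for x, continuous ('D_u ('D_v h))} ->
  'D_v ('D_u h) x = 'D_u ('D_v h) x.
Proof.
move=> du dv dvu duv cvu cuv.
have /choice[p hp] := fun k => second_difference x k du dvu.
have /choice[p' hp'] := hp.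
have /choice[q hq] := fun k => second_difference x k dv duv.
have /choice[q' hq'] := hq.
have c1 : (fun k : R => 'D_v ('D_u h) (x + p k *: u + p' k *: v)) @ 0^' --> 'D_v ('D_u h) x.
  by apply: (cvg_comp (fun k : R => x + p k *: u + p' k *: v) _ _ cvu); apply: cvg_box => k; have [] := hp' k.
have c2 : (fun k : R => 'D_u ('D_v h) (x + q k *: v + q' k *: u)) @ 0^' --> 'D_u ('D_v h) x.
  by apply: (cvg_comp (fun k : R => x + q k *: v + q' k *: u) _ _ cuv); apply: cvg_box => k; have [] := hq' k.
have c3 : (fun k : R => 'D_v ('D_u h) (x + p k *: u + p' k *: v)) @ 0^' --> 'D_u ('D_v h) x.
  apply: cvg_trans c2; apply: near_eq_cvg; near=> k.
  have k0 : k != 0 by near: k; exact: nbhs_dnbhs_neq.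
  have [_ _ E] := hp' k; have [_ _ E'] := hq' k.
  have ac (a b c e : R) : a - b - (c - e) = a - c - (b - e) by ring.
  have e : k * (k * 'D_u ('D_v h) (x + q k *: v + q' k *: u)) = k * (k * 'D_v ('D_u h) (x + p k *: u + p' k *: v)).
    apply: (etrans (esym E') (etrans _ E)).
    by rewrite (addrAC x (k *: v)); exact: ac.
  exact: (mulfI k0 (mulfI k0 e)).
exact: (cvg_unique (@norm_hausdorff R R) c1 c3).
Unshelve. all: by end_near. Qed.

End directional_derivatives.

Section chain_rule.
Context {R : realType} {V : normedModType R}.
Implicit Types (h : V -> R) (x v : V).

Lemma is_derive_of_line h x v (d : R) : is_derive (0 : R) (1 : R) (fun r : R => h (x + r *: v)) d -> is_derive x v h d.
Proof.
move=> [dh hd].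
have E : (fun k : R => k^-1 *: (((fun r : R => h (x + r *: v)) \o shift (0 : R)) (k *: (1 : R)) - h (x + 0 *: v))) =
         (fun k : R => k^-1 *: ((h \o shift x) (k *: v) - h x)).
  apply/funext => k /=; congr (_ *: (h _ - h _)); last by rewrite scale0r addr0.
  have -> : k *: (1 : R) = k by rewrite /GRing.scale/= mulr1.
  by rewrite addr0 addrC.
by apply: DeriveDef; [rewrite /derivable -E; exact: dh|rewrite /derive -E].
Qed.

Lemma is_derive_comp1 (p : R -> R) h x v (dp : R) : is_derive (h x) (1 : R) p dp -> derivable h x v ->
  is_derive x v (p \o h) (dp * 'D_v h x).
Proof.
move=> hp dh; apply: is_derive_of_line.
have x0 : x + 0 *: v = x by rewrite scale0r addr0.
have hl : is_derive (0 : R) (1 : R) (fun r : R => h (x + r *: v)) ('D_v h x).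
  by rewrite -{2}x0; apply: is_derive_line; rewrite x0.
by apply: (@is_derive1_comp _ p (fun r : R => h (x + r *: v)) 0 _ _ _ hl); rewrite x0.
Qed.

Lemma is_derive_difference h x v (c : R) : (forall k : R, h (x + k *: v) - h x = k * c) -> is_derive x v h c.
Proof.
move=> hc; have cv : (fun k : R => k^-1 *: ((h \o shift x) (k *: v) - h x)) @ 0^' --> c.
  apply: cvg_near_cst; near=> k; have k0 : k != 0 by near: k; exact: nbhs_dnbhs_neq.
  rewrite (_ : (h \o shift x) (k *: v) = h (x + k *: v)); last by rewrite /= addrC.
  by rewrite hc /GRing.scale/= mulKf.
by apply: DeriveDef; [apply/cvg_ex; exists c; exact: cv|exact: (cvg_lim (@norm_hausdorff R R) cv)].
Unshelve. all: by end_near. Qed.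

End chain_rule.

(** * Iterated partial derivatives in any order *)

Section partial_words.
Context {R : realType} {s : nat}.
Implicit Types (g : 'cV[R]_s -> R) (w : seq 'I_s).
Local Notation e i := (delta_mx i ord0 : 'cV[R]_s).

Definition partials w g : 'cV[R]_s -> R := foldr partial g w.

Lemma partials_rcons w i g : partials (rcons w i) g = partials w (partial i g).
Proof. by rewrite /partials foldr_rcons. Qed.

Lemma Ck_continuous k g : Ck k g -> continuous g.
Proof. by case: k => [|k] []. Qed.

Lemma Ck_partials k w g : Ck (k + size w) g -> Ck k (partials w g).
Proof.
elim: w k => [|i w IH] k /=; first by rewrite addn0.
rewrite addnS -addSn => /IH [_ /(_ i)[]] //.
Qed.

Lemma Ck_le k k' g : (k <= k')%N -> Ck k' g -> Ck k g.
Proof.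
elim: k k' g => [|k IH] k' g; first by move=> _ /Ck_continuous.
case: k' => [//|k'] kk [cg dg]; split => // i; have [d1 d2] := dg i.
by split => //; exact: IH d2.
Qed.

Lemma partials_swap i j w g : Ck (size w).+2 g -> partials [:: i, j & w] g = partials [:: j, i & w] g.
Proof.
move=> cg; have c2 : Ck 2 (partials w g) by apply: Ck_partials; rewrite add2n.
have [_ h] := c2; have [d1 [_ d1']] := h i; have [d2 [_ d2']] := h j.
apply/funext => x.
exact: (derive_commute d2 d1 (d2' i).1 (d1' j).1 ((d2' i).2.1 x) ((d1' j).2.1 x)).
Qed.

Lemma partials_insert i w1 w2 g : Ck (size w1 + size w2).+1 g ->
  partials (i :: w1 ++ w2) g = partials (w1 ++ i :: w2) g.
Proof.
elim: w1 => [//|j w1 IH] cg; rewrite cat_cons partials_swap; last by rewrite size_cat.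
rewrite -[LHS]/(partial j (partials (i :: w1 ++ w2) g)) IH//.
by apply: Ck_le cg; rewrite ltnS addSn.
Qed.

Lemma perm_partials w w' g : perm_eq w w' -> Ck (size w) g -> partials w g = partials w' g.
Proof.
elim: w w' => [|i w IH] w' ww' cg.
  by move: ww'; rewrite perm_sym => /perm_nilP ->.
have iw' : i \in w' by rewrite -(perm_mem ww') mem_head.
move: ww'; case/splitPr: iw' => w1 w2 ww'.
have ww : perm_eq w (w1 ++ w2).
  by rewrite -(perm_cons i) (perm_trans ww')// -cat1s perm_catCA.
rewrite -partials_insert; last by rewrite -size_cat -(perm_size ww).
rewrite -[LHS]/(partial i (partials w g)) (IH _ ww)//.
by apply: Ck_le cg => /=.
Qed.

Lemma mderive_partials (a : 'I_s -> nat) g :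
  mderive a g = partials (flatten [seq nseq (a i) i | i <- enum 'I_s]) g.
Proof.
rewrite /mderive; elim: (enum 'I_s) => //= i l ->.
by elim: (a i) => //= k ->.
Qed.

(** Carries a bound on [D^a], stated for one order of differentiation, over to every word of
    indices. *)
Lemma partials_mderive w g : Ck (size w) g -> partials w g = mderive (fun i => count_mem i w) g.
Proof.
move=> cg; rewrite mderive_partials; apply: perm_partials => //.
apply/allP => j _ /=; apply/eqP; rewrite count_flatten -map_comp sumnE big_map big_enum/=.
rewrite (bigD1 j)//= count_nseq/= eqxx mul1n big1 ?addn0// => i ij.
by rewrite count_nseq/= (negbTE ij).
Qed.

Lemma sum_count_mem w : (\sum_(i < s) count_mem i w = size w)%N.
Proof.
elim: w => [|j w IH] /=; first by rewrite big1.
rewrite big_split/= IH (bigD1 j)//= eqxx big1 ?addn0//.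
by move=> i /negbTE ij; rewrite eq_sym ij.
Qed.

End partial_words.

Section bounded_derivatives.
Context {R : realType} {s : nat}.
Implicit Types (f g E : 'cV[R]_s -> R) (i : 'I_s).
Local Notation e i := (delta_mx i ord0 : 'cV[R]_s).

(* [g] is of class C^k and [O(E)], together with its iterated partial
   derivatives of order at most [k]. *)
Fixpoint derivs_le k g E : Prop :=
  [/\ continuous g, exists2 K, 0 <= K & forall z, `|g z| <= K * E z &
  if k is k'.+1 then
    forall i, (forall x, derivable g x (e i)) /\ derivs_le k' (partial i g) E
  else True].

Lemma derivs_le_Ck k g E : derivs_le k g E -> Ck k g.
Proof.
elim: k g => [|k IH] g [cg _ dg]; split => // i.
by have [d1 d2] := dg i; split => //; exact: IH.
Qed.

Lemma derivs_le_continuous k g E : derivs_le k g E -> continuous g.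
Proof. by case: k => [|k] []. Qed.

Lemma derivs_le_bound k g E : derivs_le k g E -> exists2 K, 0 <= K & forall z, `|g z| <= K * E z.
Proof. by case: k => [|k] []. Qed.

Lemma derivs_le_pred k g E : derivs_le k.+1 g E -> derivs_le k g E.
Proof.
elim: k g => [|k IH] g [cg bg dg]; split => // i; have [d1 d2] := dg i.
by split => //; exact: IH.
Qed.

Lemma derivs_le_partials k w g E : derivs_le (k + size w) g E -> derivs_le k (partials w g) E.
Proof.
elim: w k => [|i w IH] k /=; first by rewrite addn0.
by rewrite addnS -addSn => /IH [_ _ /(_ i)[]].
Qed.

Lemma derivs_le_le k k' g E : (k <= k')%N -> derivs_le k' g E -> derivs_le k g E.
Proof.
by move=> /subnK <-; elim: (k' - k)%N => // d IH /derivs_le_pred.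
Qed.

Lemma derivs_le_trans k g E E' c : 0 <= c -> (forall z, E z <= c * E' z) -> derivs_le k g E -> derivs_le k g E'.
Proof.
move=> c0 EE; elim: k g => [|k IH] g [cg [K K0 hK] dg].
  split => //; exists (K * c); first exact: mulr_ge0.
  by move=> z; rewrite (le_trans (hK z))// -mulrA ler_wpM2l.
split => //; last by move=> i; have [d1 d2] := dg i; split => //; exact: IH.
exists (K * c); first exact: mulr_ge0.
by move=> z; rewrite (le_trans (hK z))// -mulrA ler_wpM2l.
Qed.

Lemma Ck_derivs_le k g E : Ck k g ->
  (forall w, (size w <= k)%N -> exists2 K, 0 <= K & forall z, `|partials w g z| <= K * E z) -> derivs_le k g E.
Proof.
elim: k g => [|k IH] g cg bg.
  by split; [exact: Ck_continuous cg|exact: (bg [::])|].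
split; [exact: Ck_continuous cg|exact: (bg [::])|].
move=> i; have [_ /(_ i)[d1 d2]] := cg; split => //; apply: IH => // w wk.
by rewrite -partials_rcons; apply: bg; rewrite size_rcons.
Qed.

Lemma derivs_le_cst k c E : (forall z, 1 <= E z) -> derivs_le k (fun=> c) E.
Proof.
move=> E1; elim: k c => [|k IH] c.
  split => //; first exact: cst_continuous.
  by exists `|c| => // z; rewrite ler_peMr.
split; [exact: cst_continuous|by exists `|c| => // z; rewrite ler_peMr|].
move=> i; split; first by move=> x; exact: derivable_cst.
rewrite (_ : partial i _ = fun=> 0); first exact: IH.
by apply/funext => x; rewrite /partial derive_cst.
Qed.

Lemma derivs_leD k f g E : derivs_le k f E -> derivs_le k g E -> derivs_le k (fun z => f z + g z) E.
Proof.
elim: k f g => [|k IH] f g [cf [K K0 hK] df] [cg [K' K'0 hK'] dg].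
  split => //; first by move=> x; exact: (cvgD (cf x) (cg x)).
  by exists (K + K'); rewrite ?addr_ge0// => z; rewrite mulrDl (le_trans (ler_normD _ _))// lerD.
split; first by move=> x; exact: (cvgD (cf x) (cg x)).
  by exists (K + K'); rewrite ?addr_ge0// => z; rewrite mulrDl (le_trans (ler_normD _ _))// lerD.
move=> i; have [d1 d2] := df i; have [d3 d4] := dg i; split.
  by move=> x; exact: (derivableD (d1 x) (d3 x)).
rewrite (_ : partial i _ = fun z => partial i f z + partial i g z); first exact: IH.
by apply/funext => x; rewrite /partial -(deriveD (d1 x) (d3 x)).
Qed.

Lemma derivs_leM k f g E E' : derivs_le k f E -> derivs_le k g E' ->
  derivs_le k (fun z => f z * g z) (fun z => E z * E' z).
Proof.
elim: k f g => [|k IH] f g hf hg; have [cf [K K0 hK] df] := hf; have [cg [K' K'0 hK'] dg] := hg.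
  split => //; first by move=> x; exact: (cvgM (cf x) (cg x)).
  by exists (K * K'); rewrite ?mulr_ge0// => z; rewrite mulrACA normrM ler_pM.
split; first by move=> x; exact: (cvgM (cf x) (cg x)).
  by exists (K * K'); rewrite ?mulr_ge0// => z; rewrite mulrACA normrM ler_pM.
move=> i; have [d1 d2] := df i; have [d3 d4] := dg i; split.
  by move=> x; exact: (derivableM (d1 x) (d3 x)).
rewrite (_ : partial i _ = fun z => f z * partial i g z + partial i f z * g z).
  by apply: derivs_leD; apply: IH => //; exact: derivs_le_pred.
by apply/funext => x; rewrite /partial (mulrC _ (g x)) -(deriveM (d1 x) (d3 x)).
Qed.

Lemma derivs_leZ k c f E : derivs_le k f E -> derivs_le k (fun z => c * f z) E.
Proof.
have bnd (g : 'cV[R]_s -> R) : (exists2 K, 0 <= K & forall z, `|g z| <= K * E z) ->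
    exists2 K, 0 <= K & forall z, `|c * g z| <= K * E z.
  move=> [K K0 hK]; exists (`|c| * K); first by rewrite mulr_ge0.
  by move=> z; rewrite normrM -mulrA ler_wpM2l.
have cont (g : 'cV[R]_s -> R) : continuous g -> continuous (fun z => c * g z).
  by move=> cg x; exact: (cvgM (cvg_cst c) (cg x)).
elim: k f => [|k IH] f [cf bf df]; split; [exact: cont|exact: bnd|by []|exact: cont|exact: bnd|].
move=> i; have [d1 d2] := df i.
have key x : is_derive x (e i) (fun z => c * f z) (c * partial i f x).
  exact: (@is_deriveZ _ _ _ f c x (e i) _ (DeriveDef (d1 x) erefl)).
split; first by move=> x; have [] := key x.
rewrite (_ : partial i _ = fun z => c * partial i f z); first exact: IH.
by apply/funext => x; have [] := key x.
Qed.

Lemma derivs_le_sum k (I : Type) (r : seq I) (f : I -> 'cV[R]_s -> R) E : (forall z, 0 <= E z) ->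
  (forall j, derivs_le k (f j) E) -> derivs_le k (fun z => \sum_(j <- r) f j z) E.
Proof.
move=> E0 hf; elim: r => [|j r IH].
  rewrite (_ : (fun _ => _) = fun=> 0); last by apply/funext => z; rewrite big_nil.
  elim: k {hf} => [|k IH]; split => //.
  - exact: cst_continuous.
  - by exists 0 => // z; rewrite normr0 mul0r.
  - exact: cst_continuous.
  - by exists 0 => // z; rewrite normr0 mul0r.
  move=> i; split; first by move=> x; exact: derivable_cst.
  by rewrite (_ : partial i _ = fun=> 0)//; apply/funext => x; rewrite /partial derive_cst.
rewrite (_ : (fun _ => _) = fun z => f j z + \sum_(j <- r) f j z); last by apply/funext => z; rewrite big_cons.
exact: derivs_leD.
Qed.

End bounded_derivatives.

Section affine_substitution.
Context {R : realType} {s : nat}.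
Local Notation e i := (delta_mx i ord0 : 'cV[R]_s).
Variables (mu : 'cV[R]_s) (L : 'M[R]_s).

Lemma mulmx_sum_col (z : 'cV[R]_s) : L *m z = \sum_j z j ord0 *: col j L.
Proof.
apply/colP => i; rewrite !mxE summxE; apply: eq_bigr => j _.
by rewrite !mxE mulrC.
Qed.

Lemma continuous_affine_mx : continuous (fun z : 'cV[R]_s => mu + L *m z).
Proof.
rewrite (_ : (fun _ => _) = fun z : 'cV[R]_s => mu + \sum_(j <- enum 'I_s) z j ord0 *: col j L); last first.
  by apply/funext => z; rewrite mulmx_sum_col big_enum.
have cs : continuous (fun z : 'cV[R]_s => \sum_(j <- enum 'I_s) z j ord0 *: col j L).
  elim: (enum 'I_s) => [|j r IH] z.
    by rewrite (_ : (fun _ => _) = fun=> 0); [exact: cst_continuous|apply/funext => y; rewrite big_nil].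
  rewrite (_ : (fun _ => _) = fun z : 'cV[R]_s => z j ord0 *: col j L + \sum_(j <- r) z j ord0 *: col j L); last first.
    by apply/funext => y; rewrite big_cons.
  have c1 : (fun z : 'cV[R]_s => z j ord0 *: col j L) @ z --> z j ord0 *: col j L.
    have cc : continuous (fun y : 'cV[R]_s => y j ord0) by exact: coord_continuous.
    pose V : normedModType R := 'cV[R]_s.
    exact: (@cvgZr_tmp R V _ _ _ (fun y : 'cV[R]_s => y j ord0) (z j ord0) (col j L) (cc z)).
  exact: (cvgD c1 (IH z)).
by move=> z; exact: (cvgD (cvg_cst mu) (cs z)).
Qed.

(** Induction over the directions with [is_derive_dirD]; each step consumes the continuity of one
    partial derivative. *)
Lemma derive_combination (h : 'cV[R]_s -> R) (c : 'I_s -> R) (r : seq 'I_s) :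
  (forall i x, derivable h x (e i)) -> (forall i, continuous (partial i h)) ->
  forall x, is_derive x (\sum_(j <- r) c j *: e j) h (\sum_(j <- r) c j * partial j h x).
Proof.
move=> dh ch; elim: r => [|j r IH] x.
  by rewrite !big_nil; apply: is_derive_difference => k; rewrite scaler0 addr0 subrr mulr0.
have dj y : is_derive y (c j *: e j) h (c j * partial j h y).
  apply: is_derive_of_line.
  have h0 : is_derive (c j * 0) (1 : R) (fun r : R => h (y + r *: e j)) (partial j h y).
    have E : partial j h y = 'D_(e j) h (y + (c j * 0) *: e j) by rewrite mulr0 scale0r addr0.
    by rewrite E; apply: is_derive_line.
  have h1 : is_derive (0 : R) (1 : R) (fun r : R => c j * r) (c j).
    by apply: is_derive_difference => k; rewrite add0r mulr0 subr0 /GRing.scale/= mulr1 mulrC.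
  have := @is_derive1_comp _ (fun r : R => h (y + r *: e j)) (fun r : R => c j * r) 0 _ _ h0 h1.
  rewrite mulrC; congr is_derive; apply/funext => k /=.
  by rewrite scalerA mulrC.
rewrite !big_cons (addrC (c j *: _)) (addrC (c j * _)).
have := @is_derive_dirD R _ h x (\sum_(j <- r) c j *: e j) (c j *: e j).
have -> : 'D_(c j *: e j) h x = c j * partial j h x by have [] := dj x.
have -> : 'D_(\sum_(j <- r) c j *: e j) h x = \sum_(j <- r) c j * partial j h x by have [] := IH x.
apply.
- by move=> y; have [] := IH y.
- by move=> y; have [] := dj y.
- rewrite (_ : 'D_(c j *: e j) h = fun y => c j * partial j h y).
    exact: (cvgM (cvg_cst (c j)) (ch j x)).
  by apply/funext => y; have [] := dj y.
Qed.

(** Each partial derivative of the composite is a combination of partial derivatives of [h] at the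
    image point, with the entries of [L] as coefficients; the bounds pass through finite sums. *)
Lemma derivs_le_affine k (h E : 'cV[R]_s -> R) : (forall x, 0 <= E x) -> derivs_le k h E ->
  derivs_le k (fun z => h (mu + L *m z)) (fun z => E (mu + L *m z)).
Proof.
move=> E0; elim: k h => [|k IH] h [ch [K K0 hK] dh].
  split => //; last by exists K.
  by move=> z; exact: (continuous_comp (continuous_affine_mx (x := z)) (ch (mu + L *m z))).
split; [|by exists K|].
  by move=> z; exact: (continuous_comp (continuous_affine_mx (x := z)) (ch (mu + L *m z))).
have key i z : is_derive z (e i) (fun z => h (mu + L *m z)) (\sum_(j <- enum 'I_s) L j i * partial j h (mu + L *m z)).
  apply: is_derive_of_line.
  have E1 : (\sum_(j <- enum 'I_s) L j i *: e j) = L *m e i.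
    rewrite big_enum/=; apply/colP => a; rewrite summxE !mxE; transitivity (L a i).
      rewrite (bigD1 a)//= big1 ?addr0; first by rewrite !mxE !eqxx mulr1.
      by move=> j ja; rewrite !mxE eq_sym (negbTE ja) mulr0.
    rewrite (bigD1 i)//= big1 ?addr0; first by rewrite !mxE !eqxx mulr1.
    by move=> j ji; rewrite !mxE (negbTE ji) mulr0.
  have d1 i' x : derivable h x (e i') by have [] := dh i'.
  have c1 i' : continuous (partial i' h) by have [_ /derivs_le_continuous] := dh i'.
  have [d2 d3] := @derive_combination h (fun j => L j i) (enum 'I_s) d1 c1 (mu + L *m z).
  rewrite -d3 E1.
  have z0 : mu + L *m z + 0 *: (L *m e i) = mu + L *m z by rewrite scale0r addr0.
  rewrite -{1}z0 (_ : (fun r : R => _) = fun r : R => h (mu + L *m z + r *: (L *m e i))).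
    by apply: is_derive_line; rewrite z0 -E1.
  by apply/funext => r; rewrite mulmxDr -scalemxAr addrA.
move=> i; split; first by move=> z; have [] := key i z.
rewrite (_ : partial i _ = fun z => \sum_(j <- enum 'I_s) L j i * partial j h (mu + L *m z)); last first.
  by apply/funext => z; have [] := key i z.
apply: derivs_le_sum => // j; have [_ /IH bj] := dh j.
exact: derivs_leZ.
Qed.

End affine_substitution.

(** * The importance weight *)

Section slow_growth.
Context {R : realType} {s : nat}.
Implicit Types (f g P : 'cV[R]_s -> R) (i j : 'I_s) (z : 'cV[R]_s).
Local Notation e i := (delta_mx i ord0 : 'cV[R]_s).

Lemma sqnormE z : sqnorm z = \sum_i z i ord0 ^+ 2.
Proof. by rewrite /sqnorm mxE; apply: eq_bigr => i _; rewrite mxE expr2. Qed.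

Lemma sqnorm_ge0 z : 0 <= sqnorm z.
Proof. by rewrite sqnormE sumr_ge0// => i _; exact: sqr_ge0. Qed.

Lemma sqr_le_sqnorm z i : z i ord0 ^+ 2 <= sqnorm z.
Proof. by rewrite sqnormE (bigD1 i)//= lerDl sumr_ge0// => j _; exact: sqr_ge0. Qed.

Definition growth (t : R) z : R := expR (t * sqnorm z).

Lemma growth_gt0 t z : 0 < growth t z. Proof. exact: expR_gt0. Qed.

Lemma growth_ge1 t z : 0 <= t -> 1 <= growth t z.
Proof. by move=> t0; rewrite -expR0 ler_expR mulr_ge0// sqnorm_ge0. Qed.

Lemma growthD a b z : growth a z * growth b z = growth (a + b) z.
Proof. by rewrite /growth mulrDl expRD. Qed.

(** The quantifiers over [k] and [t] make the class closed under partial derivatives and, by halving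
    [t], under products. *)
Definition slow g := forall k (t : R), 0 < t -> derivs_le k g (growth t).

Lemma slow_cst c : slow (fun=> c).
Proof. by move=> k t t0; apply: derivs_le_cst => z; rewrite growth_ge1// ltW. Qed.

Lemma slowD f g : slow f -> slow g -> slow (fun z => f z + g z).
Proof. by move=> hf hg k t t0; apply: derivs_leD; [exact: hf|exact: hg]. Qed.

Lemma slowM f g : slow f -> slow g -> slow (fun z => f z * g z).
Proof.
move=> hf hg k t t0; have t2 : 0 < t / 2 by rewrite divr_gt0.
apply: (derivs_le_trans ler01 _ (derivs_leM (hf k _ t2) (hg k _ t2))) => z.
by rewrite growthD -splitr mul1r.
Qed.

Lemma slow_sum (I : Type) (r : seq I) (f : I -> 'cV[R]_s -> R) : (forall j : I, slow (f j)) ->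
  slow (fun z => \sum_(j <- r) f j z).
Proof.
by move=> hf k t t0; apply: derivs_le_sum => [z|j]; [rewrite ltW ?growth_gt0|exact: hf].
Qed.

Lemma slow_prod (I : Type) (r : seq I) (f : I -> 'cV[R]_s -> R) : (forall j : I, slow (f j)) ->
  slow (fun z => \prod_(j <- r) f j z).
Proof.
move=> hf; elim: r => [|j r IH].
  by rewrite (_ : (fun _ => _) = fun=> 1); [exact: slow_cst|apply/funext => z; rewrite big_nil].
rewrite (_ : (fun _ => _) = fun z => f j z * \prod_(j <- r) f j z); first exact: slowM.
by apply/funext => z; rewrite big_cons.
Qed.

Lemma derivable_slow g i z : slow g -> derivable g z (e i).
Proof. by move=> /(_ 1%N 1 ltr01)[_ _ /(_ i)[]]. Qed.

Lemma slow_partial g i : slow g -> slow (partial i g).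
Proof. by move=> hg k t t0; have [_ _ /(_ i)[]] := hg k.+1 t t0. Qed.

Lemma is_derive_coord i j z : is_derive z (e j) (fun z : 'cV[R]_s => z i ord0) (i == j)%:R.
Proof. by apply: is_derive_difference => k; rewrite !mxE eqxx andbT addrAC subrr add0r. Qed.

Lemma derivs_le_coord k i (t : R) : 0 < t -> derivs_le k (fun z : 'cV[R]_s => z i ord0) (growth t).
Proof.
move=> t0; have cc : continuous (fun z : 'cV[R]_s => z i ord0) by exact: coord_continuous.
have bc : exists2 K : R, 0 <= K & forall z : 'cV[R]_s, `|z i ord0| <= K * growth t z.
  (* [|z_i| <= 1 + |z|^2 <= (1 + 1/t) (1 + t |z|^2)], and the last factor is at most
     [growth t z]. *)
  exists (1 + t^-1); first by rewrite addr_ge0// invr_ge0 ltW.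
  move=> z; apply: (@le_trans _ _ (1 + sqnorm z)).
    apply: (@le_trans _ _ (1 + z i ord0 ^+ 2)); last by rewrite lerD2l sqr_le_sqnorm.
    rewrite -(real_normK (num_real (z i ord0))); have := sqr_ge0 (`|z i ord0| - 1).
    by have := normr_ge0 (z i ord0); rewrite sqrrB mulr1 expr1n; lra.
  apply: (@le_trans _ _ ((1 + t^-1) * (1 + t * sqnorm z))); last first.
    by rewrite ler_wpM2l ?expR_ge1Dx// addr_ge0// invr_ge0 ltW.
  have -> : (1 + t^-1) * (1 + t * sqnorm z) = 1 + sqnorm z + (t^-1 + t * sqnorm z) by field; rewrite gt_eqF.
  by rewrite lerDl addr_ge0 ?invr_ge0 ?mulr_ge0 ?sqnorm_ge0// ltW.
case: k => [|k]; split => // j; split; first by move=> z; have [] := is_derive_coord i j z.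
rewrite (_ : partial j _ = fun=> (i == j)%:R); first exact: slow_cst.
by apply/funext => z; have [] := is_derive_coord i j z.
Qed.

Lemma slow_coord i : slow (fun z => z i ord0).
Proof. by move=> k t t0; exact: derivs_le_coord. Qed.

(** Each derivative brings out a factor [partial i P], again slow, which is paid for with half of
    the remaining [t]. *)
Lemma derivs_le_expR P k (t : R) : slow P -> 0 < t ->
  derivs_le k (fun z => expR (P z)) (fun z => growth t z * expR (P z)).
Proof.
move=> hP; have cP : continuous P by exact: derivs_le_continuous (hP 0%N 1 ltr01).
have cE : continuous (fun z => expR (P z)).
  by move=> z; exact: (continuous_comp (cP z) (@continuous_expR R (P z))).
have bE u : 0 < u -> exists2 K : R, 0 <= K & forall z, `|expR (P z)| <= K * (growth u z * expR (P z)).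
  move=> u0; exists 1 => // z; rewrite mul1r ger0_norm ?expR_ge0// ler_peMl ?expR_ge0//.
  by rewrite growth_ge1// ltW.
elim: k t => [|k IH] t t0; split => //; [exact: bE|exact: bE|].
have key i z : is_derive z (e i) (fun z => expR (P z)) (partial i P z * expR (P z)).
  rewrite mulrC; apply: (@is_derive_comp1 _ _ expR P); exact: derivable_slow.
move=> i; split; first by move=> z; have [] := key i z.
rewrite (_ : partial i _ = fun z => partial i P z * expR (P z)); last by apply/funext => z; have [] := key i z.
have t2 : 0 < t / 2 by rewrite divr_gt0.
apply: (derivs_le_trans ler01 _ (derivs_leM (slow_partial i hP k t2) (IH _ t2))) => z.
by rewrite mulrA growthD -splitr mul1r.
Qed.

End slow_growth.

Section student_factor.
Context {R : realType} {s : nat} (nu : R) (nu_gt0 : 0 < nu).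
Local Notation e i := (delta_mx i ord0 : 'cV[R]_s).

Definition t_power (b y : R) : R := (1 + y ^+ 2 / nu) `^ b.

Lemma t_power_base_ge1 (y : R) : 1 <= 1 + y ^+ 2 / nu.
Proof. by rewrite lerDl divr_ge0 ?sqr_ge0// ltW. Qed.

Lemma is_derive_t_power b (y : R) : is_derive y (1 : R) (t_power b) (2 * b / nu * y * t_power (b - 1) y).
Proof.
have y0 : 0 < 1 + y ^+ 2 / nu by exact: lt_le_trans (t_power_base_ge1 y).
have h2 : is_derive y (1 : R) (fun y : R => 1 + y ^+ 2 / nu) (2 * y / nu).
  have hid : is_derive y (1 : R) (@id R) 1 by exact: is_derive_id.
  have := is_deriveD (is_derive_cst (1 : R) y (1 : R)) (is_deriveZ nu^-1 (is_deriveM hid hid)).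
  rewrite (_ : _ + _ = fun y : R => 1 + y ^+ 2 / nu); last by apply/funext => u; rewrite fctE /= /GRing.scale/= mulrC.
  by rewrite (_ : _ + _ = 2 * y / nu)// /GRing.scale/=; ring.
have := @is_derive1_comp _ (fun x : R => x `^ b) (fun y : R => 1 + y ^+ 2 / nu) y _ _ (is_derive1_powR b y0) h2.
by move/(@is_derive_eq _ _ _ _ _ _ _ _); apply; rewrite /t_power; ring.
Qed.

Lemma t_power_le (b t : R) : 0 < t -> exists2 K : R, 0 <= K & forall y, t_power b y <= K * expR (t * y ^+ 2).
Proof.
move=> t0; pose p := `|b| + 1; have p0 : 0 < p by rewrite ltr_wpDl.
pose c := t * nu; have c0 : 0 < c by rewrite mulr_gt0.
(* The constant of [powR_le_expR] at [c (1 + y^2 / nu)]: the choice [c = t * nu] makes the exponent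
   there equal to [t y^2 + c - p]. *)
exists (c `^ (- p) * (p `^ p * expR (c - p))); first by rewrite !mulr_ge0 ?powR_ge0 ?expR_ge0.
move=> y; have b1 := t_power_base_ge1 y; have b0 : 0 < 1 + y ^+ 2 / nu by exact: lt_le_trans b1.
apply: (@le_trans _ _ ((1 + y ^+ 2 / nu) `^ p)).
  by rewrite ler_powR// /p (le_trans (ler_norm b))// lerDl.
have := powR_le_expR p0 (mulr_gt0 c0 b0).
rewrite powRM ?(ltW c0) ?(ltW b0)// => h.
have cp : 0 < c `^ p by rewrite powR_gt0.
rewrite powRN -(mulrA (c `^ p)^-1) ler_pdivlMl//; apply: (le_trans h).
rewrite -[leRHS]mulrA ler_wpM2l ?powR_ge0// -expRD ler_expR le_eqVlt; apply/orP; left; apply/eqP; rewrite /c.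
by field; rewrite gt_eqF.
Qed.

(** The powers of [1 + y^2 / nu] are stable under differentiation up to a multiple of [y], so the
    induction runs over all exponents [b] at once. *)
Lemma slow_t_power b (i : 'I_s) : slow (fun z : 'cV[R]_s => t_power b (z i ord0)).
Proof.
have cc : continuous (fun z : 'cV[R]_s => z i ord0) by exact: coord_continuous.
have cz a : continuous (fun z : 'cV[R]_s => t_power a (z i ord0)).
  have cp : continuous (t_power a).
    by move=> y; apply: differentiable_continuous; apply/derivable1_diffP; have [] := is_derive_t_power a y.
  by move=> z; exact: (continuous_comp (cc z) (cp (z i ord0))).
have bz a t : 0 < t -> exists2 K : R, 0 <= K & forall z : 'cV[R]_s, `|t_power a (z i ord0)| <= K * growth t z.
  move=> t0; have [K K0 hK] := t_power_le a t0; exists K => // z.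
  rewrite ger0_norm ?powR_ge0// (le_trans (hK _))// ler_wpM2l// ler_expR.
  by rewrite ler_wpM2l ?sqr_le_sqnorm// ltW.
move=> k; elim: k b => [|k IH] b t t0; split; [exact: cz|exact: bz|by []|exact: cz|exact: bz|].
move=> j.
pose dz (z : 'cV[R]_s) := (2 * b / nu * (i == j)%:R) * (z i ord0 * t_power (b - 1) (z i ord0)).
have key z : is_derive z (e j) (fun z : 'cV[R]_s => t_power b (z i ord0)) (dz z).
  have [d1 d2] := is_derive_coord i j z.
  have := @is_derive_comp1 _ _ (t_power b) (fun z : 'cV[R]_s => z i ord0) z (e j) _ (is_derive_t_power b (z i ord0)) d1.
  rewrite d2 => /(@is_derive_eq _ _ _ _ _ _ _ _); apply; rewrite /dz; ring.
split; first by move=> z; have [] := key z.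
rewrite (_ : partial j _ = dz); last by apply/funext => z; have [] := key z.
apply: derivs_leZ; have t2 : 0 < t / 2 by rewrite divr_gt0.
apply: (derivs_le_trans ler01 _ (derivs_leM (slow_coord i k t2) (IH (b - 1) _ t2))) => z.
by rewrite growthD -splitr mul1r.
Qed.

End student_factor.

Section importance_weight.
Context {R : realType} {s : nat} (nu : R) (nu_gt1 : 1 < nu).
Variables (mu mu0 : 'cV[R]_s) (Sigma Sigma0 L : 'M[R]_s).

Lemma slow_affine_coord i : slow (fun z => (mu + L *m z - mu0) i ord0).
Proof.
rewrite (_ : (fun _ => _) = fun z : 'cV[R]_s => (mu i ord0 - mu0 i ord0) + \sum_(j <- enum 'I_s) L i j * z j ord0).
  apply: slowD; first exact: slow_cst.
  by apply: slow_sum => j; apply: slowM; [exact: slow_cst|exact: slow_coord].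
by apply/funext => z; rewrite !mxE addrAC big_enum.
Qed.

Lemma sqnorm_mxE (E : 'M[R]_s) x : sqnorm_mx E x =
  \sum_(j <- enum 'I_s) (\sum_(i <- enum 'I_s) x i ord0 * invmx E i j) * x j ord0.
Proof.
rewrite /sqnorm_mx mxE big_enum/=; apply: eq_bigr => j _; rewrite mxE big_enum/=; congr (_ * _).
by apply: eq_bigr => i _; rewrite mxE.
Qed.

Lemma slow_exponent : slow (fun z => - (2^-1 * sqnorm_mx Sigma0 (mu + L *m z - mu0))).
Proof.
rewrite (_ : (fun _ => _) = fun z : 'cV[R]_s => (- 2^-1) * \sum_(j <- enum 'I_s)
   (\sum_(i <- enum 'I_s) (mu + L *m z - mu0) i ord0 * invmx Sigma0 i j) * (mu + L *m z - mu0) j ord0).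
  apply: slowM; first exact: slow_cst.
  apply: slow_sum => j; apply: slowM; last exact: slow_affine_coord.
  by apply: slow_sum => i; apply: slowM; [exact: slow_affine_coord|exact: slow_cst].
by apply/funext => z; rewrite sqnorm_mxE mulNr.
Qed.

Lemma derivs_le_W_t k (t : R) : 0 < t -> derivs_le k (W_t nu mu mu0 Sigma Sigma0 L)
  (fun z => growth t z * expR (- (2^-1 * sqnorm_mx Sigma0 (mu + L *m z - mu0)))).
Proof.
move=> t0; have t2 : 0 < t / 2 by rewrite divr_gt0.
have nu0 : 0 < nu by exact: lt_trans nu_gt1.
have hp : slow (fun z : 'cV[R]_s => \prod_(i <- enum 'I_s)
    (Num.sqrt (nu * pi) * Gamma (nu / 2) / Gamma ((nu + 1) / 2) * t_power nu ((nu + 1) / 2) (z i ord0))).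
  by apply: slow_prod => i; apply: slowM; [exact: slow_cst|exact: slow_t_power].
have h := derivs_leM (derivs_leZ (Num.sqrt (\det Sigma) / ((2 * pi) `^ (s%:R / 2) * Num.sqrt (\det Sigma0)))
  (derivs_le_expR k slow_exponent t2)) (hp k _ t2).
rewrite (_ : W_t _ _ _ _ _ _ = fun z => Num.sqrt (\det Sigma) / ((2 * pi) `^ (s%:R / 2) * Num.sqrt (\det Sigma0)) *
  expR (- (2^-1 * sqnorm_mx Sigma0 (mu + L *m z - mu0))) * \prod_(i <- enum 'I_s)
    (Num.sqrt (nu * pi) * Gamma (nu / 2) / Gamma ((nu + 1) / 2) * t_power nu ((nu + 1) / 2) (z i ord0))); last first.
  by apply/funext => z; rewrite /W_t big_enum.
apply: (derivs_le_trans ler01 _ h) => z.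
by rewrite mul1r mulrAC growthD -splitr.
Qed.

End importance_weight.

(** * Gaussian decay of the integrand *)

Section quadratic_forms.
Context {R : realType} {s : nat}.
Implicit Types (A B E : 'M[R]_s) (x y : 'cV[R]_s).

Definition form A x y : R := (x^T *m A *m y) 0 0.

Lemma form_sum A x y : form A x y = \sum_i \sum_j x i ord0 * A i j * y j ord0.
Proof.
rewrite /form mxE exchange_big/=; apply: eq_bigr => j _; rewrite mxE mulr_suml.
by apply: eq_bigr => i _; rewrite mxE.
Qed.

Lemma form_sym A x y : A^T = A -> form A x y = form A y x.
Proof.
move=> AT; have e : x^T *m A *m y = (y^T *m A *m x)^T by rewrite !trmx_mul trmxK AT mulmxA.
by rewrite /form e mxE.
Qed.

Lemma formDZ A x y (t : R) : A^T = A ->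
  form A (x + t *: y) (x + t *: y) = form A x x + 2 * t * form A x y + t ^+ 2 * form A y y.
Proof.
move=> AT; have e (a b c d : 'M[R]_1) : (a + t *: b + t *: (c + t *: d)) 0 0 =
    a 0 0 + t * (b 0 0 + c 0 0) + t ^+ 2 * d 0 0 by rewrite !mxE; ring.
have -> : form A (x + t *: y) (x + t *: y) = form A x x + t * (form A x y + form A y x) + t ^+ 2 * form A y y.
  rewrite -e /form (_ : (x + t *: y)^T = x^T + t *: y^T); last by apply/matrixP => i j; rewrite !mxE.
  by rewrite !mulmxDl !mulmxDr -!scalemxAl -!scalemxAr scalerDr.
by rewrite (form_sym y x AT); ring.
Qed.

Lemma form_le A : exists2 C : R, 0 < C & forall x, `|form A x x| <= C * sqnorm x.
Proof.
exists (1 + \sum_i \sum_j `|A i j|); first by rewrite ltr_wpDr// sumr_ge0// => i _; rewrite sumr_ge0.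
move=> x; rewrite form_sum mulrDl mul1r ler_wpDl ?sqnorm_ge0// (le_trans (ler_norm_sum _ _ _))//.
rewrite mulr_suml ler_sum// => i _; rewrite (le_trans (ler_norm_sum _ _ _))// mulr_suml ler_sum// => j _.
rewrite mulrAC normrM [leLHS]mulrC ler_wpM2l//.
have := sqr_le_sqnorm x i; have := sqr_le_sqnorm x j.
have := sqr_ge0 (x i ord0 - x j ord0); have := sqr_ge0 (x i ord0 + x j ord0).
rewrite sqrrB sqrrD => h1 h2 h3 h4; rewrite ler_norml; apply/andP; split; lra.
Qed.

Lemma sqnorm_mulmx_le B : exists2 C : R, 0 < C & forall x, sqnorm (B *m x) <= C * sqnorm x.
Proof.
have [C C0 hC] := form_le (B^T *m B); exists C => // x; apply: le_trans (hC x).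
rewrite (_ : sqnorm (B *m x) = form (B^T *m B) x x) ?ler_norm//.
by rewrite /sqnorm /form trmx_mul !mulmxA.
Qed.

Lemma sqnorm_eq0 x : (sqnorm x == 0) = (x == 0).
Proof.
apply/eqP/eqP => [x0|->]; last by rewrite /sqnorm mulmx0 mxE.
apply/colP => i; rewrite mxE; apply/eqP; rewrite -sqrf_eq0 eq_le sqr_ge0 andbT.
by rewrite (le_trans (sqr_le_sqnorm x i))// x0.
Qed.

Lemma sqnorm_gt0 x : x != 0 -> 0 < sqnorm x.
Proof. by rewrite lt0r sqnorm_ge0 andbT sqnorm_eq0. Qed.

Lemma sqnorm0 : sqnorm (0 : 'cV[R]_s) = 0.
Proof. by apply/eqP; rewrite sqnorm_eq0. Qed.

Lemma psd_cauchy_schwarz A x y : A^T = A -> (forall x, 0 <= form A x x) ->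
  form A x y ^+ 2 <= form A x x * form A y y.
Proof.
move=> AT A0; have key t : 0 <= form A x x + 2 * t * form A x y + t ^+ 2 * form A y y.
  by rewrite -formDZ.
have := A0 y; rewrite le_eqVlt => /predU1P[yy|yy].
  rewrite -yy mulr0; have [->|xy] := eqVneq (form A x y) 0; first by rewrite expr0n.
  (* If [form A y y = 0], the quadratic in [t] is affine, and this [t] would give it the value
     [-1]. *)
  have := key (- (form A x x + 1) / (2 * form A x y)); rewrite -yy mulr0 addr0.
  have -> : 2 * (- (form A x x + 1) / (2 * form A x y)) * form A x y = - (form A x x + 1) by field.
  by rewrite opprD addrA subrr add0r oppr_ge0 ler10.
have := key (- form A x y / form A y y).
have -> : form A x x + 2 * (- form A x y / form A y y) * form A x y + (- form A x y / form A y y) ^+ 2 * form A y y =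
   form A x x - form A x y ^+ 2 / form A y y by field; rewrite gt_eqF.
by rewrite subr_ge0 ler_pdivrMr.
Qed.

Lemma unitmx_of_kernel E : (forall v : 'rV[R]_s, v *m E = 0 -> v = 0) -> E \in unitmx.
Proof.
move=> hE; rewrite -row_free_unit -kermx_eq0; apply/eqP/row_matrixP => i; rewrite row0.
by apply: hE; rewrite -row_mul mulmx_ker row0.
Qed.

(** Cauchy-Schwarz with [y = A^(-1) x] gives [|x|^4 <= form A x x * form (invmx A) x x], and the
    last factor is at most [C |x|^2]. This replaces a compactness or spectral argument. *)
Lemma psd_unit_coercive A : A^T = A -> (forall x, 0 <= form A x x) -> A \in unitmx ->
  exists2 c : R, 0 < c & forall x, c * sqnorm x <= form A x x.
Proof.
move=> AT A0 uA; have [C C0 hC] := form_le (invmx A).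
exists C^-1; first by rewrite invr_gt0.
move=> x; have [->|x0] := eqVneq x 0; first by rewrite sqnorm0 mulr0.
have xx := sqnorm_gt0 x0; pose y := invmx A *m x.
have E1 : form A x y = sqnorm x by rewrite /form /y mulmxA mulmxK.
have E2 : form A y y = form (invmx A) x x.
  by rewrite {1}/form /y mulmxA mulmxK// trmx_mul trmx_inv AT /form.
have := psd_cauchy_schwarz x y AT A0; rewrite E1 E2 => h.
have h2 : form (invmx A) x x <= C * sqnorm x by rewrite (le_trans _ (hC x))// ler_norm.
have h3 : sqnorm x ^+ 2 <= form A x x * (C * sqnorm x) by rewrite (le_trans h)// ler_wpM2l.
move: h3; rewrite expr2 mulrA ler_pM2r// => h3.
by rewrite mulrC ler_pdivrMr.
Qed.

Lemma posdef_unit E : sym_posdef E -> E \in unitmx.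
Proof.
move=> [ET Epos]; apply: unitmx_of_kernel => v vE; apply/eqP; apply: contraT => v0.
have vT0 : v^T != 0 by apply: contraNneq v0 => h; rewrite -(trmxK v) h trmx0.
by have := Epos _ vT0; rewrite trmxK vE mul0mx mxE ltxx.
Qed.

(* The largest [m] with [m |x|^2 <= x^T E^-1 x] makes [E^-1 - m] singular:
   otherwise this semidefinite matrix would be coercive.  Hence [1/m] is an
   eigenvalue of [E]. *)
Lemma rayleigh E x : (0 < s)%N -> sym_posdef E -> (lambda_max E)^-1 * sqnorm x <= sqnorm_mx E x.
Proof.
move=> s0 hE; have [ET Epos] := hE; have uE := posdef_unit hE.
have iT : (invmx E)^T = invmx E by rewrite trmx_inv ET.
have sqE y : sqnorm_mx E y = form (invmx E) y y by [].
have ipos y : y != 0 -> 0 < form (invmx E) y y.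
  move=> y0; have -> : form (invmx E) y y = form E (invmx E *m y) (invmx E *m y).
    by rewrite /form trmx_mul iT -!mulmxA mulKVmx.
  apply: Epos; apply: contraNneq y0 => h.
  by rewrite -(mulKVmx uE y) h mulmx0.
have ige0 y : 0 <= form (invmx E) y y.
  have [->|/ipos/ltW//] := eqVneq y 0; by rewrite /form mulmx0 mxE.
pose S := [set c : R | forall y, c * sqnorm y <= form (invmx E) y y].
have S0 : S 0 by move=> y; rewrite mul0r.
pose e0 : 'cV[R]_s := delta_mx (Ordinal s0) ord0.
have e00 : e0 != 0.
  by apply/eqP => /matrixP/(_ (Ordinal s0) ord0)/eqP; rewrite !mxE !eqxx oner_eq0.
have ub_y y : y != 0 -> ubound S (form (invmx E) y y / sqnorm y).
  by move=> y0 c /(_ y); rewrite ler_pdivlMr// sqnorm_gt0.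
have Ssup : has_sup S by split; [exists 0|exists (form (invmx E) e0 e0 / sqnorm e0); exact: ub_y].
pose m := sup S.
have mS : S m.
  move=> y; have [->|y0] := eqVneq y 0.
    by rewrite sqnorm0 mulr0 ige0.
  rewrite -ler_pdivlMr ?sqnorm_gt0//; apply: ge_sup; [by exists 0|exact: ub_y].
have m0 : 0 <= m by apply: ub_le_sup; [exact: Ssup.2|].
pose A := invmx E - m%:M.
have formA y : form A y y = form (invmx E) y y - m * sqnorm y.
  have e (a b : 'M[R]_1) c : (a - c *: b) 0 0 = a 0 0 - c * b 0 0 by rewrite !mxE.
  by rewrite /form /A mulmxBr mulmxBl mul_mx_scalar -scalemxAl e.
have AT : A^T = A by rewrite /A linearB/= iT tr_scalar_mx.
have Apos y : 0 <= form A y y by rewrite formA subr_ge0; exact: mS.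
have nA : A \notin unitmx.
  apply/negP => uA; have [c c0 hc] := psd_unit_coercive AT Apos uA.
  have : m + c <= m.
    apply: ub_le_sup; first exact: Ssup.2.
    by move=> y; rewrite mulrDl -lerBrDl -formA.
  by rewrite gerDl leNgt c0.
have [v v0 vA] : exists2 v : 'rV[R]_s, v != 0 & v *m A = 0.
  have [//|h] := pselect (exists2 v : 'rV[R]_s, v != 0 & v *m A = 0).
  move: nA; rewrite unitmx_of_kernel// => v vA; apply/eqP; apply: contraT => v0.
  by exfalso; apply: h; exists v.
have vE : v *m invmx E = m *: v.
  by move: vA; rewrite /A mulmxBr mul_mx_scalar => /eqP; rewrite subr_eq0 => /eqP.
have mn0 : m != 0.
  apply: contraNneq v0 => m00; move: vE; rewrite m00 scale0r => h.
  by rewrite -(mulmxKV uE v) h mul0mx.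
have mpos : 0 < m by rewrite lt_neqAle eq_sym mn0.
have vE' : v *m E = m^-1 *: v.
  by rewrite -[LHS]scale1r -(mulVf mn0) -scalerA scalemxAl -vE mulmxKV.
have eig : eigenvalue E m^-1 by apply/eigenvalueP; exists v.
(* [lambda_max] is a [sup], so the eigenvalue [m^-1] lies below it only once the set of eigenvalues
   is known to be bounded above. *)
have ubE : ubound [set a | eigenvalue E a] m^-1.
  move=> a /= /eigenvalueP[w wE w0].
  have wT0 : w^T != 0 by apply: contraNneq w0 => h; rewrite -(trmxK w) h trmx0.
  have wE2 : form E w^T w^T = a * sqnorm w^T.
    by rewrite /form /sqnorm trmxK wE -scalemxAl mxE.
  have a0 : 0 < a by have := Epos _ wT0; rewrite -/(form E _ _) wE2 pmulr_lgt0// sqnorm_gt0.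
  have wi : w *m invmx E = a^-1 *: w.
    by rewrite -{1}[w]scale1r -(mulVf (lt0r_neq0 a0)) -scalerA -wE -!scalemxAl mulmxK.
  have := mS w^T; rewrite {1}/form trmxK wi -scalemxAl mxE -[X in a^-1 * X](_ : sqnorm w^T = _); last first.
    by rewrite /sqnorm trmxK.
  rewrite ler_pM2r ?sqnorm_gt0// => ma.
  by rewrite -(invrK a) lef_pV2 ?posrE ?invr_gt0.
have lam : m^-1 <= lambda_max E.
  by apply: ub_le_sup; [exists m^-1|].
rewrite sqE (le_trans _ (mS x))// ler_wpM2r ?sqnorm_ge0//.
rewrite -(invrK m) lef_pV2 ?posrE ?invr_gt0//.
by rewrite (lt_le_trans _ lam)// invr_gt0.
Qed.

End quadratic_forms.

Section gaussian_decay.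
Context {R : realType} {s : nat} (s_gt0 : (0 < s)%N).
Variables (M : R) (mu mu0 : 'cV[R]_s) (Sigma Sigma0 L : 'M[R]_s).
Hypotheses (Sigma_pd : sym_posdef Sigma) (Sigma0_pd : sym_posdef Sigma0) (LLT : L *m L^T = Sigma).
Hypothesis eig_cond : 0 < (lambda_max Sigma0)^-1 - 2 * M.

Lemma sqnormD_le (x y : 'cV[R]_s) : sqnorm (x + y) <= 2 * sqnorm x + 2 * sqnorm y.
Proof.
rewrite !sqnormE !mulr_sumr -big_split/= ler_sum// => i _; rewrite mxE.
by have := sqr_ge0 (x i ord0 - y i ord0); rewrite sqrrB sqrrD; lra.
Qed.

(** Young's inequality [2 |a b| <= h a^2 + b^2 / h] in each coordinate. The form is two-sided
    because [M] may have either sign. *)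
Lemma sqnorm_perturb (h : R) (x y : 'cV[R]_s) : 0 < h ->
  `|sqnorm (x + y) - sqnorm x| <= h * sqnorm x + (h^-1 + 1) * sqnorm y.
Proof.
move=> h0; have h0' : h^-1 * h = 1 by rewrite mulVf// gt_eqF.
have i0 : 0 < h^-1 by rewrite invr_gt0.
rewrite !sqnormE -sumrB !mulr_sumr -big_split/= (le_trans (ler_norm_sum _ _ _))// ler_sum// => i _.
rewrite mxE; set a := x i ord0; set b := y i ord0.
have e1 : 0 <= h^-1 * (h * a + b) ^+ 2 by rewrite mulr_ge0 ?sqr_ge0// ltW.
have e2 : 0 <= h^-1 * (h * a - b) ^+ 2 by rewrite mulr_ge0 ?sqr_ge0// ltW.
have E1 : h^-1 * (h * a + b) ^+ 2 = h * a ^+ 2 + 2 * (a * b) + h^-1 * b ^+ 2 by field; rewrite gt_eqF.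
have E2 : h^-1 * (h * a - b) ^+ 2 = h * a ^+ 2 - 2 * (a * b) + h^-1 * b ^+ 2 by field; rewrite gt_eqF.
move: e1 e2; rewrite E1 E2 => e1 e2; have b2 := sqr_ge0 b.
by rewrite sqrrD ler_norml mulr2n; apply/andP; split; lra.
Qed.

Lemma unitmx_L : L \in unitmx.
Proof.
have := posdef_unit Sigma_pd; rewrite -LLT !unitmxE det_mulmx unitrM.
by case/andP.
Qed.

Lemma exponent_decay : exists c K : R, 0 < c /\ forall z : 'cV[R]_s,
  M * sqnorm (mu + L *m z) - 2^-1 * sqnorm_mx Sigma0 (mu + L *m z - mu0) <= K - c * sqnorm z.
Proof.
have rl y := @rayleigh _ _ Sigma0 y s_gt0 Sigma0_pd.
move: eig_cond rl; set l := (lambda_max Sigma0)^-1 => l0 rl.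
(* [l / 2 - M = 2 rho]: one [rho] absorbs the error of recentring at [mu0], the other supplies the
   decay in [z]. *)
pose rho := l / 4 - M / 2; have rho0 : 0 < rho by rewrite /rho; lra.
pose h := rho / (`|M| + 1); have h0 : 0 < h by rewrite divr_gt0// ltr_wpDl.
have Mh : `|M| * h <= rho.
  by rewrite /h mulrCA ger_pMr// ler_pdivrMr ?ltr_wpDl// mul1r lerDl.
have [C C0 hC] := sqnorm_mulmx_le (invmx L).
exists (rho / (2 * C)), (`|M| * ((h^-1 + 1) * sqnorm mu0) + rho * sqnorm (mu0 - mu)).
split=> [|z]; first by rewrite divr_gt0// mulr_gt0.
set y := mu + L *m z - mu0.
have xE : mu + L *m z = y + mu0 by rewrite /y subrK.
have zE : z = invmx L *m (y + (mu0 - mu)).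
  by rewrite /y addrA subrK addrC addKr mulKmx// unitmx_L.
have h1 := rl y.
have h2 : M * sqnorm (mu + L *m z) <= M * sqnorm y + `|M| * (h * sqnorm y + (h^-1 + 1) * sqnorm mu0).
  rewrite -lerBlDl -mulrBr xE (le_trans (ler_norm _))// normrM ler_wpM2l//.
  exact: sqnorm_perturb.
have h3 : sqnorm z <= C * (2 * sqnorm y + 2 * sqnorm (mu0 - mu)).
  by rewrite {1}zE (le_trans (hC _))// ler_wpM2l ?sqnormD_le// ltW.
have h4 : rho / (2 * C) * sqnorm z <= rho * sqnorm y + rho * sqnorm (mu0 - mu).
  have -> : rho * sqnorm y + rho * sqnorm (mu0 - mu) = rho / (2 * C) * (C * (2 * sqnorm y + 2 * sqnorm (mu0 - mu))).
    by field; rewrite gt_eqF.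
  by rewrite ler_wpM2l// ltW// divr_gt0// mulr_gt0.
have h5 : `|M| * (h * sqnorm y) <= rho * sqnorm y by rewrite mulrA ler_wpM2r// sqnorm_ge0.
have E : l * sqnorm y = 4 * (rho * sqnorm y) + 2 * (M * sqnorm y) by rewrite /rho; field.
by move: h1 h2 h4 h5; rewrite E mulrDr; lra.
Qed.

Lemma expRN_sqr_le (c : R) : 0 < c -> exists2 K : R, 0 <= K & forall t, expR (- (c * t ^+ 2)) <= K * weight (- 2) t.
Proof.
move=> c0; exists (2 * (1 + c^-1)); first by rewrite mulr_ge0// addr_ge0// invr_ge0 ltW.
move=> t; have w0 : 0 < 1 + `|t| by rewrite ltr_wpDr.
rewrite expRN /weight powRN -invf_div invf_div ler_pdivlMr ?powR_gt0// mulrC ler_pdivrMr ?expR_gt0//.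
rewrite -[2]/(2%:R) powR_mulrn ?(ltW w0)//.
apply: (@le_trans _ _ (2 * (1 + c^-1) * (1 + c * t ^+ 2))); last first.
  by rewrite ler_wpM2l ?expR_ge1Dx// mulr_ge0// addr_ge0// invr_ge0 ltW.
apply: (@le_trans _ _ (2 * (1 + t ^+ 2))).
  rewrite -(real_normK (num_real t)); have := sqr_ge0 (`|t| - 1).
  by rewrite sqrrB sqrrD mulr1 expr1n mul1r; lra.
have -> : 2 * (1 + c^-1) * (1 + c * t ^+ 2) = 2 * (1 + t ^+ 2) + 2 * (c^-1 + c * t ^+ 2) by field; rewrite gt_eqF.
by have i0 : 0 < c^-1; [rewrite invr_gt0|have := mulr_ge0 (ltW c0) (sqr_ge0 t); lra].
Qed.

Lemma gaussian_decay : exists t K : R, [/\ 0 < t, 0 <= K & forall z : 'cV[R]_s,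
  expR (M * sqnorm (mu + L *m z)) * (growth t z * expR (- (2^-1 * sqnorm_mx Sigma0 (mu + L *m z - mu0))))
   <= K * \prod_i weight (- 2) (z i ord0)].
Proof.
have [c [K [c0 hK]]] := exponent_decay.
have c2 : 0 < c / 2 by rewrite divr_gt0.
have [K' K'0 hK'] := expRN_sqr_le c2.
(* Half of the decay rate pays for [growth t] with [t = c / 2]; the other half is turned into the
   coordinatewise weights. *)
exists (c / 2), (expR K * K' ^+ s); split => //; first by rewrite mulr_ge0 ?expR_ge0// exprn_ge0.
move=> z; apply: (@le_trans _ _ (expR K * expR (- (c / 2 * sqnorm z)))).
  rewrite /growth -!expRD ler_expR; have := hK z; set u := M * _; set v := _ / _ * _.
  have -> : c * sqnorm z = v + v by rewrite /v; field.
  by lra.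
rewrite -[leRHS]mulrA ler_wpM2l ?expR_ge0//.
have -> : K' ^+ s * \prod_i weight (- 2) (z i ord0) = \prod_i (K' * weight (- 2) (z i ord0)).
  by rewrite big_split/= prodr_const card_ord.
rewrite sqnormE mulr_sumr -sumrN expR_sum.
by apply: ler_prod => i _; rewrite expR_ge0 hK'.
Qed.

Lemma derivs_le_G_tIS (f Psi : 'cV[R]_s -> R) (n : nat) (nu B : R) : 1 < nu -> Ck s (G0 f Psi n) -> 0 < B ->
  (forall (a : 'I_s -> nat) (z : 'cV[R]_s), (\sum_(i < s) a i <= s)%N ->
    `|mderive a (G0 f Psi n) z| <= B * expR (M * sqnorm z)) ->
  derivs_le s (G_tIS f Psi n nu mu mu0 Sigma Sigma0 L) (fun z => \prod_i weight (- 2) (z i ord0)).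
Proof.
move=> nu1 cG B0 bG; have [t [K [t0 K0 hK]]] := gaussian_decay.
have hG : derivs_le s (G0 f Psi n) (fun z => expR (M * sqnorm z)).
  apply: Ck_derivs_le => // w ws; exists B; first exact: ltW.
  move=> z; rewrite partials_mderive; last exact: Ck_le cG.
  by apply: bG; rewrite sum_count_mem.
have h1 := derivs_le_affine mu L (fun x => expR_ge0 (M * sqnorm x)) hG.
exact: (derivs_le_trans K0 hK (derivs_leM h1 (derivs_le_W_t nu1 mu mu0 Sigma Sigma0 L s t0))).
Qed.

End gaussian_decay.

Section mixed_partials.
Context {R : realType} {s : nat} (G : 'cV[R]_s -> R).
Local Notation e i := (delta_mx i ord0 : 'cV[R]_s).

Definition col_of (l : seq R) : 'cV[R]_s := \col_i nth 0 l i.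

Definition bit_word (b : seq bool) : seq 'I_s := [seq i : 'I_s <- enum 'I_s | nth false b i].

Definition mixed_partial (b : seq bool) (l : seq R) : R := partials (bit_word b) G (col_of l).

Lemma size_bit_word b : (size (bit_word b) <= s)%N.
Proof. by rewrite size_filter (leq_trans (count_size _ _))// size_enum_ord. Qed.

Lemma mixed_partial0 n l : mixed_partial (nseq n false) l = G (col_of l).
Proof.
rewrite /mixed_partial /bit_word (eq_filter (a2 := pred0)) ?filter_pred0// => i.
by rewrite nth_nseq; case: ifP.
Qed.

(** Equality holds only up to order, since bits of [cs] may already be set before position [j]; this
    is where the symmetry of partial derivatives enters the representation. *)
Lemma perm_bit_word cs b (j : 'I_s) : j = size cs :> nat ->
  perm_eq (bit_word (cs ++ true :: b)) (j :: bit_word (cs ++ false :: b)).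
Proof.
move=> jE; apply: uniq_perm.
- by rewrite filter_uniq// enum_uniq.
- by rewrite /= filter_uniq ?enum_uniq// mem_filter nth_cat jE ltnn subnn.
move=> i; have memb b' : (i \in bit_word b') = nth false b' i by rewrite mem_filter mem_enum andbT.
rewrite in_cons !memb !nth_cat -val_eqE/= jE.
case: (ltngtP i (size cs)) => // [ij|->]; last by rewrite subnn.
by rewrite -(subnSK ij).
Qed.

Lemma col_ofE xs l (j : 'I_s) (x : R) : j = size xs :> nat ->
  col_of (xs ++ x :: l) = col_of (xs ++ 0 :: l) + x *: e j.
Proof.
move=> jE; apply/colP => i; rewrite !mxE !nth_cat eqxx andbT -val_eqE/= jE.
case: (ltngtP i (size xs)) => [ij|ij|->]; rewrite ?mulr0 ?addr0//.
  by rewrite -(subnSK ij).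
by rewrite subnn/= add0r mulr1.
Qed.

(** Generalised over a prefix [cs], [xs] of coordinates already fixed, because [mixed_derivatives]
    descends into the tail. *)
Lemma mixed_derivatives_partial : Ck s G -> mixed_derivatives s mixed_partial.
Proof.
move=> cG; suff : forall m cs xs, size cs = size xs -> (size cs + m = s)%N ->
    mixed_derivatives m (fun b l => mixed_partial (cs ++ b) (xs ++ l)).
  by move=> /(_ s [::] [::]); exact.
elim=> [//|m IH] cs xs csxs sm; split; last first.
  move=> c x; rewrite (_ : (fun _ _ => _) = fun b l => mixed_partial (rcons cs c ++ b) (rcons xs x ++ l)).
    by apply: IH; rewrite !size_rcons ?csxs// addSnnS -csxs.
  by apply/funext => b; apply/funext => l; rewrite !cat_rcons.
move=> b l sb sl.
have js : (size cs < s)%N by rewrite -sm addnS ltnS leq_addr.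
pose j : 'I_s := Ordinal js; have jc : j = size cs :> nat by []. have jx : j = size xs :> nat by rewrite -csxs.
have pw := perm_bit_word b jc.
have sw : ((size (bit_word (cs ++ false :: b))).+1 <= s)%N.
  by rewrite -(perm_size pw : _ = (size (bit_word _)).+1) size_bit_word.
pose H := partials (bit_word (cs ++ false :: b)) G.
have cH : Ck 1 H by apply: Ck_partials; exact: Ck_le cG.
have dH y : derivable H y (e j) by have [_ /(_ j)[]] := cH.
have cdH : continuous (partial j H) by have [_ /(_ j)[_ []]] := cH.
have tE : partials (bit_word (cs ++ true :: b)) G = partial j H.
  rewrite (perm_partials pw)//; apply: Ck_le cG; exact: size_bit_word.
have lineE : (fun x : R => mixed_partial (cs ++ false :: b) (xs ++ x :: l)) =
    fun x : R => H (col_of (xs ++ 0 :: l) + x *: e j).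
  by apply/funext => x; rewrite /mixed_partial (col_ofE l x jx).
have lineE' (x : R) : mixed_partial (cs ++ true :: b) (xs ++ x :: l) = partial j H (col_of (xs ++ 0 :: l) + x *: e j).
  by rewrite /mixed_partial (col_ofE l x jx) tE.
split.
  by move=> x; rewrite lineE lineE'; apply: is_derive_line.
rewrite (_ : (fun x => _) = fun x : R => partial j H (col_of (xs ++ 0 :: l) + x *: e j)); last exact/funext.
move=> x; have cl : (fun x : R => col_of (xs ++ 0 :: l) + x *: e j) @ x --> col_of (xs ++ 0 :: l) + x *: e j.
  pose V : normedModType R := 'cV[R]_s.
  exact: (cvgD (cvg_cst _) (@cvgZr_tmp R V _ _ _ (fun x : R => x) x (e j) cvg_id)).
exact: (continuous_comp cl (cdH _)).
Qed.

Lemma mem_allbits b : b \in allbits (size b).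
Proof.
elim: b => [//|c b IH] /=; rewrite mem_cat; apply/orP.
by case: c; [right|left]; apply: map_f.
Qed.

Lemma weight_bounded_partial : derivs_le s G (fun z => \prod_i weight (- 2) (z i ord0)) ->
  exists C, weight_bounded s mixed_partial C.
Proof.
move=> hG; have /choice[K hK] : forall b, exists K : R, 0 <= K /\
    forall z, `|partials (bit_word b) G z| <= K * \prod_i weight (- 2) (z i ord0).
  move=> b; have : derivs_le 0 (partials (bit_word b) G) (fun z => \prod_i weight (- 2) (z i ord0)).
    apply: derivs_le_partials; rewrite add0n.
    exact: derivs_le_le (size_bit_word b) hG.
  by move=> /derivs_le_bound[K K0 hK]; exists K.
exists (\sum_(b <- allbits s) K b) => b l sb sl.
have [K0 hb] := hK b.
apply: (le_trans (hb _)).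
have -> : \prod_(i < s) weight (- 2) (col_of l i ord0) = \prod_(x <- l) weight (- 2) x.
  rewrite [RHS](big_nth 0) sl big_mkord; apply: eq_bigr => i _; by rewrite mxE.
rewrite ler_wpM2r//; first by apply: prodr_ge0 => x _; rewrite (ltW (weight_gt0 _ _)).
rewrite -sb (big_rem b) ?mem_allbits//= lerDl sumr_ge0// => b' _.
by have [] := hK b'.
Qed.

End mixed_partials.

(** * The root mean squared error *)

(** [k] exceeds [1 / nu] by [eta <= eps], so [k / 2] spends at most [eps / 2] of the slack, and
    [3 d] spends at most as much again. The remaining choices give [p k = 1 + eta nu / 2], above
    [2 alpha + 1 = 1 + eta nu / 4]. *)
Lemma exponents_exist (R : realType) (nu eps : R) : 1 < nu -> 0 < eps ->
  exists alpha p k d x : R, [/\ 0 < alpha, 2 * alpha + 1 < nu, 0 <= p < nu, 0 <= k <= 1 & 2 * alpha + 1 < p * k] /\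
    [/\ 0 < d, 0 < x <= 1, (2 - k) * x = 1 + d & (2 * d - 1) / x / 2 <= -1 + (2 * nu)^-1 + eps].
Proof.
move=> nu1 e0; have nu0 : 0 < nu by lra.
pose i := nu^-1; have inu : nu * i = 1 by rewrite /i mulfV// gt_eqF.
have i0 : 0 < i by rewrite invr_gt0.
have i1 : i < 1 by rewrite invf_lt1.
(* The second bound keeps [k] below [1] and [2 alpha + 1] below [nu]. *)
pose eta := Num.min eps ((1 - i) / 2).
have eta0 : 0 < eta by rewrite lt_min e0/=; lra.
have eta1 : eta <= eps by rewrite ge_min lexx.
have eta2 : eta <= (1 - i) / 2 by rewrite ge_min lexx orbT.
pose k := i + eta; have k0 : 0 < k by rewrite /k; lra.
have k1 : k < 1 by rewrite /k; lra.
(* [d <= 1 - k] gives [x = (1 + d) / (2 - k) <= 1]. *)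
pose d := Num.min (eps / 6) (1 - k).
have d0 : 0 < d by rewrite lt_min; apply/andP; split; lra.
have d1 : d <= eps / 6 by rewrite ge_min lexx.
have d2 : d <= 1 - k by rewrite ge_min lexx orbT.
have en0 : 0 < eta * nu by rewrite mulr_gt0.
have en1 : eta * nu <= (nu - 1) / 2.
  have := ler_wpM2r (ltW nu0) eta2.
  by rewrite mulrAC mulrBl mul1r [i * _]mulrC inu.
pose p := nu * (1 + eta * nu / 2) / (1 + eta * nu).
have pk : p * k = 1 + eta * nu / 2.
  have -> : k = (1 + eta * nu) / nu by rewrite mulrDl mul1r mulfK ?gt_eqF.
  by rewrite /p; field; apply/andP; split; rewrite gt_eqF//; lra.
have k2 : 0 < 2 - k by lra.
have p0 : 0 <= p.
  by rewrite /p; apply: divr_ge0; [apply: mulr_ge0|]; lra.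
have pn : p < nu.
  rewrite /p ltr_pdivrMr ?ltr_pM2l//; lra.
exists (eta * nu / 8), p, k, d, ((1 + d) / (2 - k)); split; split.
- by lra.
- by lra.
- by rewrite p0 pn.
- by apply/andP; split; lra.
- by rewrite pk; lra.
- by [].
- by rewrite divr_gt0 ?ler_pdivrMr//=; lra.
- by rewrite mulrCA mulfV ?mulr1// gt_eqF.
have -> : (2 * nu)^-1 = i / 2 by rewrite invfM mulrC.
have d3 : 0 < 1 + d by lra.
set y := i / 2.
have -> : (2 * d - 1) / ((1 + d) / (2 - k)) / 2 = (2 * d - 1) * ((2 - k) / 2) / (1 + d).
  by field; apply/andP; split; rewrite gt_eqF//; lra.
rewrite ler_pdivrMr//.
have h1 : 0 <= d * k by rewrite mulr_ge0// ltW.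
have h2 : k / 2 + 3 * d <= y + eps by rewrite /y /k; lra.
have h3 := ler_wpM2r (ltW d3) h2; have h4 := sqr_ge0 d.
apply: (@le_trans _ _ ((-1 + (k / 2 + 3 * d)) * (1 + d))); last first.
  by rewrite ler_wpM2r ?(ltW d3)//; lra.
rewrite -subr_ge0; have -> : (-1 + (k / 2 + 3 * d)) * (1 + d) - (2 * d - 1) * ((2 - k) / 2) = 3 / 2 * (d * k) + 3 * d ^+ 2 by field.
by lra.
Qed.

Section root_mean_square.
Context {R : realType} {s : nat} (nu : R) (nu_gt1 : 1 < nu) (G : 'cV[R]_s -> R).

Lemma quadrature_error_lattice (N : nat) (z : 'I_s -> nat) (Delta : s.-tuple R) :
  I_phi nu G - lattice_rule nu N z G Delta =
  quadrature_error nu (mixed_partial G) (fun (k : 'I_N) i => k%:R * (z i)%:R / N%:R) Delta.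
Proof.
congr (_ - _ * _).
  apply: eq_Rintegral => t _; rewrite mixed_partial0; congr (G _ * _).
  by apply/colP => i; rewrite !mxE (tnth_nth 0).
apply: eq_bigr => k _; rewrite mixed_partial0; congr G.
by apply/colP => i; rewrite !mxE nth_shifted.
Qed.

Lemma rmse_le (alpha C : R) : 0 < alpha -> 2 * alpha + 1 < nu -> Ck s G -> weight_bounded s (mixed_partial G) C ->
  exists2 K, 0 <= K & forall N (z : 'I_s -> nat) E, (0 < N)%N -> 0 <= E ->
    (forall u, u != finset.set0 -> set_error nu alpha N z u <= E) ->
    (rmse nu N z G <= (K * Num.sqrt E)%:E)%E.
Proof.
move=> a0 a1 cG bG; set m := size (behead (allbits s)).
(* One factor [m] comes from squaring a sum of [m] terms, the other from adding up [m] bounds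
   [E]. *)
pose K := m%:R * energy_bound nu s C * m%:R.
have K0 : 0 <= K by rewrite !mulr_ge0// ltW// energy_bound_gt0.
exists (Num.sqrt K) => [|N z E N0 E0 hE]; first exact: sqrtr_ge0.
have bS b : b \in behead (allbits s) -> set_error nu alpha N z [set i : 'I_s | nth false b i]%SET <= E.
  move=> hb; apply: hE; apply/finset.set0Pn.
  have /(has_nthP false)[i ib hi] := has_behead_allbits hb.
  have is_ : (i < s)%N by rewrite -(size_allbits (mem_behead hb)).
  by exists (Ordinal is_); rewrite inE.
rewrite -sqrtrM// -[(Num.sqrt _)%:E]/(sqrte (K * E)%:E).
rewrite /rmse lee_sqrt ?lee_fin ?(mulr_ge0 K0 E0)//.
under eq_integral do rewrite quadrature_error_lattice.
apply: (le_trans (mean_squared_error_le nu_gt1 a0 a1 (mixed_derivatives_partial cG) bG N0 _)).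
rewrite lee_fin /K -[leRHS]mulrA ler_wpM2l ?(mulr_ge0 (ler0n _ _) (ltW (energy_bound_gt0 nu_gt1 s C)))//.
have -> : m%:R * E = \sum_(b <- behead (allbits s)) E.
  by rewrite big_const_seq count_predT iter_addr_0 mulr_natl.
rewrite !big_seq; apply: ler_sum => b hb.
by rewrite lattice_energyE// bS.
Qed.

End root_mean_square.

Theorem theorem5p1 (R : realType) (s : nat) (s_ge1 : (1 <= s)%N)
    (nu : R) (nu_gt1 : 1 < nu) (n : nat)
    (f Psi : 'cV[R]_s -> R) (mu mu0 : 'cV[R]_s) (Sigma Sigma0 L : 'M[R]_s)
    (Sigma_pd : sym_posdef Sigma) (Sigma0_pd : sym_posdef Sigma0)
    (LLT : L *m L^T = Sigma)
    (gamma : {set 'I_s} -> R) (gamma_gt0 : forall u, 0 < gamma u)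
    (G0_Cs : Ck s (G0 f Psi n))
    (B M : R) (B_gt0 : 0 < B)
    (G0_bound : forall (a : 'I_s -> nat) (z : 'cV[R]_s),
      (\sum_(i < s) a i <= s)%N ->
      `|mderive a (G0 f Psi n) z| <= B * expR (M * sqnorm z))
    (eig_cond : 0 < (lambda_max Sigma0)^-1 - 2 * M) :
  forall eps : R, 0 < eps ->
  exists alpha C : R,
    [/\ 0 < alpha, 2 * alpha + 1 < nu &
      forall N : nat, (2 <= N)%N ->
        (exists z : 'I_s -> nat, cbc_vector gamma nu alpha N z) /\
        (forall z : 'I_s -> nat, cbc_vector gamma nu alpha N z ->
          (rmse nu N z (G_tIS f Psi n nu mu mu0 Sigma Sigma0 L)
            <= (C * N%:R `^ (-1 + (2 * nu)^-1 + eps))%:E)%E)].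
Proof.
move=> eps eps_gt0.
have hG := derivs_le_G_tIS s_ge1 mu mu0 Sigma_pd Sigma0_pd LLT eig_cond nu_gt1 G0_Cs B_gt0 G0_bound.
have [C bG] := weight_bounded_partial hG.
have [alpha [p [k [d [x [[a0 a1 hp hk apk] [d0 hx xE le_e]]]]]]] := exponents_exist nu_gt1 eps_gt0.
have [K K0 hK] := rmse_le nu_gt1 a0 a1 (derivs_le_Ck hG) bG.
have [C1 C1_gt0 hC1] := @cbc_set_error _ _ nu_gt1 _ a0 a1 _ _ _ _ _ _ gamma_gt0 hp hk apk d0 hx xE.
exists alpha, (K * Num.sqrt C1); split => // N N2; split; first exact: cbc_vector_exists.
move=> z hz; have N0 : (0 < N)%N by exact: ltnW.
apply: (le_trans (hK N z _ N0 _ (fun u hu => hC1 N z N2 hz u hu))).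
  by rewrite mulr_ge0 ?powR_ge0// ltW.
rewrite lee_fin -mulrA ler_wpM2l// sqrtrM ?(ltW C1_gt0)// ler_wpM2l ?sqrtr_ge0//.
(* The square root halves the exponent of [N] furnished by [cbc_set_error]; [le_e] compares the
   result with the claimed rate. *)
by rewrite -powR12_sqrt ?powR_ge0// -powRrM ler_powR ?ler1n.
Qed.
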